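(* For each $2<p<\infty$, there exist a bounded domain $\Omega\subset\mathbb C$ and a point $z\in\Omega$ such that $$K_p(\cdot,z)\neq K_{2,p,z}(\cdot,z).$$
   Context: All integrals are with respect to Lebesgue measure. $A^p(\Omega)=\{f\in\mathcal O(\Omega):\|f\|_p^p:=\int_\Omega|f|^p<\infty\}$. For $z\in\Omega$ put $m_p(z):=\inf\{\|f\|_p: f\in A^p(\Omega),\ f(z)=1\}$; for $1\le p<\infty$ the infimum is attained by exactly one function $m_p(\cdot,z)$. Set $K_p(z):=m_p(z)^{-p}$ and $K_p(\cdot,z):=m_p(\cdot,z)K_p(z)$. For a measurable real-valued function $\varphi$ on $\Omega$ (defined almost everywhere) such that each point of $\Omega$ has a neighborhood on which $e^{\alpha\varphi}$ is integrable for some $\alpha>0$, set $A^2(\Omega,\varphi):=\{f\in\mathcal O(\Omega):\int_\Omega|f|^2e^{-\varphi}<\infty\}$. It is a Hilbert space with a unique reproducing kernel $K_{\Omega,\varphi}(\cdot,\cdot)$, i.e. $K_{\Omega,\varphi}(\cdot,w)\in A^2(\Omega,\varphi)$ and $f(w)=\int_\Omega f\,\overline{K_{\Omega,\varphi}(\cdot,w)}\,e^{-\varphi}$ for all $f\in A^2(\Omega,\varphi)$, $w\in\Omega$. For $p\ge1$ and $z\in\Omega$, $K_{2,p,z}(\cdot,\cdot):=K_{\Omega,\varphi}(\cdot,\cdot)$ with $\varphi=(2-p)\log|m_p(\cdot,z)|$. *)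

(* Defs.v *)
From HB Require Import structures.
From mathcomp Require Export all_boot all_order all_algebra.
From mathcomp Require Export all_classical all_reals all_analysis.
From mathcomp Require Export complex.

Set Implicit Arguments.
Unset Strict Implicit.
Unset Printing Implicit Defensive.

Import Order.TTheory GRing.Theory Num.Theory.
Import numFieldNormedType.Exports.
Local Open Scope classical_set_scope.
Local Open Scope ring_scope.
Local Open Scope complex_scope.

(* R[i] carries its usual topology and its structure of normed space over
   itself through the regular module R[i]^o. *)
Notation Cplx R := (R[i]^o).

Definition bounded_domain (R : realType) (Omega : set (Cplx R)) : Prop :=
  [/\ Omega !=set0, open Omega, connected Omega & bounded_set Omega].

(* [derivable] is taken over the scalar field R[i]: complex differentiability.
   Functions on Omega are represented by total functions; what they do outside
   Omega is irrelevant everywhere below. *)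
Definition holomorphic_on (R : realType) (Omega : set (Cplx R))
    (f : Cplx R -> Cplx R) : Prop :=
  forall w, Omega w -> derivable f w 1.

Definition cabs (R : realType) (w : Cplx R) : R := ComplexField.Normc.normc w.

(* Integration over Omega with respect to planar Lebesgue measure, C being
   identified with R * R. *)
Definition cintegral (R : realType) (Omega : set (Cplx R))
    (F : Cplx R -> \bar R) : \bar R :=
  (\int[(@lebesgue_measure R \x @lebesgue_measure R)%E]_(u in
      [set u : R * R | Omega (u.1 +i* u.2)]) F (u.1 +i* u.2))%E.

Definition cintegralC (R : realType) (Omega : set (Cplx R))
    (F : Cplx R -> Cplx R) : Cplx R :=
  fine (cintegral Omega (fun w => (complex.Re (F w))%:E)) +i*
  fine (cintegral Omega (fun w => (complex.Im (F w))%:E)).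

Definition bergman_space (R : realType) (Omega : set (Cplx R)) (p : R) :
    set (Cplx R -> Cplx R) :=
  [set f | holomorphic_on Omega f /\
           (cintegral Omega (fun w => (cabs (f w) `^ p)%:E) < +oo)%E].

Definition bergman_norm (R : realType) (Omega : set (Cplx R)) (p : R)
    (f : Cplx R -> Cplx R) : R :=
  fine (cintegral Omega (fun w => (cabs (f w) `^ p)%:E)) `^ p^-1.

Definition normalized_at (R : realType) (Omega : set (Cplx R)) (p : R)
    (z : Cplx R) : set (Cplx R -> Cplx R) :=
  [set f | bergman_space Omega p f /\ f z = 1].

(* m_p(z) *)
Definition min_norm (R : realType) (Omega : set (Cplx R)) (p : R)
    (z : Cplx R) : R :=
  inf [set bergman_norm Omega p f | f in normalized_at Omega p z].

Definition is_minimizer (R : realType) (Omega : set (Cplx R)) (p : R)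
    (z : Cplx R) (f : Cplx R -> Cplx R) : Prop :=
  normalized_at Omega p z f /\ bergman_norm Omega p f = min_norm Omega p z.

(* m_p(., z): a minimizer exists for 1 <= p, and any two of them agree on
   Omega, so that only the values outside Omega depend on the choice made by
   [xget]. *)
Definition minimizer (R : realType) (Omega : set (Cplx R)) (p : R)
    (z : Cplx R) : Cplx R -> Cplx R :=
  xget (fun=> 0) [set f | is_minimizer Omega p z f].

(* K_p(z) *)
Definition pBergman_diag (R : realType) (Omega : set (Cplx R)) (p : R)
    (z : Cplx R) : R :=
  min_norm Omega p z `^ (- p).

(* K_p(w, z) *)
Definition pBergman (R : realType) (Omega : set (Cplx R)) (p : R)
    (w z : Cplx R) : Cplx R :=
  minimizer Omega p z w * (pBergman_diag Omega p z)%:C.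

Definition weighted_bergman_space (R : realType) (Omega : set (Cplx R))
    (phi : Cplx R -> R) : set (Cplx R -> Cplx R) :=
  [set f | holomorphic_on Omega f /\
    (cintegral Omega (fun w => (cabs (f w) ^+ 2 * expR (- phi w))%:E)
       < +oo)%E].

Definition is_reproducing_kernel (R : realType) (Omega : set (Cplx R))
    (phi : Cplx R -> R) (K : Cplx R -> Cplx R -> Cplx R) : Prop :=
  forall w, Omega w ->
    weighted_bergman_space Omega phi (K^~ w) /\
    forall f, weighted_bergman_space Omega phi f ->
      f w = cintegralC Omega
              (fun u => f u * (K u w)^* * (expR (- phi u))%:C).

(* K_{Omega, phi}: unique on Omega x Omega, with the same proviso as for
   [minimizer]. *)
Definition weighted_bergman_kernel (R : realType) (Omega : set (Cplx R))
    (phi : Cplx R -> R) : Cplx R -> Cplx R -> Cplx R :=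
  xget (fun _ _ => 0) [set K | is_reproducing_kernel Omega phi K].

(* The weight (2 - p) log |m_p(., z)|.  At the zeros of m_p(., z), a null set,
   it takes the irrelevant value 0, since ln 0 = 0. *)
Definition minimizer_weight (R : realType) (Omega : set (Cplx R)) (p : R)
    (z : Cplx R) : Cplx R -> R :=
  fun w => (2 - p) * ln (cabs (minimizer Omega p z w)).

(* K_{2, p, z}(., .) *)
Definition K2p (R : realType) (Omega : set (Cplx R)) (p : R) (z : Cplx R) :
    Cplx R -> Cplx R -> Cplx R :=
  weighted_bergman_kernel Omega (minimizer_weight Omega p z).

(* Main.v *)
Require Import Defs.
From mathcomp Require Import measurable_realfun ring lra.
Import Order.TTheory GRing.Theory Num.Theory.
Import numFieldNormedType.Exports.
Set Implicit Arguments.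
Unset Strict Implicit.
Unset Printing Implicit Defensive.
Local Open Scope classical_set_scope.
Local Open Scope ring_scope.

(** A set E may be negligible for A^p and yet be seen by A^2, as soon as
    p > 2: the removable sets for A^p include the sets of small positive
    dimension, whereas those for A^2 have logarithmic capacity zero.  So let
    Omega be a large disc about 0 from which a self-similar Cantor set E of
    small dimension has been removed, E lying on the real axis near [1, 2].

    For A^p nothing has happened: every f in A^p(Omega) still has the mean value
    property, the integral of f over Omega being |Omega| f(0) (mean_value with
    bergman_admissible).  Bernoulli's inequality
      |f|^p >= 1 + (p / 2) (|f|^2 - 1)
            = 1 + (p / 2) |f - 1|^2 + p (Re f - 1)
    then integrates, when f(0) = 1, to
      ||f||_p^p >= |Omega| + (p / 2) ||f - 1||_2^2     (norm_ge_volume),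
    so the constant 1 is the only minimizer.  Hence K_p(., 0) is the constant
    1 / |Omega| (pBergman_constant), the weight is trivial, and K_{2,p,0} is the
    unweighted Bergman kernel of Omega.  If the two were equal, all f in
    A^2(Omega) would have the mean value property.

    For A^2 the set E matters: the Cauchy transform f(w) of the natural measure
    of E is holomorphic off E and square integrable (cauchy_abs_L2_level, by
    self-similarity).  Outside a fixed box |f| <= 1/8, while |f(0)| >= 1/4;
    when the disc is large the mean of f over Omega is smaller than |f(0)|, a
    contradiction.

    The mean value property is proved by testing f against dbar of
    conj(w) k(|w|^2) chi_n(w), with k radial and chi_n a cutoff vanishing near E
    (green_cauchy_riemann, test_identity).  Since f is only known to be complex
    differentiable, the divergence theorem is needed without continuity of the
    partial derivatives; green proves it by Goursat's bisection.  The n-th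
    cutoff is a product of 2^n bumps on squares of side of order rho^n, so its
    gradient is of order rho^-n there, and the error made by inserting it is
      2^n rho^-n times the integral of |f| over one such square.
    With rho = 1 / (4 m), and |f| split at height m^n, this is of order
    2^-n + (8 m^(2 - p))^n (bergman_cutoff_negligible), which tends to 0 for m
    large exactly because p > 2. *)

(** * Borel sets of the plane and first-order expansions *)

(** R * R with the Borel structure that carries lebesgue_measure: the structure
    inferred for R * R itself has the same sets but a different display. *)
Notation plane R := (measurableTypeR R * measurableTypeR R)%type.

Section PlanarMeasurability.
Context (R : realType).
Implicit Types (D : set (R * R)) (f : R * R -> R).

Definition ratbox (q : rat * rat * rat) : set (R * R) :=
  [set v | `|v.1 - ratr q.1.1| < ratr q.2] `&`
  [set v | `|v.2 - ratr q.1.2| < ratr q.2].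

Lemma near_boxP (u : R * R) (P : R * R -> Prop) :
  (\forall v \near u, P v) <->
  exists2 d : R, 0 < d &
    forall v : R * R, `|v.1 - u.1| < d -> `|v.2 - u.2| < d -> P v.
Proof.
split.
  move=> /nbhs_ballP[d /= d0 H]; exists d => // v v1 v2; apply: H.
  by split; rewrite /ball /= distrC.
case=> d d0 H; apply/nbhs_ballP; exists d => //= v [v1 v2].
by apply: H; rewrite distrC.
Qed.

Lemma measurable_dist_lt (c e : R) : measurable [set x : R | `|x - c| < e].
Proof.
rewrite (_ : [set _ | _] = `]c - e, c + e[%classic).
  exact: measurable_itv.
by apply/seteqP; split => x /=; rewrite in_itv/= ltr_distl.
Qed.

Lemma open_measurable_plane D : open D -> @measurable _ (plane R) D.
Proof.
move=> oD.
pose I := [set q : rat * rat * rat | ratbox q `<=` D].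
have -> : D = \bigcup_(q in I) ratbox q.
  apply/seteqP; split => [u Du|u [q qI qu]]; last exact: qI.
  have /near_boxP[d d0 Hd] : \forall v \near u, D v by exact: open_nbhs_nbhs.
  have [e /andP[e0 ed]] : exists e : rat, (0 < (ratr e : R)) && ((ratr e : R) < d / 2).
    have [e] := rat_in_itvoo (divr_gt0 d0 (ltr0Sn R 1)).
    by rewrite in_itv/=; exists e.
  have [a] := @rat_in_itvoo R (u.1 - ratr e) (u.1 + ratr e) ltac:(lra).
  rewrite in_itv /= => /andP[a1 a2].
  have [b] := @rat_in_itvoo R (u.2 - ratr e) (u.2 + ratr e) ltac:(lra).
  rewrite in_itv /= => /andP[b1 b2].
  exists ((a, b), e) => /=.
    move=> v [/= /ltr_normlP[v1 v2] /ltr_normlP[v3 v4]]; apply: Hd; apply/ltr_normlP; split; lra.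
  by split => /=; apply/ltr_normlP; split; lra.
rewrite bigcup_mkcond; apply: countable_bigcupT_measurable => [|q].
  exact: countableP.
case: ifPn => // _; apply: measurableI.
  have -> : [set v : R * R | `|v.1 - ratr q.1.1| < ratr q.2] =
     [set x : R | `|x - ratr q.1.1| < ratr q.2] `*` setT.
    by apply/seteqP; split => v //= [].
  by apply: measurableX => //; exact: measurable_dist_lt.
have -> : [set v : R * R | `|v.2 - ratr q.1.2| < ratr q.2] =
   setT `*` [set x : R | `|x - ratr q.1.2| < ratr q.2].
  by apply/seteqP; split => v //= [].
by apply: measurableX => //; exact: measurable_dist_lt.
Qed.

Lemma closed_measurable_plane D : closed D -> @measurable _ (plane R) D.
Proof. by move/closed_openC/open_measurable_plane/measurableC; rewrite setCK. Qed.

Lemma continuous_measurable_plane D f : open D ->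
  (forall u, D u -> {for u, continuous f}) -> measurable_fun (D : set (plane R)) f.
Proof.
move=> oD cf; apply: (measurability _ (RGenOpens.measurableE R)) => _ [_ [a [b ->] <-]].
have oo : open `]a, b[%classic by exact: interval_open.
apply: open_measurable_plane; rewrite openE => u [Du fu].
apply: filterI; first exact: open_nbhs_nbhs.
by apply: (cf u Du); apply: open_nbhs_nbhs.
Qed.

End PlanarMeasurability.

Section PlanarDifferential.
Context (R : realType).
Implicit Types (f g : R * R -> R) (u v : R * R) (A B : R).

Definition dist1 u v : R := `|v.1 - u.1| + `|v.2 - u.2|.

Lemma dist1_ge0 u v : 0 <= dist1 u v.
Proof. by rewrite addr_ge0. Qed.

Lemma near_dist1 u d : 0 < d -> \forall v \near u, dist1 u v < d.
Proof.
move=> d0; apply/near_boxP; exists (d / 2); first lra.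
by move=> v v1 v2; rewrite /dist1; lra.
Qed.

(** Differentiability at u with partial derivatives A and B.  This constrains f at
    u only: the partial derivatives may be discontinuous. *)
Definition is_diff2 f u A B := forall e : R, 0 < e -> \forall v \near u,
  `|f v - f u - (A * (v.1 - u.1) + B * (v.2 - u.2))| <= e * dist1 u v.

Lemma lin_dist1 u v A B :
  `|A * (v.1 - u.1) + B * (v.2 - u.2)| <= (`|A| + `|B|) * dist1 u v.
Proof.
rewrite (le_trans (ler_normD _ _))// !normrM /dist1.
have := normr_ge0 A; have := normr_ge0 B.
have := normr_ge0 (v.1 - u.1); have := normr_ge0 (v.2 - u.2).
nra.
Qed.

Lemma diff2_lip f u A B : is_diff2 f u A B ->
  \forall v \near u, `|f v - f u| <= (`|A| + `|B| + 1) * dist1 u v.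
Proof.
move=> /(_ 1 ltr01); apply: filterS => v H.
rewrite -[f v - f u](subrK (A * (v.1 - u.1) + B * (v.2 - u.2))).
apply: (le_trans (ler_normD _ _)); have := lin_dist1 u v A B; lra.
Qed.

Lemma diff2_continuous f u A B : is_diff2 f u A B -> {for u, continuous f}.
Proof.
move=> /diff2_lip H; apply/cvgrPdist_lt => e e0.
have C0 : 0 < `|A| + `|B| + 1 by rewrite ltr_wpDl// addr_ge0.
near=> v; rewrite distrC.
apply: (@le_lt_trans _ _ ((`|A| + `|B| + 1) * dist1 u v)); first by near: v.
rewrite mulrC -ltr_pdivlMr//; near: v; apply: near_dist1; exact: divr_gt0.
Unshelve. all: by end_near. Qed.

Lemma diff2_cst c u : is_diff2 (fun=> c) u 0 0.
Proof.
move=> e e0; near=> v; rewrite subrr !mul0r addr0 subrr normr0.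
by rewrite mulr_ge0 ?dist1_ge0// ltW.
Unshelve. all: by end_near. Qed.

Lemma diff2_fst u : is_diff2 fst u 1 0.
Proof.
move=> e e0; near=> v; rewrite mul1r mul0r addr0 subrr normr0.
by rewrite mulr_ge0 ?dist1_ge0// ltW.
Unshelve. all: by end_near. Qed.

Lemma diff2_snd u : is_diff2 snd u 0 1.
Proof.
move=> e e0; near=> v; rewrite mul1r mul0r add0r subrr normr0.
by rewrite mulr_ge0 ?dist1_ge0// ltW.
Unshelve. all: by end_near. Qed.

Lemma diff2_add f g u A B A' B' : is_diff2 f u A B -> is_diff2 g u A' B' ->
  is_diff2 (fun v => f v + g v) u (A + A') (B + B').
Proof.
move=> Hf Hg e e0; have e20 : 0 < e / 2 by lra.
move: (Hf _ e20) (Hg _ e20); apply: filterS2 => v H1 H2.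
rewrite [X in `|X|](_ : _ = (f v - f u - (A * (v.1 - u.1) + B * (v.2 - u.2))) +
  (g v - g u - (A' * (v.1 - u.1) + B' * (v.2 - u.2)))); last ring.
rewrite (le_trans (ler_normD _ _))// (le_trans (lerD H1 H2))//; lra.
Qed.

Lemma diff2_ext f g u A B A' B' : is_diff2 f u A B -> (\forall v \near u, f v = g v) ->
  A = A' -> B = B' -> is_diff2 g u A' B'.
Proof.
move=> Hf fg <- <- e e0; have fgu := nbhs_singleton fg.
by move: fg (Hf e e0); apply: filterS2 => v <-; rewrite fgu.
Qed.

Lemma diff2_scale f u A B c : is_diff2 f u A B -> is_diff2 (fun v => c * f v) u (c * A) (c * B).
Proof.
move=> Hf e e0; have c0 : 0 < `|c| + 1 by rewrite ltr_wpDl.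
move: (Hf (e / (`|c| + 1)) (divr_gt0 e0 c0)); apply: filterS => v H1.
rewrite [X in `|X|](_ : _ = c * (f v - f u - (A * (v.1 - u.1) + B * (v.2 - u.2)))); last ring.
rewrite normrM.
apply: (le_trans (ler_wpM2l (normr_ge0 c) H1)).
rewrite !mulrA; apply: ler_wpM2r; first exact: dist1_ge0.
by rewrite -mulrA mulrCA ger_pMr// ler_pdivrMr// mul1r lerDl.
Qed.

Lemma diff2_mul f g u A B A' B' : is_diff2 f u A B -> is_diff2 g u A' B' ->
  is_diff2 (fun v => f v * g v) u (f u * A' + g u * A) (f u * B' + g u * B).
Proof.
move=> Hf Hg.
have H1 : is_diff2 (fun v => f u * g v + g u * f v) u (f u * A' + g u * A) (f u * B' + g u * B).
  by apply: diff2_add; apply: diff2_scale.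
have H2 : is_diff2 (fun v => (f v - f u) * (g v - g u)) u 0 0.
  move=> e e0.
  set C1 := `|A| + `|B| + 1; set C2 := `|A'| + `|B'| + 1.
  have C10 : 0 < C1 by rewrite ltr_wpDl// addr_ge0.
  have C20 : 0 < C2 by rewrite ltr_wpDl// addr_ge0.
  have d0 : 0 < e / (C1 * C2) by rewrite divr_gt0// mulr_gt0.
  near=> v; rewrite !subrr mul0r !mul0r addr0 !subr0 normrM.
  have h1 : `|f v - f u| <= C1 * dist1 u v by near: v; exact: diff2_lip.
  have h2 : `|g v - g u| <= C2 * dist1 u v by near: v; exact: diff2_lip.
  have h3 : dist1 u v < e / (C1 * C2) by near: v; exact: near_dist1.
  apply: (le_trans (ler_pM (normr_ge0 _) (normr_ge0 _) h1 h2)).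
  rewrite mulrACA mulrA; apply: ler_wpM2r; first exact: dist1_ge0.
  by rewrite mulrC -ler_pdivlMr ?mulr_gt0// ltW.
have H3 := diff2_add (diff2_add H1 H2) (diff2_cst (- (f u * g u)) u).
apply: (diff2_ext H3); rewrite ?addr0//.
by near=> v; ring.
Unshelve. all: by end_near. Qed.

Lemma diff2_opp f u A B : is_diff2 f u A B -> is_diff2 (fun v => - f v) u (- A) (- B).
Proof.
move=> /(diff2_scale (-1)) H; apply: (diff2_ext H); rewrite ?mulN1r//.
by near=> v; rewrite mulN1r.
Unshelve. all: by end_near. Qed.

Lemma diff2_comp (h : R -> R) f u A B c : is_diff2 f u A B -> is_derive (f u) 1 h c ->
  is_diff2 (fun v => h (f v)) u (c * A) (c * B).
Proof.
move=> Hf dh e e0.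
have cf := diff2_continuous Hf.
set C1 := `|A| + `|B| + 1.
have C10 : 0 < C1 by rewrite ltr_wpDl// addr_ge0.
have e1 : 0 < e / 2 / C1 by rewrite !divr_gt0.
have c0 : 0 < `|c| + 1 by rewrite ltr_wpDl.
have e2 : 0 < e / 2 / (`|c| + 1) by rewrite !divr_gt0.
have Hh : \forall y \near f u, `|h y - h (f u) - c * (y - f u)| <= e / 2 / C1 * `|y - f u|.
  have [dh1 dh2] := dh.
  have /cvgrPdist_le/(_ _ e1) : (fun k => k^-1 *: (h (k *: 1 + f u) - h (f u))) @ (0:R)^' --> c.
    by rewrite -dh2; exact: dh1.
  move=> /nbhs_ballP[d /= d0 Hd].
  apply/nbhs_ballP; exists d => //= y yd.
  have [->|yu] := eqVneq y (f u); first by rewrite !subrr mulr0 subrr !normr0 mulr0.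
  have k0 : y - f u != 0 by rewrite subr_eq0.
  have := Hd (y - f u); rewrite /ball /= sub0r normrN distrC => /(_ yd k0).
  rewrite /GRing.scale /= mulr1 subrK => H.
  rewrite [X in _ <= _ * X]distrC.
  rewrite -ler_pdivrMr ?normr_gt0//.
  apply: le_trans H; rewrite -normfV -normrM.
  rewrite (_ : _ * _ = - (c - (y - f u)^-1 * (h y - h (f u)))) ?normrN//.
  by field.
near=> v.
have h1 : `|h (f v) - h (f u) - c * (f v - f u)| <= e / 2 / C1 * `|f v - f u|.
  by near: v; exact: (cf _ Hh).
have h2 : `|f v - f u| <= C1 * dist1 u v by near: v; exact: diff2_lip.
have h3 : `|f v - f u - (A * (v.1 - u.1) + B * (v.2 - u.2))| <= e / 2 / (`|c| + 1) * dist1 u v.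
  by near: v; exact: Hf.
rewrite [X in `|X|](_ : _ = (h (f v) - h (f u) - c * (f v - f u)) +
  c * (f v - f u - (A * (v.1 - u.1) + B * (v.2 - u.2)))); last ring.
apply: (le_trans (ler_normD _ _)); rewrite normrM.
have h4 : e / 2 / C1 * `|f v - f u| <= e / 2 * dist1 u v.
  by rewrite -(mulrA (e / 2)) ler_pM2l; [rewrite mulrC ler_pdivrMr// mulrC|lra].
have h5 : `|c| * `|f v - f u - (A * (v.1 - u.1) + B * (v.2 - u.2))| <= e / 2 * dist1 u v.
  apply: (le_trans (ler_wpM2l (normr_ge0 c) h3)).
  rewrite !mulrA; apply: ler_wpM2r; first exact: dist1_ge0.
  by rewrite ler_pdivrMr//; have := normr_ge0 c; nra.
lra.
Unshelve. all: by end_near. Qed.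

End PlanarDifferential.

(** * The divergence theorem without continuous partial derivatives *)

Notation plane_measure R := (@lebesgue_measure R \x @lebesgue_measure R)%E.

Section PlaneIntegral.
Context (R : realType).
Notation mu1 := (@lebesgue_measure R).
Notation mu2 := (plane_measure R).

Lemma Rintegral_near d (T : measurableType d) (mu : {measure set T -> \bar R})
    (D : set T) (g : T -> R) (m e : R) :
  measurable D -> mu.-integrable D (EFin \o g) -> (mu D < +oo)%E ->
  (forall x, D x -> `|g x - m| <= e) ->
  `|\int[mu]_(x in D) g x - m * fine (mu D)| <= e * fine (mu D).
Proof.
move=> mD ig fD H.
have ic c : mu.-integrable D (EFin \o fun=> c) 
  by apply: measurable_bounded_integrable => //; exact: bounded_cst.
have ib : mu.-integrable D (EFin \o fun x => g x - m).
  by have := integrableB mD ig (ic m); apply: eq_integrable => // x _ /=; rewrite EFinB.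
rewrite -(Rintegral_cst mu mD) -RintegralB//.
apply: (le_trans (le_normr_Rintegral mD ib)).
rewrite -(Rintegral_cst mu mD); apply: le_Rintegral => //.
exact: integrable_norm.
Qed.

(** Half-open, so that a rectangle is the disjoint union of its halves. *)
Definition rect (a c w h : R) : set (plane R) :=
  `[a, a + w[%classic `*` `[c, c + h[%classic.

Lemma measurable_rect a c w h : measurable (rect a c w h).
Proof. by apply: measurableX; exact: measurable_itv. Qed.

Lemma mu1_itv (a w : R) : 0 <= w -> mu1 `[a, a + w[%classic = w%:E.
Proof.
move=> w0; rewrite lebesgue_measure_itv/= lte_fin ltrDl -EFinB addrC addKr.
by move: w0; rewrite le_eqVlt => /predU1P[<-|->//]; rewrite ltxx.
Qed.

Lemma mu2_rect a c w h : 0 <= w -> 0 <= h -> mu2 (rect a c w h) = (w * h)%:E.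
Proof.
move=> w0 h0; rewrite product_measure1E; [|exact: measurable_itv..].
by rewrite [X in (X * _)%E](mu1_itv _ w0) [X in (_ * X)%E](mu1_itv _ h0) EFinM.
Qed.

Lemma bounded_integrable2 (D : set (R * R)) (g : R * R -> R) (M : R) :
  measurable D -> (mu2 D < +oo)%E -> measurable_fun D g ->
  (forall u, D u -> `|g u| <= M) -> mu2.-integrable D (EFin \o g).
Proof.
move=> mD fD mg H; apply: measurable_bounded_integrable => //.
exists M; split; first exact: num_real.
by move=> x Mx u Du /=; rewrite (le_trans (H u Du))// ltW.
Qed.

Lemma continuous_bounded_on (g : R * R -> R) (l : R) : continuous g ->
  exists M, forall u, `|u.1| <= l -> `|u.2| <= l -> `|g u| <= M.
Proof.
move=> cg.
have cK : compact (`[- l, l]%classic `*` `[- l, l]%classic : set (R * R)).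
  by apply: compact_setX; exact: segment_compact.
have := continuous_compact (continuous_subspaceT cg) cK.
move=> /compact_bounded[M [_ HM]]; exists (M + 1) => u u1 u2.
apply: HM; first by rewrite ltrDl.
by exists u => //; split => /=; rewrite in_itv/= -ler_norml.
Qed.

Lemma continuous_itv_integrable (g : R -> R) (a w : R) : continuous g ->
  mu1.-integrable `[a, a + w[%classic (EFin \o g).
Proof.
move=> cg.
have H : mu1.-integrable `[a, a + w]%classic (EFin \o g).
  by apply: continuous_compact_integrable; [exact: segment_compact|exact: continuous_subspaceT].
apply: (integrableS _ _ _ H); [exact: measurable_itv|exact: measurable_itv|].
by move=> x /=; rewrite !in_itv/= => /andP[-> /ltW].
Qed.

Lemma continuous_rect_integrable (g : R * R -> R) (a c w h : R) :
  0 <= w -> 0 <= h -> continuous g -> mu2.-integrable (rect a c w h) (EFin \o g).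
Proof.
move=> w0 h0 cg.
have [M HM] := continuous_bounded_on (`|a| + `|c| + w + h) cg.
apply: (@bounded_integrable2 _ _ M).
- exact: measurable_rect.
- by rewrite mu2_rect// ltry.
- apply: (@measurable_funS _ _ _ _ setT) => //.
  by apply: continuous_measurable_plane => [|u _]; [exact: openT|exact: cg].
- move=> u [/=]; rewrite !in_itv/= => /andP[u1 u2] /andP[u3 u4].
  have := ler_norm a; have := ler_norm c; have := ler_norm (- a); have := ler_norm (- c).
  rewrite !normrN => h1 h2 h3 h4.
  by apply: HM; rewrite ler_norml; lra.
Qed.

Lemma itv_integralD (g : R -> R) (a h : R) : 0 <= h -> continuous g ->
  \int[mu1]_(x in `[a, a + (h + h)[) g x =
  \int[mu1]_(x in `[a, a + h[) g x + \int[mu1]_(x in `[a + h, a + h + h[) g x.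
Proof.
move=> h0 cg.
have E : `[a, a + (h + h)[%classic = `[a, a + h[%classic `|` `[a + h, a + h + h[%classic :> set R.
  apply/seteqP; split => x /=; rewrite !in_itv/=.
    move=> /andP[x1 x2]; have [xl|xl] := ltP x (a + h); [left|right]; lra.
  by case; lra.
rewrite E Rintegral_setU//.
  by rewrite -E; exact: continuous_itv_integrable.
by apply/disj_setPS => x [/=]; rewrite !in_itv/=; lra.
Qed.

Lemma rect_integralDw (g : R * R -> R) (a c w h : R) : 0 <= w -> 0 <= h -> continuous g ->
  \int[mu2]_(x in rect a c (w + w) h) g x =
  \int[mu2]_(x in rect a c w h) g x + \int[mu2]_(x in rect (a + w) c w h) g x.
Proof.
move=> w0 h0 cg.
have E : rect a c (w + w) h = rect a c w h `|` rect (a + w) c w h.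
  apply/seteqP; split => x /=; rewrite /rect/= !in_itv/=.
    move=> -[/andP[x1 x2] x3]; have [xl|xl] := ltP x.1 (a + w); [left|right]; split => //; lra.
  by case=> -[]; split => //; lra.
rewrite E Rintegral_setU; [by []|exact: measurable_rect|exact: measurable_rect| |].
  by rewrite -E; apply: continuous_rect_integrable => //; lra.
by apply/disj_setPS => x [[/=]]; rewrite !in_itv/= => x1 _ [/=]; rewrite !in_itv/=; lra.
Qed.

Lemma rect_integralDh (g : R * R -> R) (a c w h : R) : 0 <= w -> 0 <= h -> continuous g ->
  \int[mu2]_(x in rect a c w (h + h)) g x =
  \int[mu2]_(x in rect a c w h) g x + \int[mu2]_(x in rect a (c + h) w h) g x.
Proof.
move=> w0 h0 cg.
have E : rect a c w (h + h) = rect a c w h `|` rect a (c + h) w h.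
  apply/seteqP; split => x /=; rewrite /rect/= !in_itv/=.
    move=> -[x3 /andP[x1 x2]]; have [xl|xl] := ltP x.2 (c + h); [left|right]; split => //; lra.
  by case=> -[]; split => //; lra.
rewrite E Rintegral_setU; [by []|exact: measurable_rect|exact: measurable_rect| |].
  by rewrite -E; apply: continuous_rect_integrable => //; lra.
by apply/disj_setPS => x [[/= _]]; rewrite !in_itv/= => x1 [/= _]; rewrite !in_itv/=; lra.
Qed.

Lemma itv_integral_near (g : R -> R) (a w m e : R) : 0 <= w -> continuous g ->
  (forall x, a <= x < a + w -> `|g x - m| <= e) ->
  `|\int[mu1]_(x in `[a, a + w[) g x - m * w| <= e * w.
Proof.
move=> w0 cg H.
have fw : fine (mu1 `[a, a + w[%classic) = w by rewrite mu1_itv.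
have fi : (mu1 `[a, (a + w)%R[%classic < +oo)%E.
  by rewrite [X in (X < _)%E](mu1_itv _ w0) ltry.
have H' (x : R) : `[a, a + w[%classic x -> `|g x - m| <= e.
  by move=> /=; rewrite in_itv/=; exact: H.
have := Rintegral_near _ (continuous_itv_integrable a w cg) fi H'.
by rewrite fw; apply; exact: measurable_itv.
Qed.

Lemma rect_integral_near (g : R * R -> R) (a c w h m e : R) : 0 <= w -> 0 <= h ->
  continuous g -> (forall u, rect a c w h u -> `|g u - m| <= e) ->
  `|\int[mu2]_(x in rect a c w h) g x - m * (w * h)| <= e * (w * h).
Proof.
move=> w0 h0 cg H.
have fw : fine (mu2 (rect a c w h)) = w * h by rewrite mu2_rect.
have fi : (mu2 (rect a c w h) < +oo)%E by rewrite mu2_rect// ltry.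
have := Rintegral_near (measurable_rect _ _ _ _) (continuous_rect_integrable a c w0 h0 cg) fi H.
by rewrite fw.
Qed.

End PlaneIntegral.

Section Green.
Context (R : realType).
Notation mu1 := (@lebesgue_measure R).
Notation mu2 := (plane_measure R).
Variables (P Q k : R * R -> R).
Hypothesis dPQ : forall u, exists A B C D,
  [/\ is_diff2 P u A B, is_diff2 Q u C D & k u = A + D].
Hypothesis ck : continuous k.

Let cP : continuous P.
Proof. by move=> u; have [A [B [C [D [H _ _]]]]] := dPQ u; exact: diff2_continuous H. Qed.

Let cQ : continuous Q.
Proof. by move=> u; have [A [B [C [D [_ H _]]]]] := dPQ u; exact: diff2_continuous H. Qed.

Let cPx x : continuous (fun y => P (x, y)).
Proof.
move=> y; apply: (@continuous_comp _ _ _ (fun y => (x, y)) P); last exact: cP.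
by apply: (@cvg_pair _ _ _ _ (nbhs x) (nbhs y)); [exact: cvg_cst|exact: cvg_id].
Qed.

Let cQy y : continuous (fun x => Q (x, y)).
Proof.
move=> x; apply: (@continuous_comp _ _ _ (fun x => (x, y)) Q); last exact: cQ.
by apply: (@cvg_pair _ _ _ _ (nbhs x) (nbhs y)); [exact: cvg_id|exact: cvg_cst].
Qed.

Let V x c h := \int[mu1]_(y in `[c, c + h[) P (x, y).
Let H y a w := \int[mu1]_(x in `[a, a + w[) Q (x, y).

(** The defect in the divergence theorem: the flux of (P, Q) out of a square,
    minus the integral of k over it. *)
Let lam a c s := (V (a + s) c s - V a c s) + (H (c + s) a s - H c a s)
  - \int[mu2]_(u in rect a c s s) k u.

(** The fluxes through the inner sides cancel. *)
Let lam_split a c h : 0 <= h -> lam a c (h + h) =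
  (lam a c h + lam (a + h) c h) + (lam a (c + h) h + lam (a + h) (c + h) h).
Proof.
move=> h0; rewrite /lam rect_integralDw ?rect_integralDh//; try lra.
rewrite /V /H !itv_integralD//.
rewrite !addrA; ring.
Qed.

(** The affine parts of P and Q satisfy the divergence theorem exactly; the
    remainders are small compared with the side, and the perimeter is of the order
    of the side. *)
Let lam_small u e : 0 < e -> exists2 d : R, 0 < d & forall a c s, 0 < s < d ->
  a <= u.1 <= a + s -> c <= u.2 <= c + s -> `|lam a c s| <= e * (s * s).
Proof.
move=> e0.
have [A [B [C [D [dP dQ ku]]]]] := dPQ u.
have e90 : 0 < e / 9 by lra.
have kn : \forall v \near u, `|k v - k u| <= e / 9.
  by move: (@ck u) => /cvgrPdist_le/(_ _ e90); apply: filterS => v; rewrite distrC.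
have [d d0 Hd] := (near_boxP _ _).1 (filterI kn (filterI (dP _ e90) (dQ _ e90))).
exists d => // a c s /andP[s0 sd] /andP[a1 a2] /andP[c1 c2].
have nr v : a <= v.1 <= a + s -> c <= v.2 <= c + s ->
  [/\ `|v.1 - u.1| < d, `|v.2 - u.2| < d & dist1 u v <= 2 * s].
  move=> v1 v2; have h1 : `|v.1 - u.1| <= s by rewrite ler_norml; lra.
  have h2 : `|v.2 - u.2| <= s by rewrite ler_norml; lra.
  by split; rewrite /dist1; lra.
have V1 : `|V (a + s) c s - V a c s - A * s * s| <= 4 * (e / 9) * s * s.
  rewrite /V -RintegralB; [|exact: measurable_itv|exact: continuous_itv_integrable..].
  apply: itv_integral_near; [exact: ltW|by move=> y; apply: cvgB; exact: cPx|move=> y yc].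
  have [n1 n2 n3] := nr (a + s, y) ltac:(simpl; lra) ltac:(simpl; lra).
  have [n4 n5 n6] := nr (a, y) ltac:(simpl; lra) ltac:(simpl; lra).
  have [_ [+ _]] := Hd (a + s, y) n1 n2.
  have [_ [+ _]] := Hd (a, y) n4 n5.
  rewrite /= => /ler_normlP[q1 q2] /ler_normlP[q3 q4].
  have := ler_wpM2l (ltW e90) n3; have := ler_wpM2l (ltW e90) n6 => q5 q6.
  rewrite ler_norml; apply/andP; split; lra.
have V2 : `|H (c + s) a s - H c a s - D * s * s| <= 4 * (e / 9) * s * s.
  rewrite /H -RintegralB; [|exact: measurable_itv|exact: continuous_itv_integrable..].
  apply: itv_integral_near; [exact: ltW|by move=> y; apply: cvgB; exact: cQy|move=> y yc].
  have [n1 n2 n3] := nr (y, c + s) ltac:(simpl; lra) ltac:(simpl; lra).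
  have [n4 n5 n6] := nr (y, c) ltac:(simpl; lra) ltac:(simpl; lra).
  have [_ [_ +]] := Hd (y, c + s) n1 n2.
  have [_ [_ +]] := Hd (y, c) n4 n5.
  rewrite /= => /ler_normlP[q1 q2] /ler_normlP[q3 q4].
  have := ler_wpM2l (ltW e90) n3; have := ler_wpM2l (ltW e90) n6 => q5 q6.
  rewrite ler_norml; apply/andP; split; lra.
have V3 : `|\int[mu2]_(u in rect a c s s) k u - k u * (s * s)| <= e / 9 * (s * s).
  apply: rect_integral_near; [exact: ltW|exact: ltW|exact: ck|].
  move=> v [/=]; rewrite !in_itv/= => v1 v2.
  have [n1 n2 n3] := nr v ltac:(lra) ltac:(lra).
  by have [+ _] := Hd v n1 n2.
move: V1 V2 V3; rewrite ku /lam => /ler_normlP[q1 q2] /ler_normlP[q3 q4] /ler_normlP[q5 q6].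
by rewrite ler_norml; lra.
Qed.

(** Goursat's argument: a defect of at least eta times the area is inherited by
    one of the four quarters, for ever, and contradicts lam_small at the point to
    which the squares shrink. *)
Let lam0 a c s : 0 < s -> lam a c s = 0.
Proof.
move=> s0; apply/eqP; apply/negPn/negP => lamN0.
pose eta := `|lam a c s| / (s * s).
have eta0 : 0 < eta by rewrite divr_gt0 ?normr_gt0// mulr_gt0.
pose big (q : R * R) (t : R) := eta * (t * t) <= `|lam q.1 q.2 t|.
have step (q : R * R) t : exists q' : R * R, 0 < t -> big q (t + t) ->
   [/\ q.1 <= q'.1 <= q.1 + t, q.2 <= q'.2 <= q.2 + t & big q' t].
  have [t0|] := ltP 0 t; last by exists q => ?; lra.
  rewrite /big lam_split; last lra.
  have [h1|h1] := leP (eta * (t * t)) `|lam q.1 q.2 t|.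
    by exists q; split => //=; lra.
  have [h2|h2] := leP (eta * (t * t)) `|lam (q.1 + t) q.2 t|.
    by exists (q.1 + t, q.2); split => //=; lra.
  have [h3|h3] := leP (eta * (t * t)) `|lam q.1 (q.2 + t) t|.
    by exists (q.1, q.2 + t); split => //=; lra.
  have [h4|h4] := leP (eta * (t * t)) `|lam (q.1 + t) (q.2 + t) t|.
    by exists (q.1 + t, q.2 + t); split => //=; lra.
  exists q => _ hh; exfalso; move: hh h1 h2 h3 h4.
  set l1 := lam _ _ _; set l2 := lam _ _ _; set l3 := lam _ _ _; set l4 := lam _ _ _.
  move=> hh h1 h2 h3 h4.
  have := ler_normD (l1 + l2) (l3 + l4); have := ler_normD l1 l2; have := ler_normD l3 l4.
  lra.
have [nx nxP] : {nx : R * R -> R -> R * R | forall q t, 0 < t -> big q (t + t) ->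
   [/\ q.1 <= (nx q t).1 <= q.1 + t, q.2 <= (nx q t).2 <= q.2 + t & big (nx q t) t]}.
  exists (fun q t => projT1 (cid (step q t))) => q t.
  exact: (projT2 (cid (step q t))).
pose sn n : R := s / 2 ^+ n.
have sn0 n : 0 < sn n by rewrite divr_gt0// exprn_gt0.
have snS n : sn n = sn n.+1 + sn n.+1.
  by rewrite /sn exprS; field; rewrite expf_neq0.
pose fix q n := if n is m.+1 then nx (q m) (sn m.+1) else (a, c).
have qb n : big (q n) (sn n).
  elim: n => [|n IH].
    by rewrite /big /sn expr0 divr1 /= /eta divfK// mulf_neq0// gt_eqF.
  by have [] := nxP (q n) (sn n.+1) (sn0 _); rewrite -?snS.
have qS n : (q n).1 <= (q n.+1).1 <= (q n).1 + sn n.+1 /\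
   (q n).2 <= (q n.+1).2 <= (q n).2 + sn n.+1.
  by have [] := nxP (q n) (sn n.+1) (sn0 _); rewrite -?snS.
(* each coordinate of the corners converges, to a point of all the squares *)
have key (x : nat -> R) : (forall n, x n <= x n.+1 <= x n + sn n.+1) ->
  exists l, forall n, x n <= l <= x n + sn n.
  move=> Hx.
  have xmon : nondecreasing_seq x by apply/nondecreasing_seqP => n; case/andP: (Hx n).
  have ymon : nonincreasing_seq (fun n => x n + sn n).
    by apply/nonincreasing_seqP => n; rewrite (snS n); case/andP: (Hx n); lra.
  have xy n m : x n <= x m + sn m.
    have [nm|mn] := leP n m.
      by have := xmon _ _ nm; have := sn0 m; lra.
    by have := ymon _ _ (ltnW mn); have := sn0 n => /=; lra.
  exists (sup (range x)) => n; apply/andP; split.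
    apply: ub_le_sup; last by exists n.
    by exists (x 0%N + sn 0%N) => _ [m _ <-].
  apply: ge_sup; first by exists (x n); exists n.
  by move=> _ [m _ <-].
have [l1 Hl1] := key (fun n => (q n).1) (fun n => (qS n).1).
have [l2 Hl2] := key (fun n => (q n).2) (fun n => (qS n).2).
have [d d0 Hd] := @lam_small (l1, l2) (eta / 2) ltac:(lra).
have [n nd] : exists n, sn n < d.
  have [n Hn] : exists n : nat, s / d < n%:R.
    exists (Num.bound (s / d)); apply: archi_boundP; rewrite divr_ge0 ?ltW//.
  exists n; rewrite /sn ltr_pdivrMr ?exprn_gt0// -ltr_pdivrMl// mulrC.
  apply: (lt_trans Hn); rewrite -natrX ltr_nat; exact: ltn_expl.
have := Hd (q n).1 (q n).2 (sn n); rewrite sn0 nd => /(_ isT (Hl1 n) (Hl2 n)).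
have := qb n; rewrite /big; have : 0 < sn n * sn n by rewrite mulr_gt0.
set z := sn n * sn n => z0 h1 h2; have : 0 < eta * z by rewrite mulr_gt0.
lra.
Qed.

(** Only differentiability of P and Q at each point is assumed, together with
    continuity of their divergence k: this is what a product of a complex
    differentiable function and a test function provides. *)
Lemma green (L : R) :
  (forall u, L <= `|u.1| \/ L <= `|u.2| -> [/\ P u = 0, Q u = 0 & k u = 0]) ->
  \int[mu2]_u k u = 0.
Proof.
move=> supp.
pose l := `|L| + 1.
have l0 : 0 < l by rewrite /l; have := normr_ge0 L; lra.
have lL : L <= l by rewrite /l; have := ler_norm L; lra.
have := @lam0 (- l) (- l) (l + l) ltac:(lra).
have Vz x c h : L <= `|x| -> V x c h = 0.
  move=> Lx; rewrite /V; under eq_Rintegral => y _.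
    have [-> _ _] := supp (x, y) (or_introl Lx); over.
  by rewrite Rintegral_cst ?mul0r//; exact: measurable_itv.
have Hz y c h : L <= `|y| -> H y c h = 0.
  move=> Ly; rewrite /H; under eq_Rintegral => x _.
    have [_ -> _] := supp (x, y) (or_intror Ly); over.
  by rewrite Rintegral_cst ?mul0r//; exact: measurable_itv.
rewrite /lam (_ : - l + (l + l) = l); last lra.
rewrite !Vz ?Hz ?normrN ?gtr0_norm//.
rewrite !subrr !addr0 sub0r => /eqP; rewrite oppr_eq0 => /eqP <-.
rewrite [RHS]Rintegral_mkcond; congr (Rintegral _ _ _); apply/funext => u.
rewrite patchE; case: ifPn => //; rewrite notin_setE => nu.
have [h1|h1] := leP L `|u.1|; first by have [] := supp u (or_introl h1).
have [h2|h2] := leP L `|u.2|; first by have [] := supp u (or_intror h2).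
case: nu; move: (lt_le_trans h1 lL) (lt_le_trans h2 lL) => /ltr_normlP[? ?] /ltr_normlP[? ?].
by split; rewrite /= in_itv/=; lra.
Qed.

End Green.

(** * A planar Cantor set and its cutoff functions *)

Section PosSquare.
Context (R : realType).
Implicit Types x y t : R.

(** Differentiates pos2 at its corner 0 in the same way as elsewhere. *)
Lemma is_derive_quadratic (f : R -> R) x c C :
  (forall y, `|f y - f x - c * (y - x)| <= C * (y - x) ^+ 2) -> is_derive x 1 f c.
Proof.
move=> H.
have cv : (fun h => h^-1 *: (f (h *: 1 + x) - f x)) @ (0 : R)^' --> c.
  have C0 : 0 <= C.
    have := H (x + 1); rewrite [X in C * X](_ : _ = 1) ?mulr1; last by ring.
    exact: le_trans.
  apply/cvgrPdist_le => e e0.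
  apply/nbhs_ballP; exists (e / (C + 1)) => /=; first by rewrite divr_gt0// ltr_wpDl.
  move=> h; rewrite /ball/= sub0r normrN => hd h0.
  rewrite distrC /GRing.scale/= mulr1.
  have h'0 : 0 < `|h| by rewrite normr_gt0.
  rewrite (_ : _ - c = h^-1 * (f (h + x) - f x - c * (h + x - x))); last by field.
  rewrite normrM normfV ler_pdivrMl//.
  apply: (le_trans (H _)); rewrite addrK -real_normK ?num_real// expr2 mulrCA ler_pM2l//.
  move: hd; rewrite ltr_pdivlMr ?ltr_wpDl// => hd.
  by rewrite (le_trans _ (ltW hd))// mulrC ler_pM2l// lerDl.
apply: DeriveDef; first by apply/cvg_ex; exists c.
exact/cvg_lim.
Qed.

Definition pos x := Num.max 0 x.
Definition pos2 x := pos x ^+ 2.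

Lemma pos_ge0 x : 0 <= pos x.
Proof. by rewrite /pos le_max lexx. Qed.

Lemma pos_id x : 0 <= x -> pos x = x.
Proof. by move=> x0; rewrite /pos; apply/max_idPr. Qed.

Lemma pos_0 x : x <= 0 -> pos x = 0.
Proof. by move=> x0; rewrite /pos; apply/max_idPl. Qed.

Lemma pos_lip x y : `|pos x - pos y| <= `|x - y|.
Proof.
have [x0|x0] := leP 0 x; have [y0|y0] := leP 0 y.
- by rewrite !pos_id.
- rewrite (pos_id x0) (pos_0 (ltW y0)) subr0 !ger0_norm; lra.
- rewrite (pos_id y0) (pos_0 (ltW x0)) sub0r normrN distrC !ger0_norm; lra.
- by rewrite !pos_0 ?subrr ?normr0// ltW.
Qed.

Lemma continuous_pos : continuous pos.
Proof.
move=> x; apply/cvgrPdist_lt => e e0; near=> y.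
apply: (le_lt_trans (pos_lip _ _)); near: y.
by apply/nbhs_ballP; exists e.
Unshelve. all: by end_near. Qed.

Lemma is_derive_pos2 x : is_derive x 1 pos2 (2 * pos x).
Proof.
apply: (@is_derive_quadratic _ _ _ 1) => y; rewrite /pos2 mul1r ler_norml.
have h0 := sqr_ge0 (y - x); have hx := sqr_ge0 x; have hy := sqr_ge0 y.
have [x0|x0] := leP 0 x; have [y0|y0] := leP 0 y.
- by rewrite !pos_id//; apply/andP; split; lra.
- have xy : 0 <= x * - y by rewrite mulr_ge0//; lra.
  by rewrite (pos_id x0) (pos_0 (ltW y0)); apply/andP; split; lra.
- have xy : 0 <= - x * y by rewrite mulr_ge0//; lra.
  by rewrite (pos_id y0) (pos_0 (ltW x0)); apply/andP; split; lra.
- by rewrite (pos_0 (ltW x0)) (pos_0 (ltW y0)); apply/andP; split; lra.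
Qed.

Lemma pos2_ge0 x : 0 <= pos2 x. Proof. by rewrite /pos2 sqr_ge0. Qed.

Lemma pos2_0 x : x <= 0 -> pos2 x = 0.
Proof. by move=> x0; rewrite /pos2 pos_0// expr0n. Qed.

Lemma pos2_le1 x : x <= 1 -> pos2 x <= 1.
Proof.
move=> x1; rewrite /pos2 expr_le1 ?pos_ge0//.
by rewrite /pos ge_max x1 ler01.
Qed.

Lemma pos2_ge1 x : 1 <= x -> 1 <= pos2 x.
Proof. by move=> x1; rewrite /pos2 pos_id; [exact: exprn_ege1|lra]. Qed.

(** A C^1 transition from 0 on t <= 1/2 to 1 on 1 <= t, and its derivative. *)
Definition transition t := 1 - pos2 (1 - pos2 (2 * t - 1)).
Definition dtransition t := 8 * (pos (1 - pos2 (2 * t - 1)) * pos (2 * t - 1)).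

Lemma transition_itv t : 0 <= transition t <= 1.
Proof.
rewrite /transition; have := pos2_ge0 (1 - pos2 (2 * t - 1)).
have := @pos2_le1 (1 - pos2 (2 * t - 1)); have := pos2_ge0 (2 * t - 1).
by move=> h /(_ ltac:(lra)); lra.
Qed.

Lemma transition0 t : t <= 2^-1 -> transition t = 0.
Proof.
move=> t1; rewrite /transition (@pos2_0 (2 * t - 1)); last lra.
by rewrite subr0 /pos2 pos_id// expr1n subrr.
Qed.

Lemma transition1 t : 1 <= t -> transition t = 1.
Proof.
move=> t1; have := @pos2_ge1 (2 * t - 1) ltac:(lra) => h.
by rewrite /transition (@pos2_0 (1 - _)) ?subr0//; lra.
Qed.

Lemma dtransition_ge0 t : 0 <= dtransition t.
Proof. by rewrite /dtransition !mulr_ge0 ?pos_ge0. Qed.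

Lemma dtransition1 t : 1 <= t -> dtransition t = 0.
Proof.
move=> t1; have := @pos2_ge1 (2 * t - 1) ltac:(lra) => h.
by rewrite /dtransition (@pos_0 (1 - _)) ?mul0r ?mulr0//; lra.
Qed.

Lemma dtransition_le8 t : dtransition t <= 8.
Proof.
have [t1|t1] := leP 1 t; first by rewrite dtransition1.
rewrite /dtransition -[leRHS]mulr1 ler_pM2l// mulr_ile1 ?pos_ge0//.
  by rewrite /pos ge_max ler01/=; have := pos2_ge0 (2 * t - 1); lra.
by rewrite /pos ge_max ler01/=; lra.
Qed.

Lemma continuous_dtransition : continuous dtransition.
Proof.
move=> t; rewrite /dtransition.
have c1 : (fun t : R => 2 * t - 1) x @[x --> t] --> 2 * t - 1.
  by apply: cvgB; [apply: cvgM; [exact: cvg_cst|exact: cvg_id]|exact: cvg_cst].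
have c2 : (fun t : R => pos (2 * t - 1)) x @[x --> t] --> pos (2 * t - 1).
  exact: (continuous_cvg _ (@continuous_pos _) c1).
apply: cvgM; first exact: cvg_cst.
apply: cvgM; last exact: c2.
apply: (continuous_cvg _ (@continuous_pos _)).
by apply: cvgB; [exact: cvg_cst|apply: cvgM; exact: c2].
Qed.

Lemma is_derive_transition t : is_derive t 1 transition (dtransition t).
Proof.
pose q (y : R) := 2 * y - 1.
have dq (y : R) : is_derive y 1 q 2.
  apply: (@is_derive_quadratic _ _ _ 0) => z.
  by rewrite mul0r (_ : _ - _ - _ = 0) ?normr0// /q; ring.
have d1 := @is_derive1_comp _ pos2 q t _ _ (is_derive_pos2 (q t)) (dq t).
have d2 : is_derive t 1 (fun y => 1 - pos2 (q y)) (- (2 * pos (q t) * 2)).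
  apply: is_derive_eq. by ring.
have d3 := @is_derive1_comp _ pos2 (fun y => 1 - pos2 (q y)) t _ _ (is_derive_pos2 _) d2.
have d4 : is_derive t 1 (fun y => 1 - pos2 (1 - pos2 (q y)))
   (- (2 * pos (1 - pos2 (q t)) * (- (2 * pos (q t) * 2)))).
  apply: is_derive_eq. by ring.
rewrite (_ : dtransition t = - (2 * pos (1 - pos2 (q t)) * (- (2 * pos (q t) * 2)))) //.
rewrite /dtransition /q; ring.
Qed.

End PosSquare.

Section CantorCutoff.
Context (R : realType) (rho : R).
Hypothesis rho_gt0 : 0 < rho.
Hypothesis rho_le : rho <= 8^-1.
Implicit Types (c s : R) (u v : R * R).

Definition right_end c s := c + (1 - rho) * s.

(** The n-th stage is made of 2^n squares centred on the axis.  They are twice as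
    wide as the intervals of the usual construction from [c, c + s], which leaves
    room for the n-th cutoff to vanish around the whole stage n.+1. *)
Fixpoint cantor_level n c s : set (R * R) :=
  if n is m.+1 then cantor_level m c (rho * s) `|` cantor_level m (right_end c s) (rho * s)
  else [set u | `|u.1 - c - s / 2| <= s /\ `|u.2| <= s].

Definition cantor c s : set (R * R) := \bigcap_n cantor_level n c s.

Let srho s : 0 < s -> 0 < rho * s /\ rho * s <= s / 8.
Proof. by move=> s0; split; [rewrite mulr_gt0|rewrite mulrC ler_pM2l]. Qed.

Lemma cantor_level_child0 c s u : 0 < s -> cantor_level 0 c (rho * s) u -> cantor_level 0 c s u.
Proof.
by move=> s0 /= [h1 h2]; have [r0 r1] := srho s0; move: h1 h2; rewrite !ler_norml; lra.
Qed.

Lemma cantor_level_child1 c s u : 0 < s -> cantor_level 0 (right_end c s) (rho * s) u -> cantor_level 0 c s u.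
Proof.
rewrite /right_end mulrBl mul1r.
by move=> s0 /= [h1 h2]; have [r0 r1] := srho s0; move: h1 h2; rewrite !ler_norml; lra.
Qed.

Lemma cantor_levelS n c s : 0 < s -> cantor_level n.+1 c s `<=` cantor_level n c s.
Proof.
elim: n c s => [|n IH] c s s0.
  by move=> u [/(cantor_level_child0 s0)|/(cantor_level_child1 s0)].
have [r0 _] := srho s0.
by move=> u [/(IH _ _ r0)|/(IH _ _ r0)]; [left|right].
Qed.

Lemma cantor_level_mono n m c s : 0 < s -> (n <= m)%N -> cantor_level m c s `<=` cantor_level n c s.
Proof.
move=> s0 /subnK <-; elim: (m - n)%N => // k IH u h.
by apply: IH; rewrite addSn in h; exact: cantor_levelS.
Qed.

Lemma cantor_level_im n c s u : 0 < s -> cantor_level n c s u -> `|u.2| <= rho ^+ n * s.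
Proof.
elim: n c s => [|n IH] c s s0; first by rewrite expr0 mul1r => -[].
have [r0 _] := srho s0.
by rewrite exprSr -mulrA; case; apply: IH.
Qed.

Lemma cantor_level_start n c s : 0 < s -> cantor_level n c s (c, 0).
Proof.
elim: n c s => [|n IH] c s s0.
  by rewrite /= normr0 subrr sub0r normrN ger0_norm; [split|]; lra.
by left; apply: IH; have [] := srho s0.
Qed.

Lemma closed_cantor_level n c s : closed (cantor_level n c s).
Proof.
elim: n c s => [|n IH] c s; last by apply: closedU; exact: IH.
rewrite (_ : cantor_level 0 c s = [set u : R * R | `|u.1 - c - s / 2| <= s] `&` [set u | `|u.2| <= s]) //.
apply: closedI.
  apply: (@closed_comp _ _ (fun u : R * R => `|u.1 - c - s / 2|) [set y | y <= s]); last exact: closed_le.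
  move=> u _; apply: cvg_norm; apply: cvgB; last exact: cvg_cst.
  by apply: cvgB; [exact: cvg_fst|exact: cvg_cst].
apply: (@closed_comp _ _ (fun u : R * R => `|u.2|) [set y | y <= s]); last exact: closed_le.
move=> u _; apply: cvg_norm; exact: cvg_snd.
Qed.

Lemma closed_cantor c s : closed (cantor c s).
Proof. by apply: closed_bigI => n _; exact: closed_cantor_level. Qed.

Lemma cantor_split c s u : 0 < s ->
  cantor c s u <-> cantor c (rho * s) u \/ cantor (right_end c s) (rho * s) u.
Proof.
move=> s0; have [r0 _] := srho s0; split.
  move=> h; have [h1|/existsNP[n /not_implyP[_ h1]]] := pselect (cantor c (rho * s) u); first by left.
  right=> m _; have := h (maxn n m).+1 I => -[].
    by move=> /(cantor_level_mono r0 (leq_maxl n m)).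
  by move=> /(cantor_level_mono r0 (leq_maxr n m)).
case=> h n _; apply: cantor_levelS => //; [left|right]; exact: h.
Qed.

Lemma cantor_start c s : 0 < s -> cantor c s (c, 0).
Proof. by move=> s0 n _; exact: cantor_level_start. Qed.

Lemma cantor_im c s u : 0 < s -> cantor c s u -> u.2 = 0.
Proof.
move=> s0 h; apply/eqP; rewrite -normr_le0; apply/ler_addgt0Pr => e e0; rewrite add0r.
have r1 : `|rho| < 1 by rewrite gtr0_norm// (le_lt_trans rho_le)// invf_lt1// ltr1n.
have /cvgrPdist_lt/(_ _ (divr_gt0 e0 s0)) := cvg_expr r1.
move=> [n _ /(_ n (leqnn n))]; rewrite /= sub0r normrN gtr0_norm ?exprn_gt0//.
rewrite ltr_pdivlMr// => /ltW; apply: le_trans.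
by apply: cantor_level_im (h n I).
Qed.

Lemma cantor_re c s u : 0 < s -> cantor c s u -> c - s / 16 <= u.1 <= c + s + s / 16.
Proof.
move=> s0 /(_ 1%N I) /=; rewrite /right_end mulrBl mul1r.
by have [r0 r1] := srho s0; rewrite !ler_norml; lra.
Qed.

Definition sqdist c s u := ((u.1 - c) / s - 2^-1) ^+ 2 + (u.2 / s) ^+ 2.

(** One bump for each square of stage n.  The recursion on n at varying (c, s)
    avoids any change of variables: estimates at (c, s) follow from those at the
    two children, whose scale is rho * s. *)
Fixpoint cutoff n c s u : R :=
  if n is m.+1 then cutoff m c (rho * s) u * cutoff m (right_end c s) (rho * s) u
  else transition (sqdist c s u).

Fixpoint dcutoff1 n c s u : R :=
  if n is m.+1 then
    cutoff m c (rho * s) u * dcutoff1 m (right_end c s) (rho * s) u +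
    cutoff m (right_end c s) (rho * s) u * dcutoff1 m c (rho * s) u
  else dtransition (sqdist c s u) * (2 * ((u.1 - c) / s - 2^-1) / s).

Fixpoint dcutoff2 n c s u : R :=
  if n is m.+1 then
    cutoff m c (rho * s) u * dcutoff2 m (right_end c s) (rho * s) u +
    cutoff m (right_end c s) (rho * s) u * dcutoff2 m c (rho * s) u
  else dtransition (sqdist c s u) * (2 * (u.2 / s) / s).

Lemma cutoff_itv n c s u : 0 <= cutoff n c s u <= 1.
Proof.
elim: n c s => [|n IH] c s /=; first exact: transition_itv.
have /andP[h1 h2] := IH c (rho * s); have /andP[h3 h4] := IH (right_end c s) (rho * s).
by rewrite mulr_ge0//= mulr_ile1.
Qed.

Lemma diff2_sqdist c s u :
  is_diff2 (sqdist c s) u (2 * ((u.1 - c) / s - 2^-1) / s) (2 * (u.2 / s) / s).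
Proof.
have h1 : is_diff2 (fun v : R * R => (v.1 - c) / s - 2^-1) u (s^-1) 0.
  have := diff2_add (diff2_scale s^-1 (diff2_fst u)) (diff2_cst (- (c / s) - 2^-1) u).
  move=> h; apply: (diff2_ext h); [near=> v; ring|ring|ring].
have h2 : is_diff2 (fun v : R * R => v.2 / s) u 0 (s^-1).
  have h := diff2_scale s^-1 (diff2_snd u).
  apply: (diff2_ext h); [near=> v; ring|ring|ring].
have := diff2_add (diff2_mul h1 h1) (diff2_mul h2 h2).
move=> h; apply: (diff2_ext h); [near=> v; rewrite /sqdist; ring|ring|ring].
Unshelve. all: by end_near. Qed.

Lemma diff2_cutoff n c s u : is_diff2 (cutoff n c s) u (dcutoff1 n c s u) (dcutoff2 n c s u).
Proof.
elim: n c s => [|n IH] c s /=; last exact: diff2_mul.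
exact: (diff2_comp (diff2_sqdist c s u) (is_derive_transition _)).
Qed.

Lemma continuous_cutoff n c s : continuous (cutoff n c s).
Proof. by move=> u; exact: diff2_continuous (diff2_cutoff n c s u). Qed.

Let continuous_dtr c s : continuous (fun u => dtransition (sqdist c s u)).
Proof.
move=> u; apply: (continuous_cvg _ (@continuous_dtransition R _)).
exact: diff2_continuous (diff2_sqdist c s u).
Qed.

Lemma continuous_dcutoff1 n c s : continuous (dcutoff1 n c s).
Proof.
elim: n c s => [|n IH] c s u /=.
  apply: cvgM; first exact: continuous_dtr.
  apply: cvgM; last exact: cvg_cst.
  apply: cvgM; first exact: cvg_cst.
  apply: cvgB; last exact: cvg_cst.
  apply: cvgM; last exact: cvg_cst.
  by apply: cvgB; [exact: cvg_fst|exact: cvg_cst].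
by apply: cvgD; apply: cvgM; (exact: continuous_cutoff || exact: IH).
Qed.

Lemma continuous_dcutoff2 n c s : continuous (dcutoff2 n c s).
Proof.
elim: n c s => [|n IH] c s u /=.
  apply: cvgM; first exact: continuous_dtr.
  apply: cvgM; last exact: cvg_cst.
  apply: cvgM; first exact: cvg_cst.
  by apply: cvgM; [exact: cvg_snd|exact: cvg_cst].
by apply: cvgD; apply: cvgM; (exact: continuous_cutoff || exact: IH).
Qed.

Lemma sqdist_out c s u : 0 < s -> ~ cantor_level 0 c s u -> 1 <= sqdist c s u.
Proof.
move=> s0 /not_andP h; rewrite /sqdist.
have sq1 (x : R) : ~ (`|x * s| <= s) -> 1 <= x ^+ 2.
  rewrite normrM (gtr0_norm s0) ger_pMl// => /negP; rewrite -ltNge => /ltW x1.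
  by rewrite -real_normK ?num_real// exprn_ege1.
case: h => h.
  have := sq1 ((u.1 - c) / s - 2^-1).
  rewrite (_ : _ * s = u.1 - c - s / 2) => [/(_ h)|]; last by field; lra.
  by have := sqr_ge0 (u.2 / s); lra.
have := sq1 (u.2 / s); rewrite divfK ?gt_eqF// => /(_ h).
by have := sqr_ge0 ((u.1 - c) / s - 2^-1); lra.
Qed.

Lemma cutoff_out n c s u : 0 < s -> ~ cantor_level n c s u -> cutoff n c s u = 1.
Proof.
elim: n c s => [|n IH] c s s0 /=; last first.
  have [r0 _] := srho s0.
  by move=> /not_orP[h1 h2]; rewrite !IH// mulr1.
by move=> h; apply: transition1; exact: sqdist_out.
Qed.

Lemma cutoff_near n c s u v : 0 < s -> cantor_level n.+1 c s u ->
  `|v.1 - u.1| <= rho ^+ n * s / 20 -> `|v.2 - u.2| <= rho ^+ n * s / 20 ->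
  cutoff n c s v = 0.
Proof.
elim: n c s => [|n IH] c s s0.
  rewrite expr0 mul1r => h v1 v2; apply: transition0; rewrite /sqdist.
  have [r0 r1] := srho s0.
  have [w1 w2] : `|v.1 - c - s / 2| <= 5 / 8 * s /\ `|v.2| <= s / 4.
    move: h v1 v2; rewrite /= /right_end mulrBl mul1r !ler_norml; lra.
  have e1 : ((v.1 - c) / s - 2^-1) = (v.1 - c - s / 2) / s by field; lra.
  have e2 : `|(v.1 - c - s / 2) / s| <= 5 / 8 by rewrite normrM normfV (gtr0_norm s0) ler_pdivrMr.
  have e3 : `|v.2 / s| <= 4^-1 by rewrite normrM normfV (gtr0_norm s0) ler_pdivrMr//; lra.
  have e4 : `|(v.1 - c - s / 2) / s| ^+ 2 <= (5 / 8) ^+ 2 by rewrite ler_sqr// nnegrE; lra.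
  have e5 : `|v.2 / s| ^+ 2 <= (4^-1) ^+ 2 by rewrite ler_sqr// nnegrE; lra.
  rewrite e1 -[X in X + _]real_normK ?num_real// -[X in _ + X]real_normK ?num_real//.
  lra.
have [r0 _] := srho s0.
move=> h v1 v2; rewrite /=; move: v1 v2; rewrite exprSr -(mulrA _ rho s) => v1 v2.
by case: h => h; rewrite (IH _ _ r0 h v1 v2) ?mul0r ?mulr0.
Qed.

End CantorCutoff.

(** * The gradients of the cutoffs are small in mean *)

Section CutoffGradient.
Context (R : realType) (rho : R).
Hypothesis rho_gt0 : 0 < rho.
Hypothesis rho_le : rho <= 8^-1.
Notation mu2 := (plane_measure R).

Definition gradient_size n c s u :=
  `|dcutoff1 rho n c s u| + `|dcutoff2 rho n c s u|.

Lemma gradient_size_ge0 n c s u : 0 <= gradient_size n c s u.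
Proof. by rewrite addr_ge0. Qed.

Lemma continuous_gradient_size n c s : continuous (gradient_size n c s).
Proof.
move=> u; apply: cvgD; apply: cvg_norm.
- exact: continuous_dcutoff1.
- exact: continuous_dcutoff2.
Qed.

Lemma gradient_size0 c s u : 0 < s -> gradient_size 0 c s u <= 32 / s.
Proof.
move=> s0; rewrite /gradient_size /=.
have [t1|t1] := leP 1 (sqdist c s u).
  by rewrite dtransition1// !mul0r normr0 addr0 divr_ge0// ltW.
have lt1 (x : R) : x ^+ 2 <= sqdist c s u -> `|dtransition (sqdist c s u) * (2 * x / s)| <= 16 / s.
  move=> xd; have x1 : `|x| <= 1.
    by rewrite -(@expr_le1 _ 2)// real_normK ?num_real//; lra.
  rewrite (normrM (dtransition _)) (ger0_norm (dtransition_ge0 _)).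
  rewrite (normrM (2 * x)) normfV (gtr0_norm s0) mulrA ler_pM2r ?invr_gt0//.
  rewrite (normrM 2) [`|2|]ger0_norm//; have := dtransition_le8 (sqdist c s u).
  have := dtransition_ge0 (sqdist c s u); have := normr_ge0 x.
  set d := dtransition _; set y := `|x| in x1 *; move=> y0 d0 d8.
  have : d * y <= 8 * 1 by rewrite ler_pM.
  lra.
have h1 := lt1 ((u.1 - c) / s - 2^-1) ltac:(by rewrite /sqdist lerDl sqr_ge0).
have h2 := lt1 (u.2 / s) ltac:(by rewrite /sqdist lerDr sqr_ge0).
by rewrite (_ : 32 = 16 + 16); [rewrite (mulrDl 16 16) lerD|ring].
Qed.

Lemma gradient_size0_out c s u : 0 < s -> ~ cantor_level rho 0 c s u -> gradient_size 0 c s u = 0.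
Proof.
move=> s0 h; rewrite /gradient_size /= dtransition1 ?mul0r ?normr0 ?addr0//.
exact: (sqdist_out s0 h).
Qed.

Lemma gradient_sizeS n c s u : gradient_size n.+1 c s u <=
  gradient_size n c (rho * s) u + gradient_size n (right_end rho c s) (rho * s) u.
Proof.
rewrite /gradient_size /=.
set a := cutoff _ _ _ _ _; set b := cutoff _ _ _ _ _.
have /andP[a0 a1] : 0 <= a <= 1 by exact: cutoff_itv.
have /andP[b0 b1] : 0 <= b <= 1 by exact: cutoff_itv.
have key (x y : R) : `|a * x + b * y| <= `|x| + `|y|.
  rewrite (le_trans (ler_normD _ _))// !normrM (ger0_norm a0) (ger0_norm b0).
  by rewrite lerD// ler_piMl.
by rewrite addrACA lerD// (le_trans (key _ _))// addrC.
Qed.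

Variables (D : set (plane R)) (g : R * R -> R) (al be : R).
Hypothesis mD : measurable D.
Hypothesis mg : measurable_fun D g.
Hypothesis g0 : forall u, D u -> 0 <= g u.
Hypothesis gsq : forall c s, 0 < s ->
  (\int[mu2]_(u in D `&` cantor_level rho 0 c s) (g u)%:E <= (al * s ^+ 2 + be)%:E)%E.

Let mgg n c s : measurable_fun D (fun u => (g u * gradient_size n c s u)%:E).
Proof.
apply/measurable_EFinP; apply: measurable_funM => //.
apply: (@measurable_funS _ _ _ _ setT) => //.
apply: continuous_measurable_plane; [exact: openT|by move=> u _; exact: continuous_gradient_size].
Qed.

(** The 2^n bumps of stage n have gradients of size at most 32 / (rho^n s) on their
    squares, over each of which the integral of g is at most
    al (rho^n s)^2 + be. *)
Lemma integral_gradient n c s : 0 < s ->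
  (\int[mu2]_(u in D) (g u * gradient_size n c s u)%:E <=
   (2 ^+ n * 32 * (al * (rho ^+ n * s) + be / (rho ^+ n * s)))%:E)%E.
Proof.
elim: n c s => [|n IH] c s s0.
  rewrite !expr0 !mul1r.
  have msq : measurable (cantor_level rho 0 c s : set (plane R)) by apply: closed_measurable_plane; exact: closed_cantor_level.
  have H : (\int[mu2]_(u in D) (g u * gradient_size 0 c s u)%:E <=
     \int[mu2]_(u in D) ((32 / s)%:E * ((EFin \o g) \_ (cantor_level rho 0 c s)) u))%E.
    apply: ge0_le_integral => //.
    - by move=> u Du; rewrite lee_fin mulr_ge0 ?g0// gradient_size_ge0.
    - apply: emeasurable_funM => //.
      by apply/measurable_restrict => //; apply: measurable_funS (measurableT_comp _ mg) => //; exact: subIsetl.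
    - move=> u Du; rewrite patchE; case: ifPn => [usq|]; rewrite ?inE ?notin_setE.
        by rewrite lee_fin mulrC ler_wpM2r ?g0//; exact: gradient_size0.
      by move=> nsq; rewrite gradient_size0_out// mulr0 mule0.
  apply: (le_trans H); rewrite ge0_integralZl//; first last.
  - by rewrite lee_fin divr_ge0// ltW.
  - move=> u Du; rewrite patchE; case: ifPn => // _; rewrite lee_fin; exact: g0.
  - by apply/measurable_restrict => //; apply: measurable_funS (measurableT_comp _ mg) => //; exact: subIsetl.
  rewrite -integral_mkcondr.
  apply: (@le_trans _ _ ((32 / s)%:E * (al * s ^+ 2 + be)%:E)%E).
    by apply: lee_wpmul2l; [rewrite lee_fin divr_ge0// ltW|exact: gsq].
  rewrite -EFinM lee_fin le_eqVlt; apply/orP; left; apply/eqP.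
  by field; lra.
have r0 : 0 < rho * s by rewrite mulr_gt0.
apply: (@le_trans _ _ (\int[mu2]_(u in D) ((g u * gradient_size n c (rho * s) u)%:E +
    (g u * gradient_size n (right_end rho c s) (rho * s) u)%:E))%E).
  apply: ge0_le_integral => //.
  - by move=> u Du; rewrite lee_fin mulr_ge0 ?g0// gradient_size_ge0.
  - by apply: emeasurable_funD.
  - by move=> u Du; rewrite -EFinD lee_fin -mulrDr ler_wpM2l ?g0//; exact: gradient_sizeS.
rewrite ge0_integralD//; first last.
- by move=> u Du; rewrite lee_fin mulr_ge0 ?g0// gradient_size_ge0.
- by move=> u Du; rewrite lee_fin mulr_ge0 ?g0// gradient_size_ge0.
apply: (le_trans (leeD (IH c _ r0) (IH (right_end rho c s) _ r0))).
rewrite -EFinD lee_fin le_eqVlt; apply/orP; left; apply/eqP.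
rewrite exprS [rho ^+ n.+1]exprSr; field.
by rewrite expf_neq0 ?gt_eqF.
Qed.

End CutoffGradient.

(** * Radial test functions *)

Section Profile.
Context (R : realType).
Implicit Types (t s d : R).

(** 1 - ramp s d is the continuous cutoff equal to 1 up to (1 - d) s and to 0 from s
    on. *)
Definition ramp s d t := (pos (t - (1 - d) * s) - pos (t - s)) / (d * s).
Definition ramp_int s d t := (pos2 (t - (1 - d) * s) - pos2 (t - s)) / (2 * (d * s)).

Lemma near_le t c : t < c -> \forall y \near t, y <= c.
Proof.
move=> tc; apply/nbhs_ballP; exists (c - t); first by rewrite /= subr_gt0.
by move=> y; rewrite /ball/= => /ltr_normlP[]; lra.
Qed.

Section Ramp.
Variables (s d : R).
Hypothesis s0 : 0 < s.
Hypothesis d01 : 0 < d < 1.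

Let d0 : 0 < d. Proof. by case/andP: d01. Qed.
Let ds0 : 0 < d * s. Proof. by rewrite mulr_gt0. Qed.
Let c0 : 0 < (1 - d) * s. Proof. by rewrite mulr_gt0// subr_gt0; case/andP: d01. Qed.
Let cs : (1 - d) * s < s. Proof. by rewrite gtr_pMl//; have := d0; lra. Qed.

Lemma ramp_lo t : t <= (1 - d) * s -> ramp s d t = 0.
Proof. by move=> ts; have := cs; rewrite /ramp => ?; rewrite !pos_0 ?subrr ?mul0r//; lra. Qed.

Lemma ramp_hi t : s <= t -> ramp s d t = 1.
Proof.
have := cs => h ts; rewrite /ramp !pos_id; try lra.
by rewrite (_ : _ - _ - _ = d * s) ?divff ?gt_eqF//; ring.
Qed.

Lemma ramp_itv t : 0 <= ramp s d t <= 1.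
Proof.
rewrite /ramp ler_pdivlMr// mul0r ler_pdivrMr// mul1r.
have [h1|h1] := leP t s.
  rewrite (@pos_0 _ (t - s)); last lra.
  have := pos_ge0 (t - (1 - d) * s); rewrite subr0 => -> /=.
  have := cs; have := ds0 => h2 h3.
  by rewrite /pos ge_max ltW//=; lra.
have := cs => h; rewrite !pos_id; [|lra..].
by have := ds0; lra.
Qed.

Lemma ramp_int_lo t : t <= (1 - d) * s -> ramp_int s d t = 0.
Proof. by move=> ts; have := cs => ?; rewrite /ramp_int !pos2_0 ?subrr ?mul0r//; lra. Qed.

Lemma ramp_int_hi t : s <= t -> ramp_int s d t = t - (1 - d / 2) * s.
Proof.
have := cs => h ts; rewrite /ramp_int /pos2 !pos_id; [|lra..].
by field; rewrite !gt_eqF.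
Qed.

Lemma is_derive_pos2B t c : is_derive t 1 (fun y => pos2 (y - c)) (2 * pos (t - c)).
Proof.
have d1 : is_derive t 1 (fun y => y - c) (1 : R).
  apply: (@is_derive_quadratic _ _ _ _ 0) => z.
  by rewrite mul0r (_ : _ - _ - _ = 0) ?normr0//; ring.
have := @is_derive1_comp _ (@pos2 R) (fun y => y - c) t _ _ (is_derive_pos2 _) d1.
by rewrite mulr1.
Qed.

Lemma is_derive_ramp_int t : is_derive t 1 (ramp_int s d) (ramp s d t).
Proof.
have h1 := is_derive_pos2B t ((1 - d) * s); have h2 := is_derive_pos2B t s.
rewrite (_ : ramp_int s d = (fun y => (2 * (d * s))^-1 *: (pos2 (y - (1 - d) * s) - pos2 (y - s)))); last first.
  by apply/funext => y; rewrite /ramp_int /GRing.scale/= mulrC.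
apply: is_derive_eq; rewrite /ramp /GRing.scale/=; field.
by rewrite !gt_eqF.
Qed.

Lemma continuous_ramp : continuous (ramp s d).
Proof.
move=> t; apply: cvgM; last exact: cvg_cst.
have cp c : (fun y : R => pos (y - c)) y @[y --> t] --> pos (t - c).
  by apply: (continuous_cvg _ (@continuous_pos R _)); apply: cvgB; [exact: cvg_id|exact: cvg_cst].
by apply: cvgB; exact: cp.
Qed.

Lemma continuous_ramp_int : continuous (ramp_int s d).
Proof.
move=> t; apply: differentiable_continuous; apply/derivable1_diffP.
by have [] := is_derive_ramp_int t.
Qed.

Definition ramp_quot t := ramp_int s d t / t.
Definition dramp_quot t := (ramp s d t * t - ramp_int s d t) / t ^+ 2.

Lemma is_derive_ramp_quot t : is_derive t 1 ramp_quot (dramp_quot t).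
Proof.
have [tc|tc] := ltP t ((1 - d) * s).
  rewrite /dramp_quot ramp_lo ?ramp_int_lo ?ltW// mul0r subrr mul0r.
  have e : \forall y \near t, (0 : R) = ramp_quot y.
    near=> y; rewrite /ramp_quot ramp_int_lo ?mul0r//.
    by near: y; exact: near_le.
  exact: (near_eq_is_derive (f := fun=> 0 : R) e (is_derive_cst _ _ _)).
have t0 : t != 0 by rewrite gt_eqF//; exact: lt_le_trans tc.
have h1 := is_derive_ramp_int t.
have h2 : is_derive t 1 (fun y : R => y^-1) (- t ^- 2).
  have di : derivable (id : R -> R) t 1 by exact: derivable_id.
  apply: DeriveDef; first exact: (derivableV (f := id)).
  by rewrite (deriveV (f := id))// derive_id /GRing.scale/= mulr1.
rewrite (_ : dramp_quot t = ramp_int s d t * (- t ^- 2) + t^-1 * ramp s d t); last first.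
  by rewrite /dramp_quot; field.
exact: is_deriveM.
Unshelve. all: by end_near. Qed.

Lemma continuous_dramp_quot : continuous dramp_quot.
Proof.
move=> t; have [tc|tc] := ltP t ((1 - d) * s).
  have e : \forall y \near t, 0 = dramp_quot y.
    near=> y; rewrite /dramp_quot ramp_lo ?ramp_int_lo ?mul0r ?subrr ?mul0r//.
      by near: y; exact: near_le.
    by near: y; exact: near_le.
  have e0 := nbhs_singleton e; rewrite /continuous_at -e0.
  have c0' : (fun=> 0 : R) y @[y --> t] --> (0 : R) by exact: cvg_cst.
  by apply: cvg_trans c0'; exact: near_eq_cvg.
have t0 : t ^+ 2 != 0 by rewrite expf_neq0// gt_eqF//; exact: lt_le_trans tc.
apply: cvgM; last by apply: (@continuous_comp _ _ _ (fun y : R => y ^+ 2) GRing.inv); [exact: exprn_continuous|exact: inv_continuous].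
apply: cvgB; last exact: continuous_ramp_int.
by apply: cvgM; [exact: continuous_ramp|exact: cvg_id].
Unshelve. all: by end_near. Qed.

Lemma ramp_quot_deriv t : 0 <= t -> ramp_quot t + t * dramp_quot t = ramp s d t.
Proof.
rewrite le_eqVlt => /predU1P[<-|t0].
  by rewrite /ramp_quot ramp_int_lo ?ramp_lo ?mul0r ?addr0// ltW.
by rewrite /ramp_quot /dramp_quot; field; rewrite gt_eqF.
Qed.

End Ramp.

(** kernel1 s d t is h(t) / t for the primitive h of weight s d with h(0) = 0.  As
    h(t) = 1 - d / 2 for all t >= s, independently of s, the difference of two
    such kernels has compact support, and
      dbar (conj w * radial_kernel (|w|^2)) = weight s (|w|^2) - weight s' (|w|^2). *)
Definition kernel1 s d t := (1 - ramp_quot s d t) / s.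
Definition radial_kernel s s' d t := kernel1 s d t - kernel1 s' d t.
Definition dradial_kernel s s' d t := dramp_quot s' d t / s' - dramp_quot s d t / s.
Definition weight s d t := (1 - ramp s d t) / s.

Section Kernel.
Variables (s s' d : R).
Hypothesis s0 : 0 < s.
Hypothesis s'0 : 0 < s'.
Hypothesis d01 : 0 < d < 1.

Lemma is_derive_radial_kernel t :
  is_derive t 1 (radial_kernel s s' d) (dradial_kernel s s' d t).
Proof.
have h1 := is_derive_ramp_quot s0 d01 t; have h2 := is_derive_ramp_quot s'0 d01 t.
rewrite (_ : radial_kernel s s' d =
  (fun y => s^-1 *: (1 - ramp_quot s d y) - s'^-1 *: (1 - ramp_quot s' d y))); last first.
  by apply/funext => y; rewrite /radial_kernel /kernel1 /GRing.scale/=; ring.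
by apply: is_derive_eq; rewrite /dradial_kernel /GRing.scale/=; ring.
Qed.

Lemma continuous_dradial_kernel : continuous (dradial_kernel s s' d).
Proof.
move=> t; apply: cvgB; (apply: cvgM; last exact: cvg_cst); exact: continuous_dramp_quot.
Qed.

Lemma radial_kernel_hi t : s <= t -> s' <= t -> radial_kernel s s' d t = 0.
Proof.
move=> st s't; rewrite /radial_kernel /kernel1 /ramp_quot !ramp_int_hi//.
by field; rewrite !gt_eqF//; exact: lt_le_trans st.
Qed.

Lemma dradial_kernel_hi t : s <= t -> s' <= t -> dradial_kernel s s' d t = 0.
Proof.
move=> st s't; rewrite /dradial_kernel /dramp_quot !ramp_int_hi// !ramp_hi//.
by field; rewrite !gt_eqF//; exact: lt_le_trans st.
Qed.

Lemma radial_kernel_deriv t : 0 <= t ->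
  radial_kernel s s' d t + t * dradial_kernel s s' d t = weight s d t - weight s' d t.
Proof.
move=> t0; have h1 := ramp_quot_deriv s0 d01 t0; have h2 := ramp_quot_deriv s'0 d01 t0.
rewrite /weight -h1 -h2 /radial_kernel /kernel1 /dradial_kernel; ring.
Qed.

End Kernel.

End Profile.

(** * Holomorphic functions tested against cutoff radial functions *)

Lemma diff2_uniq0 (R : realType) (f : R * R -> R) u A B : is_diff2 f u A B ->
  (\forall v \near u, f v = 0) -> A = 0 /\ B = 0.
Proof.
move=> df f0; have fu := nbhs_singleton f0.
have H : forall e, 0 < e -> `|A| <= e /\ `|B| <= e.
  move=> e e0; have [d d0 Hd] := (near_boxP _ _).1 (filterI f0 (df e e0)).
  have d20 : 0 < d / 2 by lra.
  split.
    have [||/= -> ] := Hd (u.1 + d / 2, u.2).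
    - by rewrite /= addrAC subrr add0r gtr0_norm//; lra.
    - by rewrite /= subrr normr0.
    by rewrite fu /dist1 /= !subrr sub0r normrN [u.1 + _]addrC addrK mulr0 normr0 !addr0 normrM ler_pM2r// normr_gt0 gt_eqF.
  have [||/= -> ] := Hd (u.1, u.2 + d / 2).
  - by rewrite /= subrr normr0.
  - by rewrite /= addrAC subrr add0r gtr0_norm//; lra.
  by rewrite fu /dist1 /= !subrr sub0r normrN [u.2 + _]addrC addrK mulr0 normr0 !add0r normrM ler_pM2r// normr_gt0 gt_eqF.
by split; apply/eqP; rewrite -normr_le0; apply/ler_addgt0Pr => e /H[]; rewrite add0r.
Qed.

Section Rdominated.
Context d (T : measurableType d) (R : realType) (mu : {measure set T -> \bar R}).

Lemma Rintegral_dominated_cvg (D : set T) (f_ : nat -> T -> R) (f g : T -> R) :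
  measurable D -> (forall n, measurable_fun D (f_ n)) ->
  (forall x, D x -> f_ n x @[n --> \oo] --> f x) ->
  mu.-integrable D (EFin \o g) -> mu.-integrable D (EFin \o f) ->
  (forall n x, D x -> `|f_ n x| <= g x) ->
  \int[mu]_(x in D) f_ n x @[n --> \oo] --> \int[mu]_(x in D) f x.
Proof.
move=> mD mf ff ig intf fg.
apply: fine_cvg; rewrite fineK; last exact: integrable_fin_num.
apply: (@dominated_cvg _ _ _ mu D mD (fun n x => (f_ n x)%:E) _ (EFin \o g)) => //.
- by move=> n; apply/measurable_EFinP.
- by move=> x Dx; apply: cvg_EFin; [exact: nearW|exact: ff].
Qed.

End Rdominated.

Section GreenHolomorphic.
Context (R : realType).
Notation mu2 := (plane_measure R).

Definition cauchy_riemann (om : set (R * R)) (a b : R * R -> R) :=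
  forall u, om u -> exists A B, is_diff2 a u A B /\ is_diff2 b u (- B) A.

(** The integrand is the real part of 2 (a + i b) dbar (conj w K), that is of
    2 dbar ((a + i b) conj w K), and hence the divergence of a field with compact
    support. *)
Lemma green_cauchy_riemann (om : set (R * R)) (L : R) (a b K K1 K2 : R * R -> R) :
  (forall u, om u -> `|u.1| < L /\ `|u.2| < L) ->
  cauchy_riemann om a b ->
  (forall u, is_diff2 K u (K1 u) (K2 u)) -> continuous K1 -> continuous K2 ->
  (forall u, ~ om u -> \forall v \near u, [/\ K v = 0, K1 v = 0 & K2 v = 0]) ->
  \int[mu2]_(u in om) (2 * a u * K u + (a u * u.1 + b u * u.2) * K1 u
     + (a u * u.2 - b u * u.1) * K2 u) = 0.
Proof.
move=> omL CR dK cK1 cK2 out.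
pose P u := (a u * u.1 + b u * u.2) * K u.
pose Q u := (a u * u.2 - b u * u.1) * K u.
pose k u := 2 * a u * K u + (a u * u.1 + b u * u.2) * K1 u + (a u * u.2 - b u * u.1) * K2 u.
have k0 u : ~ om u -> k u = 0.
  by move=> /out/nbhs_singleton[k1 k2 k3]; rewrite /k k1 k2 k3 !mulr0 !addr0.
have H1 u : exists A B C D, [/\ is_diff2 P u A B, is_diff2 Q u C D & k u = A + D].
  have [ou|nou] := pselect (om u); last first.
    exists 0, 0, 0, 0; rewrite k0// addr0; split => //.
      apply: (diff2_ext (diff2_cst 0 u)) => //; near=> v.
      have [k1 _ _] : [/\ K v = 0, K1 v = 0 & K2 v = 0] by near: v; exact: out.
      by rewrite /P k1 mulr0.
    apply: (diff2_ext (diff2_cst 0 u)) => //; near=> v.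
    have [k1 _ _] : [/\ K v = 0, K1 v = 0 & K2 v = 0] by near: v; exact: out.
    by rewrite /Q k1 mulr0.
  have [A [B [da db]]] := CR u ou.
  have dP := diff2_mul (diff2_add (diff2_mul da (diff2_fst u)) (diff2_mul db (diff2_snd u))) (dK u).
  have dQ := diff2_mul (diff2_add (diff2_mul da (diff2_snd u)) (diff2_opp (diff2_mul db (diff2_fst u)))) (dK u).
  do 4 eexists; split; [exact: dP|exact: dQ|rewrite /k; ring].
have ck : continuous k.
  move=> u; have [ou|nou] := pselect (om u); last first.
    rewrite /continuous_at k0//.
    have c0' : (fun=> 0 : R) y @[y --> u] --> (0 : R) by exact: cvg_cst.
    apply: cvg_trans c0'; apply: near_eq_cvg.
    have := out u nou; apply: filterS => v [k1 k2 k3].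
    by rewrite /k k1 k2 k3 !mulr0 !addr0.
  have [A [B [/diff2_continuous ca /diff2_continuous cb]]] := CR u ou.
  have cK := diff2_continuous (dK u).
  have c1 : {for u, continuous (fst : R * R -> R)} by exact: cvg_fst.
  have c2 : {for u, continuous (snd : R * R -> R)} by exact: cvg_snd.
  apply: cvgD; [apply: cvgD|].
  - by apply: cvgM => //; apply: cvgM => //; exact: cvg_cst.
  - by apply: cvgM; [apply: cvgD; apply: cvgM|exact: cK1].
  - by apply: cvgM; [apply: cvgB; apply: cvgM|exact: cK2].
have /(_ L) := green H1 ck; rewrite [RHS]/= => <-; last first.
  move=> u h; have nou : ~ om u by move=> /omL[h1 h2]; case: h; lra.
  have [k1 _ _] := nbhs_singleton (out u nou).
  by rewrite k0// /P /Q k1 !mulr0.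
rewrite Rintegral_mkcond; congr (Rintegral _ _ _); apply/funext => u.
by rewrite patchE; case: ifPn => //; rewrite notin_setE => /k0 ->.
Unshelve. all: by end_near. Qed.

End GreenHolomorphic.

Section MeanValue.
Context (R : realType) (rho Rad : R).
Hypothesis rho_gt0 : 0 < rho.
Hypothesis rho_le : rho <= 8^-1.
Hypothesis Rad_gt0 : 0 < Rad.
Notation mu2 := (plane_measure R).

Definition norm2 (u : R * R) : R := u.1 ^+ 2 + u.2 ^+ 2.

Definition disc_minus_cantor : set (R * R) := [set u | norm2 u < Rad ^+ 2] `&` ~` cantor rho 1 1.
Local Notation om := disc_minus_cantor.

Lemma diff2_norm2 u : is_diff2 norm2 u (2 * u.1) (2 * u.2).
Proof.
have h := diff2_add (diff2_mul (diff2_fst u) (diff2_fst u)) (diff2_mul (diff2_snd u) (diff2_snd u)).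
by apply: (diff2_ext h); [near=> v; rewrite /norm2; ring|ring|ring].
Unshelve. all: by end_near. Qed.

Lemma continuous_norm2 : continuous norm2.
Proof. by move=> u; exact: diff2_continuous (diff2_norm2 u). Qed.

Lemma norm2_ge0 u : 0 <= norm2 u.
Proof. by rewrite addr_ge0 ?sqr_ge0. Qed.

Lemma open_disc_minus_cantor : open om.
Proof.
apply: openI; last by apply: closed_openC; exact: closed_cantor.
apply: (@open_comp _ _ norm2 [set y | y < Rad ^+ 2]); last exact: open_lt.
by move=> u _; exact: continuous_norm2.
Qed.

Lemma measurable_disc_minus_cantor : measurable (om : set (plane R)).
Proof. exact: open_measurable_plane open_disc_minus_cantor. Qed.

Lemma norm2_bound u (r : R) : 0 < r -> norm2 u < r ^+ 2 -> `|u.1| < r /\ `|u.2| < r.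
Proof.
move=> r0; rewrite /norm2 => h; have := sqr_ge0 u.1; have := sqr_ge0 u.2 => h1 h2.
by split; rewrite -(@ltr_pXn2r _ 2)// ?nnegrE ?ltW// real_normK ?num_real//; lra.
Qed.

Lemma disc_minus_cantor_bound u : om u -> `|u.1| < Rad /\ `|u.2| < Rad.
Proof. by move=> [h _]; exact: norm2_bound. Qed.

Lemma mu2_disc_minus_cantor_lty : (mu2 om < +oo)%E.
Proof.
apply: (@le_lt_trans _ _ (mu2 (rect (- Rad) (- Rad) (2 * Rad) (2 * Rad)))).
  apply: le_measure; rewrite ?inE; [exact: measurable_disc_minus_cantor|exact: measurable_rect|].
  move=> u /disc_minus_cantor_bound[/ltr_normlP[h1 h2] /ltr_normlP[h3 h4]].
  by split; rewrite /= in_itv/=; lra.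
by rewrite mu2_rect ?ltry// mulr_ge0// ltW.
Qed.

Lemma disc_minus_cantor0 : om (0, 0).
Proof.
split; first by rewrite /= /norm2 /= expr0n addr0 exprn_gt0.
by move=> /(cantor_re rho_gt0 rho_le ltr01) /=; lra.
Qed.

Lemma continuous_on_measurable (f : R * R -> R) :
  (forall u, om u -> {for u, continuous f}) -> measurable_fun (om : set (plane R)) f.
Proof. exact: continuous_measurable_plane open_disc_minus_cantor. Qed.

(** The sense in which the Cantor set is removable for a + i b. *)
Definition cutoff_negligible (a b : R * R -> R) :=
  (\int[mu2]_(u in om) ((`|a u| + `|b u|) * gradient_size rho n 1 1 u)%:E)%E @[n --> \oo] --> 0%E.

Definition admissible (a b : R * R -> R) :=
  [/\ cauchy_riemann om a b, mu2.-integrable om (EFin \o a),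
      mu2.-integrable om (EFin \o b) & cutoff_negligible a b].

Lemma cauchy_riemann_measurable a b : cauchy_riemann om a b ->
  measurable_fun (om : set (plane R)) a /\ measurable_fun (om : set (plane R)) b.
Proof.
move=> h; split; apply: continuous_on_measurable => u /h[A [B [h1 h2]]].
  exact: diff2_continuous h1.
exact: diff2_continuous h2.
Qed.

Section Test.
Variables (a b : R * R -> R) (s s' d : R).
Hypothesis adm : admissible a b.
Hypothesis s0 : 0 < s < Rad ^+ 2.
Hypothesis s'0 : 0 < s' < Rad ^+ 2.
Hypothesis d01 : 0 < d < 1.

Let K0 u := radial_kernel s s' d (norm2 u).
Let K0' u := dradial_kernel s s' d (norm2 u).
Let X n := cutoff rho n 1 1.
Let X1 n := dcutoff1 rho n 1 1.
Let X2 n := dcutoff2 rho n 1 1.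
Let K n u := K0 u * X n u.
Let K1 n u := K0 u * X1 n u + X n u * (K0' u * (2 * u.1)).
Let K2 n u := K0 u * X2 n u + X n u * (K0' u * (2 * u.2)).

Let diff2_K0 u : is_diff2 K0 u (K0' u * (2 * u.1)) (K0' u * (2 * u.2)).
Proof.
have /andP[p1 _] := s0; have /andP[p2 _] := s'0.
exact: diff2_comp (diff2_norm2 u) (is_derive_radial_kernel p1 p2 d01 _).
Qed.

Let cK0' : continuous K0'.
Proof.
have /andP[p1 _] := s0; have /andP[p2 _] := s'0.
move=> u; apply: (continuous_cvg _ (@continuous_dradial_kernel _ _ _ _ p1 p2 d01 _)).
exact: continuous_norm2.
Qed.

Let K_out n u : ~ om u -> \forall v \near u, [/\ K n v = 0, K1 n v = 0 & K2 n v = 0].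
Proof.
have /andP[p1 q1] := s0; have /andP[p2 q2] := s'0.
move=> /not_andP[/negP|/contrapT uc].
  rewrite -leNgt => uR.
  pose m := Num.max s s'.
  have mR : m < norm2 u by apply: lt_le_trans uR; rewrite /m gt_max q1 q2.
  have : \forall v \near u, m < norm2 v.
    exact: (@continuous_norm2 u _ (open_nbhs_nbhs (conj (@open_gt _ m) mR))).
  apply: filterS => v mv.
  have k0 : K0 v = 0 by apply: radial_kernel_hi => //; apply: ltW; apply: le_lt_trans mv; rewrite /m le_max lexx ?orbT.
  have k1 : K0' v = 0 by apply: dradial_kernel_hi => //; apply: ltW; apply: le_lt_trans mv; rewrite /m le_max lexx ?orbT.
  by rewrite /K /K1 /K2 k0 k1 !mul0r !mulr0 !addr0.
have r0 : 0 < rho ^+ n / 20 by rewrite divr_gt0// exprn_gt0.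
have H : \forall v \near u, \forall w \near v, X n w = 0.
  apply: nbhs_interior; apply/near_boxP; exists (rho ^+ n / 20) => // v v1 v2.
  apply: (cutoff_near rho_gt0 rho_le ltr01 (uc n.+1 I)); rewrite mulr1 ltW//.
apply: filterS H => v Hv.
have x0 : X n v = 0 := nbhs_singleton Hv.
have [x1 x2] := diff2_uniq0 (diff2_cutoff rho n 1 1 v) Hv.
by rewrite /K /K1 /K2 x0 /X1 /X2 x1 x2 !mul0r !mulr0 !addr0.
Qed.

Let cXi n : continuous (X n). Proof. exact: continuous_cutoff. Qed.
Let cK0 : continuous K0. Proof. by move=> u; exact: diff2_continuous (diff2_K0 u). Qed.

Let c1 : continuous (fst : R * R -> R). Proof. by move=> u; exact: cvg_fst. Qed.
Let c2 : continuous (snd : R * R -> R). Proof. by move=> u; exact: cvg_snd. Qed.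

Let green_n n : \int[mu2]_(u in om) (2 * a u * K n u + (a u * u.1 + b u * u.2) * K1 n u
     + (a u * u.2 - b u * u.1) * K2 n u) = 0.
Proof.
apply: (@green_cauchy_riemann _ _ Rad).
- exact: disc_minus_cantor_bound.
- by case: adm.
- by move=> u; apply: diff2_mul; [exact: diff2_K0|exact: diff2_cutoff].
- move=> u; apply: cvgD; apply: cvgM; [exact: cK0|exact: continuous_dcutoff1|exact: cXi|].
  by apply: cvgM; [exact: cK0'|apply: cvgM; [exact: cvg_cst|exact: c1]].
- move=> u; apply: cvgD; apply: cvgM; [exact: cK0|exact: continuous_dcutoff2|exact: cXi|].
  by apply: cvgM; [exact: cK0'|apply: cvgM; [exact: cvg_cst|exact: c2]].
- exact: K_out.
Qed.

Let W u := weight s d (norm2 u) - weight s' d (norm2 u).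
Let main n u := a u * W u * X n u.
Let rest n u := K0 u * ((a u * u.1 + b u * u.2) * X1 n u + (a u * u.2 - b u * u.1) * X2 n u).

Let green_split n u : 2 * a u * K n u + (a u * u.1 + b u * u.2) * K1 n u
     + (a u * u.2 - b u * u.1) * K2 n u = 2 * main n u + rest n u.
Proof.
have /andP[p1 _] := s0; have /andP[p2 _] := s'0.
rewrite /main /W -(radial_kernel_deriv p1 p2 d01 (norm2_ge0 u)).
rewrite /rest /K /K1 /K2 -/(K0 u) -/(K0' u) /norm2; ring.
Qed.

Let W_bound u : `|W u| <= s^-1 + s'^-1.
Proof.
have /andP[p1 _] := s0; have /andP[p2 _] := s'0.
have key (t : R) : 0 < t -> `|weight t d (norm2 u)| <= t^-1.
  move=> t0; rewrite /weight normrM normfV (gtr0_norm t0) ler_piMl ?invr_ge0 ?(ltW t0)//.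
  have := ramp_itv t0 d01 (norm2 u); rewrite ler_norml; lra.
by rewrite (le_trans (ler_normB _ _))// lerD// key.
Qed.

Let cW : continuous W.
Proof.
have /andP[p1 _] := s0; have /andP[p2 _] := s'0.
have key (t : R) : continuous (fun u => weight t d (norm2 u)).
  move=> u; apply: cvgM; last exact: cvg_cst.
  apply: cvgB; first exact: cvg_cst.
  by apply: (continuous_cvg _ (@continuous_ramp _ _ _ _)); exact: continuous_norm2.
by move=> u; apply: cvgB; exact: key.
Qed.

Let mcont (f : R * R -> R) : continuous f -> measurable_fun (om : set (plane R)) f.
Proof. by move=> cf; apply: continuous_on_measurable => u _; exact: cf. Qed.

Let ma : measurable_fun (om : set (plane R)) a.
Proof. by case: adm => /cauchy_riemann_measurable[]. Qed.
Let mb : measurable_fun (om : set (plane R)) b.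
Proof. by case: adm => /cauchy_riemann_measurable[]. Qed.

Let main_meas n : measurable_fun (om : set (plane R)) (main n).
Proof. by apply: measurable_funM; [apply: measurable_funM => //; exact: mcont|exact: mcont]. Qed.

Let domi u := (s^-1 + s'^-1) * `|a u|.

Let idomi : mu2.-integrable om (EFin \o domi).
Proof.
case: adm => _ ia _ _; have := integrable_norm ia.
move=> /(integrableZl measurable_disc_minus_cantor (s^-1 + s'^-1)).
by apply: eq_integrable; [exact: measurable_disc_minus_cantor|move=> u _; rewrite /= -EFinM].
Qed.

Let main_le n u : `|main n u| <= domi u.
Proof.
rewrite /main /domi !normrM mulrC.
have /andP[x0 x1] := cutoff_itv rho n 1 1 u.
rewrite (ger0_norm x0) [`|a u| * _]mulrC.
apply: (@le_trans _ _ (`|W u| * `|a u|)); first by rewrite ler_piMl// mulr_ge0.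
by rewrite ler_wpM2r.
Qed.

Let imain n : mu2.-integrable om (EFin \o main n).
Proof.
apply: (le_integrable measurable_disc_minus_cantor _ _ idomi); first exact/measurable_EFinP.
move=> u _; rewrite /= lee_fin [leRHS]ger0_norm; first exact: main_le.
exact: le_trans (main_le n u).
Qed.

Let iaW : mu2.-integrable om (EFin \o (fun u => a u * W u)).
Proof.
apply: (le_integrable measurable_disc_minus_cantor _ _ idomi).
  by apply/measurable_EFinP; apply: measurable_funM => //; exact: mcont.
move=> u _; rewrite /= lee_fin normrM mulrC [leRHS]ger0_norm ?mulr_ge0//.
  by rewrite ler_wpM2r.
have /andP[p1 _] := s0; have /andP[p2 _] := s'0.
by rewrite addr_ge0// invr_ge0 ltW.
Qed.

Let main_cvg : \int[mu2]_(u in om) main n u @[n --> \oo] --> \int[mu2]_(u in om) (a u * W u).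
Proof.
apply: (Rintegral_dominated_cvg measurable_disc_minus_cantor _ _ idomi iaW); [exact: main_meas| |by move=> n u _; exact: main_le].
move=> u [_ nc]; rewrite -[X in _ --> X]mulr1; apply: cvgM; first exact: cvg_cst.
have [m _ nm] : exists2 m, setT m & ~ cantor_level rho m 1 1 u.
  by apply: contrapT => h; apply: nc => m _; apply: contrapT => h'; apply: h; exists m.
have c1' : (fun=> 1 : R) n @[n --> \oo] --> (1 : R) by exact: cvg_cst.
apply: cvg_trans c1'; apply: near_eq_cvg; near=> n; rewrite /X cutoff_out//.
by apply: contra_not nm; apply: (cantor_level_mono rho_gt0 rho_le ltr01); near: n; exact: nbhs_infty_ge.
Unshelve. all: by end_near. Qed.

Let mG n : measurable_fun (om : set (plane R)) (fun u => (`|a u| + `|b u|) * gradient_size rho n 1 1 u).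
Proof.
apply: measurable_funM; last by apply: mcont; exact: continuous_gradient_size.
by apply: measurable_funD; apply: measurableT_comp.
Qed.

Let mrest n : measurable_fun (om : set (plane R)) (rest n).
Proof.
apply: measurable_funM; first exact: mcont.
apply: measurable_funD; apply: measurable_funM.
- by apply: measurable_funD; apply: measurable_funM => //; exact: mcont.
- by apply: mcont; exact: continuous_dcutoff1.
- by apply: measurable_funB; apply: measurable_funM => //; exact: mcont.
- by apply: mcont; exact: continuous_dcutoff2.
Qed.

Let rest_le : exists2 C, 0 <= C & forall n u, om u ->
  `|rest n u| <= C * ((`|a u| + `|b u|) * gradient_size rho n 1 1 u).
Proof.
have [M HM] := continuous_bounded_on Rad cK0.
have M0 : 0 <= M by apply: le_trans (HM (0, 0) _ _); rewrite ?normr0 ?(ltW Rad_gt0).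
exists (M * Rad) => [|n u]; first by rewrite mulr_ge0// ltW.
move=> /disc_minus_cantor_bound[/ltW h1 /ltW h2].
rewrite /rest normrM -mulrA; apply: ler_pM => //; first exact: HM.
have key (x y z t : R) : `|x| <= `|a u| -> `|y| <= `|b u| -> `|z| <= Rad -> `|t| <= Rad ->
   `|x * z + y * t| <= Rad * (`|a u| + `|b u|).
  move=> q1 q2 q3 q4; rewrite (le_trans (ler_normD _ _))// !normrM mulrDr.
  by apply: lerD; rewrite mulrC; apply: ler_pM.
rewrite /gradient_size mulrA mulrDr (le_trans (ler_normD _ _))// !normrM.
apply: lerD; apply: ler_wpM2r => //; first exact: key.
by rewrite -mulNr; apply: key; rewrite ?normrN.
Qed.

Let irest n : mu2.-integrable om (EFin \o rest n).
Proof.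
have [C C0 HC] := rest_le.
have [M HM] := continuous_bounded_on Rad (@continuous_gradient_size _ rho n 1 1).
have [_ ia ib _] := adm.
have ig := integrableD measurable_disc_minus_cantor (integrable_norm ia) (integrable_norm ib).
apply: (le_integrable measurable_disc_minus_cantor _ _ (integrableZl measurable_disc_minus_cantor (C * M) ig)).
  exact/measurable_EFinP.
move=> u ou; rewrite /= lee_fin; apply: le_trans (ler_norm _).
apply: (le_trans (HC n u ou)); rewrite -mulrA ler_wpM2l// mulrC ler_wpM2r ?addr_ge0//.
have [/ltW h1 /ltW h2] := disc_minus_cantor_bound ou.
exact: le_trans (ler_norm _) (HM u h1 h2).
Qed.

Let rest_cvg : \int[mu2]_(u in om) rest n u @[n --> \oo] --> (0 : R).
Proof.
have [C C0 rle] := rest_le.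
have [_ _ _ neg] := adm.
have abscvg : (\int[mu2]_(u in om) `|(rest n u)%:E|)%E @[n --> \oo] --> 0%E.
  have neg' : (C%:E * \int[mu2]_(u in om) ((`|a u| + `|b u|) * gradient_size rho n 1 1 u)%:E)%E @[n --> \oo] --> 0%E.
    by rewrite -(mule0 C%:E); apply: cvgeZl.
  apply: (squeeze_cvge _ (cvg_cst 0%E) neg'); apply: nearW => n.
  rewrite integral_ge0//=.
  rewrite -ge0_integralZl//; first last.
  - by move=> u _; rewrite lee_fin mulr_ge0 ?addr_ge0 ?gradient_size_ge0.
  - exact/measurable_EFinP.
  - exact: measurable_disc_minus_cantor.
  apply: ge0_le_integral => //; first exact: measurable_disc_minus_cantor.
  - by apply/measurable_EFinP; apply: measurableT_comp.
  - by apply: emeasurable_funM => //; exact/measurable_EFinP.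
  - by move=> u ou; rewrite -EFinM lee_fin; exact: rle.
have : (\int[mu2]_(u in om) (rest n u)%:E)%E @[n --> \oo] --> 0%E.
  apply: (cvg_abse0P _).1.
  apply: (squeeze_cvge _ (cvg_cst 0%E) abscvg); apply: nearW => n.
  rewrite abse_ge0/=; apply: le_abse_integral; first exact: measurable_disc_minus_cantor.
  exact/measurable_EFinP.
by move=> /fine_cvg.
Qed.

(** The cutoffs tend to 1 off the Cantor set, and the terms that contain their
    gradients tend to 0 by cutoff_negligible. *)
Lemma test_identity : \int[mu2]_(u in om) (a u * W u) = 0.
Proof.
have E n : \int[mu2]_(u in om) rest n u = - 2 * \int[mu2]_(u in om) main n u.
  have := green_n n; under eq_Rintegral do rewrite green_split.
  have i2 : mu2.-integrable om (EFin \o (fun u => 2 * main n u)).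
    have := integrableZl measurable_disc_minus_cantor 2 (imain n).
    by apply: eq_integrable; [exact: measurable_disc_minus_cantor|move=> u _; rewrite /= -EFinM].
  rewrite RintegralD//; [|exact: measurable_disc_minus_cantor].
  by rewrite RintegralZl//; [lra|exact: measurable_disc_minus_cantor].
have h1 : \int[mu2]_(u in om) rest n u @[n --> \oo] --> - 2 * \int[mu2]_(u in om) (a u * W u).
  under eq_fun do rewrite E.
  by apply: cvgM; [exact: cvg_cst|exact: main_cvg].
have h2 : -2 * \int[mu2]_(u in om) (a u * W u) = 0 by exact: (cvg_unique (@Rhausdorff R) h1 rest_cvg).
by move: h2; lra.
Qed.

End Test.

End MeanValue.

(** * The mean value property on a disc minus the Cantor set *)

Section MeanValue.
Context (R : realType) (rho Rad : R).
Hypothesis rho_gt0 : 0 < rho.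
Hypothesis rho_le : rho <= 8^-1.
Hypothesis Rad_gt0 : 0 < Rad.
Notation mu2 := (plane_measure R).
Local Notation om := (disc_minus_cantor rho Rad).
Let mom : measurable (om : set (plane R)) := measurable_disc_minus_cantor rho Rad.
Let omfin : (mu2 om < +oo)%E := mu2_disc_minus_cantor_lty rho Rad_gt0.

Lemma cvg_geometric_EFin (C q : R) : 0 <= q < 1 -> (C * q ^+ n)%:E @[n --> \oo] --> 0%E.
Proof.
move=> /andP[q0 q1]; apply: cvg_EFin; first exact: nearW.
rewrite -[X in _ --> X](mulr0 C); apply: cvgM; first exact: cvg_cst.
by apply: cvg_expr; rewrite ger0_norm.
Qed.

Lemma mu2_cantor_level0 (c s : R) : 0 < s -> (mu2 (cantor_level rho 0 c s) <= (4 * s ^+ 2)%:E)%E.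
Proof.
move=> s0.
have E : cantor_level rho 0 c s = `[c - s / 2, c + s / 2 + s]%classic `*` `[- s, s]%classic.
  apply/seteqP; split => u; rewrite /= !in_itv/= !ler_norml; [move=> [h1 h2]|move=> [h1 h2]]; split; lra.
rewrite E product_measure1E; [|exact: measurable_itv..].
have len (x y : R) : x < y -> @lebesgue_measure R `[x, y]%classic = (y - x)%:E.
  by move=> xy; rewrite lebesgue_measure_itv/= lte_fin xy -EFinB.
rewrite [X in (X * _ <= _)%E](len _ _ _); last lra.
rewrite [X in (_ * X <= _)%E](len _ _ _); last lra.
by rewrite -EFinM lee_fin le_eqVlt; apply/orP; left; apply/eqP; field.
Qed.

Lemma integrable_cst_on (c : R) : mu2.-integrable om (EFin \o fun=> c).
Proof. by apply: measurable_bounded_integrable => //; exact: bounded_cst. Qed.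

Lemma measurable_cantor_level n c s : measurable (cantor_level rho n c s : set (plane R)).
Proof. by apply: closed_measurable_plane; exact: closed_cantor_level. Qed.

Lemma cutoff_negligible_cst (c : R) : cutoff_negligible rho Rad (fun=> c) (fun=> 0).
Proof.
have gsq (x t : R) : 0 < t ->
  (\int[mu2]_(u in om `&` cantor_level rho 0 x t) `|c|%:E <= ((4 * `|c|) * t ^+ 2 + 0)%:E)%E.
  move=> t0; rewrite integral_cst/=; last first.
    by apply: measurableI => //; exact: (measurable_cantor_level 0).
  rewrite addr0 (_ : 4 * `|c| * t ^+ 2 = `|c| * (4 * t ^+ 2)); last ring.
  rewrite EFinM; apply: lee_wpmul2l; first by rewrite lee_fin.
  apply: le_trans (mu2_cantor_level0 x t0); apply: le_measure; rewrite ?inE; last exact: subIsetr.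
    by apply: measurableI => //; exact: (measurable_cantor_level 0).
  exact: (measurable_cantor_level 0).
have H n := @integral_gradient _ rho rho_gt0 om (fun=> `|c|) (4 * `|c|) 0 mom
  (measurable_cst _) (fun _ _ => normr_ge0 c) gsq n 1 1 ltr01.
have lim0 : (128 * `|c| * (2 * rho) ^+ n)%:E @[n --> \oo] --> 0%E.
  by apply: cvg_geometric_EFin; have := rho_gt0; have := rho_le; lra.
rewrite /cutoff_negligible.
apply: (squeeze_cvge _ (cvg_cst 0%E) lim0); apply: nearW => n.
rewrite integral_ge0/=; last first.
  by move=> u _; rewrite lee_fin mulr_ge0 ?addr_ge0 ?gradient_size_ge0.
under eq_integral do rewrite normr0 addr0.
apply: (le_trans (H n)).
by rewrite lee_fin mul0r addr0 mulr1 exprMn; lra.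
Qed.

Lemma admissible_cst (c : R) : admissible rho Rad (fun=> c) (fun=> 0).
Proof.
split; [|exact: integrable_cst_on|exact: integrable_cst_on|exact: cutoff_negligible_cst].
by move=> u _; exists 0, 0; rewrite oppr0; split; exact: diff2_cst.
Qed.

Lemma admissible_measurable a b : admissible rho Rad a b ->
  measurable_fun (om : set (plane R)) a /\ measurable_fun (om : set (plane R)) b.
Proof. by case=> /cauchy_riemann_measurable. Qed.

Lemma admissible_shift a b c : admissible rho Rad a b ->
  admissible rho Rad (fun u => a u - c) b.
Proof.
move=> adm; have [ma mb] := admissible_measurable adm; case: adm => CR ia ib neg; split => //.
- move=> u ou; have [A [B [da db]]] := CR u ou; exists A, B; split => //.
  have h := diff2_add da (diff2_cst (- c) u); apply: (diff2_ext h); rewrite ?addr0//.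
  by near=> v.
- have := integrableB mom ia (integrable_cst_on c).
  by apply: eq_integrable => // u _; rewrite /= EFinB.
- rewrite /cutoff_negligible.
  have negc := cutoff_negligible_cst c.
  have lim0 : ((\int[mu2]_(u in om) ((`|a u| + `|b u|) * gradient_size rho n 1 1 u)%:E) +
      \int[mu2]_(u in om) ((`|c| + `|0 : R|) * gradient_size rho n 1 1 u)%:E)%E @[n --> \oo] --> 0%E.
    by rewrite -[X in _ --> X]adde0; apply: cvgeD.
  apply: (squeeze_cvge _ (cvg_cst 0%E) lim0); apply: nearW => n.
  rewrite integral_ge0/=; last first.
    by move=> u _; rewrite lee_fin mulr_ge0 ?addr_ge0 ?gradient_size_ge0.
  have mG : measurable_fun (om : set (plane R)) (gradient_size rho n 1 1).
    apply: continuous_measurable_plane; first exact: open_disc_minus_cantor.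
    by move=> u _; exact: continuous_gradient_size.
  have mna : measurable_fun (om : set (plane R)) (fun u => `|a u|) by apply: measurableT_comp.
  have mnb : measurable_fun (om : set (plane R)) (fun u => `|b u|) by apply: measurableT_comp.
  rewrite -ge0_integralD//; first last.
  - apply/measurable_EFinP; apply: measurable_funM => //.
  - by move=> u _; rewrite lee_fin mulr_ge0 ?addr_ge0 ?gradient_size_ge0.
  - apply/measurable_EFinP; apply: measurable_funM => //; exact: measurable_funD.
  - by move=> u _; rewrite lee_fin mulr_ge0 ?addr_ge0 ?gradient_size_ge0.
  apply: ge0_le_integral => //.
  - by move=> u _; rewrite lee_fin mulr_ge0 ?addr_ge0 ?gradient_size_ge0.
  - apply/measurable_EFinP; apply: measurable_funM => //; apply: measurable_funD => //.
    by apply: measurableT_comp => //; apply: measurable_funB.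
  - apply: emeasurable_funD; apply/measurable_EFinP; apply: measurable_funM => //; exact: measurable_funD.
  - move=> u _; rewrite -EFinD lee_fin -mulrDl ler_wpM2r ?gradient_size_ge0//.
    by rewrite normr0 addr0 addrAC lerD// ler_normB.
Unshelve. all: by end_near. Qed.

Let mW s d : measurable_fun (om : set (plane R)) (fun u => weight s d (norm2 u)).
Proof.
apply: continuous_measurable_plane; first exact: open_disc_minus_cantor.
move=> u _; apply: cvgM; last exact: cvg_cst.
apply: cvgB; first exact: cvg_cst.
by apply: (continuous_cvg _ (@continuous_ramp _ _ _ _)); exact: continuous_norm2.
Qed.

Let W_itv (s d t : R) : 0 < s -> 0 < d < 1 -> 0 <= weight s d t <= s^-1.
Proof.
move=> s0 d01; have /andP[r0 r1] := ramp_itv s0 d01 t.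
have s'0 : 0 < s^-1 by rewrite invr_gt0.
by rewrite /weight mulr_ge0 ?ler_piMl ?(ltW s'0)//; lra.
Qed.

Lemma integrable_weight (a : R * R -> R) (s d : R) : 0 < s -> 0 < d < 1 -> mu2.-integrable om (EFin \o a) ->
  mu2.-integrable om (EFin \o fun u => a u * weight s d (norm2 u)).
Proof.
move=> s0 d01 ia; have /integrableP[/measurable_EFinP ma _] := ia.
apply: (le_integrable mom _ _ (integrableZl mom s^-1 ia)).
  by apply/measurable_EFinP; apply: measurable_funM.
move=> u _; rewrite /= lee_fin (normrM (a u)) (normrM s^-1) mulrC ler_wpM2r//.
have /andP[h1 h2] := W_itv (norm2 u) s0 d01.
by rewrite (ger0_norm h1) (le_trans h2)// ler_norm.
Qed.

Lemma weight_identity a b (s s' d : R) : admissible rho Rad a b ->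
  0 < s < Rad ^+ 2 -> 0 < s' < Rad ^+ 2 -> 0 < d < 1 ->
  \int[mu2]_(u in om) (a u * weight s d (norm2 u)) =
  \int[mu2]_(u in om) (a u * weight s' d (norm2 u)).
Proof.
move=> adm s0 s'0 d01; have := test_identity rho_gt0 rho_le Rad_gt0 adm s0 s'0 d01.
have /andP[p1 _] := s0; have /andP[p2 _] := s'0.
case: adm => _ ia _ _.
under eq_Rintegral do rewrite mulrBr.
rewrite RintegralB//; [|exact: integrable_weight..].
by move/eqP; rewrite subr_eq0 => /eqP.
Qed.

(** By weight_identity the weighted integral of a - a(0) is the same for all radii.
    Small radii bound it by e times the weighted volume for every e, and that
    volume does not depend on the radius either. *)
Lemma weighted_mean a b (s d : R) : admissible rho Rad a b -> 0 < s < Rad ^+ 2 -> 0 < d < 1 ->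
  \int[mu2]_(u in om) ((a u - a (0, 0)) * weight s d (norm2 u)) = 0.
Proof.
move=> adm s0 d01; have adm' := admissible_shift (a (0, 0)) adm.
set a' := fun u => a u - a (0, 0).
have /andP[p1 _] := s0.
have i1 : mu2.-integrable om (EFin \o fun u => 1 * weight s d (norm2 u)).
  by apply: integrable_weight => //; exact: integrable_cst_on.
set C := \int[mu2]_(u in om) (1 * weight s d (norm2 u)).
have C0 : 0 <= C.
  apply: Rintegral_ge0 => u _; rewrite mul1r.
  by case/andP: (W_itv (norm2 u) p1 d01).
have ca : {for (0, 0), continuous a}.
  case: adm => CR _ _ _; have [A [B [h _]]] := CR _ (disc_minus_cantor0 rho_gt0 rho_le Rad_gt0).
  exact: diff2_continuous h.
have key e : 0 < e -> `|\int[mu2]_(u in om) (a' u * weight s d (norm2 u))| <= e * C.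
  move=> e0.
  have /near_boxP[dl dl0 Hdl] : \forall v \near (0 : R, 0 : R), `|a v - a (0, 0)| <= e.
    by move: ca => /cvgrPdist_le/(_ _ e0); apply: filterS => v; rewrite distrC.
  pose s' := Num.min (dl ^+ 2) (Rad ^+ 2) / 2.
  have m0 : 0 < Num.min (dl ^+ 2) (Rad ^+ 2) by rewrite lt_min !exprn_gt0.
  have m1 : Num.min (dl ^+ 2) (Rad ^+ 2) <= dl ^+ 2 by rewrite ge_min lexx.
  have m2 : Num.min (dl ^+ 2) (Rad ^+ 2) <= Rad ^+ 2 by rewrite ge_min lexx orbT.
  have s'0 : 0 < s' < Rad ^+ 2 by rewrite /s'; lra.
  have /andP[p2 _] := s'0.
  rewrite (weight_identity adm' s0 s'0 d01).
  rewrite /C (weight_identity (admissible_cst 1) s0 s'0 d01).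
  case: adm' => _ ia' _ _.
  have i2 := integrable_weight p2 d01 ia'.
  have i3 : mu2.-integrable om (EFin \o fun u => 1 * weight s' d (norm2 u)).
    by apply: integrable_weight => //; exact: integrable_cst_on.
  apply: (le_trans (le_normr_Rintegral mom i2)).
  rewrite -RintegralZl//; apply: le_Rintegral => //.
  - exact: integrable_norm.
  - have := integrableZl mom e i3.
    by apply: eq_integrable => // u _; rewrite /= -EFinM.
  - move=> u ou; rewrite mul1r normrM.
    have /andP[h1 h2] := W_itv (norm2 u) p2 d01.
    rewrite [X in _ * X <= _]ger0_norm//.
    have [us|us] := leP s' (norm2 u).
      by rewrite /weight ramp_hi// subrr mul0r !mulr0.
    apply: ler_wpM2r => //.
    have [h3 h4] : `|u.1| < dl /\ `|u.2| < dl.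
      by apply: norm2_bound => //; apply: lt_le_trans us _; rewrite /s'; lra.
    by apply: Hdl; rewrite /= subr0.
apply/eqP; rewrite -normr_le0; apply/ler_addgt0Pr => e e0; rewrite add0r.
have C10 : 0 < C + 1 by rewrite ltr_wpDl.
apply: (le_trans (key (e / (C + 1)) _)); first by rewrite divr_gt0.
by rewrite mulrAC ler_pdivrMr// ler_pM2l// lerDl.
Qed.

Theorem mean_value a b : admissible rho Rad a b ->
  \int[mu2]_(u in om) a u = a (0, 0) * fine (mu2 om).
Proof.
move=> adm; have [CR ia ib neg] := adm; have [ma _] := admissible_measurable adm.
have adm' := admissible_shift (a (0, 0)) adm; have [_ ia' _ _] := adm'.
have [ma' _] := admissible_measurable adm'.
(* weights which tend to the indicator function of the disc *)
pose dn n : R := n.+2%:R^-1; pose sn n : R := Rad ^+ 2 * (1 - dn n).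
have dn01 n : 0 < dn n < 1 by rewrite /dn invr_gt0 ltr0n/= invf_lt1 ?ltr0n// ltr1n.
have R20 : 0 < Rad ^+ 2 by rewrite exprn_gt0.
have snR n : 0 < sn n < Rad ^+ 2.
  have /andP[h1 h2] := dn01 n.
  by rewrite /sn mulr_gt0 ?subr_gt0// gtr_pMr//; lra.
have sn0 n : 0 < sn n by case/andP: (snR n).
pose f_ n u := (a u - a (0, 0)) * (sn n * weight (sn n) (dn n) (norm2 u)).
have f0 n : \int[mu2]_(u in om) f_ n u = 0.
  rewrite /f_; under eq_Rintegral do rewrite mulrCA.
  rewrite RintegralZl//; last exact: integrable_weight.
  by rewrite (weighted_mean adm (snR n) (dn01 n)) mulr0.
have fcvg : \int[mu2]_(u in om) f_ n u @[n --> \oo] --> \int[mu2]_(u in om) (a u - a (0, 0)).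
  apply: (Rintegral_dominated_cvg mom _ _ (integrable_norm ia') ia').
  - move=> n; apply: measurable_funM => //; apply: measurable_funM => //.
  - move=> u [uR _]; rewrite /= in uR.
    rewrite -[X in _ --> X]mulr1; apply: cvgM; first exact: cvg_cst.
    have c1' : (fun=> 1 : R) n @[n --> \oo] --> (1 : R) by exact: cvg_cst.
    apply: cvg_trans c1'; apply: near_eq_cvg.
    have D0 : 0 < Rad ^+ 2 - norm2 u by rewrite subr_gt0.
    have := archi_boundP (ltW (divr_gt0 (mulr_gt0 (ltr0Sn R 1) R20) D0)).
    set N := Num.bound _ => HN.
    exists N => // n /= Nn.
    rewrite /weight ramp_lo ?subr0 ?mul1r ?divff ?gt_eqF//.
    have /andP[h1 h2] := dn01 n.
    have h3 : 2 * Rad ^+ 2 * dn n <= Rad ^+ 2 - norm2 u.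
      rewrite /dn ler_pdivrMr ?ltr0n// [leRHS]mulrC -ler_pdivrMr//.
      by apply: (le_trans (ltW HN)); rewrite ler_nat; exact: leq_trans Nn (leqW (leqnSn _)).
    rewrite /sn; have : 0 <= Rad ^+ 2 * (dn n * dn n) by rewrite !mulr_ge0 ?ltW//.
    lra.
  - move=> n u _; rewrite /f_ normrM ler_piMr//.
    have /andP[h1 h2] := W_itv (norm2 u) (sn0 n) (dn01 n).
    rewrite (ger0_norm (mulr_ge0 (ltW (sn0 n)) h1)).
    by rewrite -(mulfV (lt0r_neq0 (sn0 n))) ler_wpM2l ?(ltW (sn0 n)).
have : \int[mu2]_(u in om) (a u - a (0, 0)) = 0.
  have z : (fun=> 0 : R) n @[n --> \oo] --> (0 : R) by exact: cvg_cst.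
  move: fcvg; under eq_fun do rewrite f0; move=> fcvg.
  exact: (cvg_unique (@Rhausdorff R) fcvg z).
rewrite RintegralB//; last exact: integrable_cst_on.
by rewrite Rintegral_cst// => /eqP; rewrite subr_eq0 => /eqP.
Qed.

End MeanValue.

(** * The complex plane and the domain *)

Local Open Scope complex_scope.

Section ComplexPlane.
Context (R : realType).
Implicit Types (w z : Cplx R) (u v : R * R).

Definition toC u : Cplx R := u.1 +i* u.2.
Definition ofC w : R * R := (complex.Re w, complex.Im w).

Lemma toCK u : ofC (toC u) = u. Proof. by case: u. Qed.
Lemma ofCK w : toC (ofC w) = w. Proof. by case: w. Qed.

Lemma cabsE w : cabs w = Num.sqrt (complex.Re w ^+ 2 + complex.Im w ^+ 2).
Proof. by case: w. Qed.

Lemma normC_cabs w : `|w| = (cabs w)%:C.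
Proof. by case: w. Qed.

Lemma cabs_ge0 w : 0 <= cabs w.
Proof. by rewrite cabsE sqrtr_ge0. Qed.

Lemma cabsM w z : cabs (w * z) = cabs w * cabs z.
Proof. exact: ComplexField.Normc.normcM. Qed.

Lemma cabsV w : cabs w^-1 = (cabs w)^-1.
Proof. exact: ComplexField.Normc.normcV. Qed.

Lemma cabs1 : cabs (1 : Cplx R) = 1.
Proof. exact: ComplexField.Normc.normc1. Qed.

Lemma cabsN w : cabs (- w) = cabs w.
Proof. by apply: complexI; rewrite -!normC_cabs normrN. Qed.

Lemma cabsD w z : cabs (w + z) <= cabs w + cabs z.
Proof. exact: le_normcD. Qed.

Lemma cabs_eq0 w : cabs w = 0 -> w = 0.
Proof. exact: ComplexField.Normc.eq0_normc. Qed.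

Lemma cabs0 : cabs (0 : Cplx R) = 0.
Proof. exact: ComplexField.Normc.normc0. Qed.

Lemma cabs_gt0 w : w != 0 -> 0 < cabs w.
Proof.
by move=> w0; rewrite lt_neqAle cabs_ge0 andbT eq_sym; apply: contra w0 => /eqP/cabs_eq0 ->.
Qed.

Lemma cabs_sqr w : cabs w ^+ 2 = complex.Re w ^+ 2 + complex.Im w ^+ 2.
Proof. by rewrite cabsE sqr_sqrtr// addr_ge0 ?sqr_ge0. Qed.

Lemma Re_le_cabs w : `|complex.Re w| <= cabs w.
Proof.
by rewrite cabsE -sqrtr_sqr ler_sqrt ?addr_ge0 ?sqr_ge0// lerDl sqr_ge0.
Qed.

Lemma Im_le_cabs w : `|complex.Im w| <= cabs w.
Proof.
by rewrite cabsE -sqrtr_sqr ler_sqrt ?addr_ge0 ?sqr_ge0// lerDr sqr_ge0.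
Qed.

Lemma cabs_le_ReIm w : cabs w <= `|complex.Re w| + `|complex.Im w|.
Proof.
rewrite cabsE -[leRHS]ger0_norm ?addr_ge0// -sqrtr_sqr ler_sqrt ?sqr_ge0//.
rewrite -(real_normK (num_real (complex.Re w))) -(real_normK (num_real (complex.Im w))).
by rewrite sqrrD lerD2r lerDl mulrn_wge0// mulr_ge0.
Qed.

Lemma Re_add w z : complex.Re (w + z) = complex.Re w + complex.Re z.
Proof. by case: w; case: z. Qed.
Lemma Im_add w z : complex.Im (w + z) = complex.Im w + complex.Im z.
Proof. by case: w; case: z. Qed.
Lemma Re_opp w : complex.Re (- w) = - complex.Re w. Proof. by case: w. Qed.
Lemma Im_opp w : complex.Im (- w) = - complex.Im w. Proof. by case: w. Qed.
Lemma Re_mul w z : complex.Re (w * z) = complex.Re w * complex.Re z - complex.Im w * complex.Im z.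
Proof. by case: w; case: z. Qed.
Lemma Im_mul w z : complex.Im (w * z) = complex.Re w * complex.Im z + complex.Im w * complex.Re z.
Proof. by case: w; case: z. Qed.

Lemma near_cabsP w (P : Cplx R -> Prop) :
  (\forall z \near w, P z) <-> exists2 d : R, 0 < d & forall z, cabs (z - w) < d -> P z.
Proof.
split.
  move=> /nbhs_ballP[e /= e0 H]; move: e0; rewrite ltcE => /andP[/eqP e1 e2].
  exists (complex.Re e) => // z zd; apply: H; rewrite /ball/= distrC normC_cabs.
  by rewrite ltcE /= e1 eqxx.
case=> d d0 H; apply/nbhs_ballP; exists d%:C; first by rewrite /= ltcR.
by move=> z; rewrite /ball/= distrC normC_cabs ltcR; exact: H.
Qed.

Lemma continuous_toC : continuous toC.
Proof.
move=> u P /near_cabsP[d d0 H]; apply/near_boxP; exists (d / 2); first lra.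
move=> v v1 v2; apply: H; apply: (le_lt_trans (cabs_le_ReIm _)).
by rewrite Re_add Im_add Re_opp Im_opp /=; lra.
Qed.

Lemma continuous_ofC : continuous ofC.
Proof.
move=> w P /near_boxP[d d0 H]; apply/near_cabsP; exists d => // z zd.
apply: H.
  by apply: le_lt_trans zd; apply: le_trans (Re_le_cabs _); rewrite Re_add Re_opp.
by apply: le_lt_trans zd; apply: le_trans (Im_le_cabs _); rewrite Im_add Im_opp.
Qed.

(** Replaces the limit over R[i], whose radii and errors are themselves complex
    numbers, by inequalities in R. *)
Lemma derivable_cabsP (f : Cplx R -> Cplx R) w : derivable f w 1 <->
  exists l, forall e, 0 < e -> exists2 d : R, 0 < d & forall z, cabs (z - w) < d ->
    cabs (f z - f w - l * (z - w)) <= e * cabs (z - w).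
Proof.
split.
  move=> /cvg_ex[l] H; exists l => e e0.
  have e0' : 0 < e%:C by rewrite ltcR.
  move: H => /cvgrPdist_le/(_ _ e0') H.
  have [d /= d0 Hd] := (nbhs_ballP _ _).1 H.
  move: d0; rewrite ltcE => /andP[/eqP d1 d2].
  exists (complex.Re d) => // z zd.
  have [->|zw] := eqVneq z w; first by rewrite !subrr mulr0 subrr cabs0 mulr0.
  have k0 : z - w != 0 by rewrite subr_eq0.
  have := Hd (z - w); rewrite /ball /= sub0r normrN normC_cabs ltcE /= d1 eqxx => /(_ zd k0).
  rewrite /GRing.scale /= mulr1 subrK => H1.
  have H2 : cabs (l - (z - w)^-1 * (f z - f w)) <= e.
    by rewrite -lecR -normC_cabs.
  rewrite -ler_pdivrMr ?cabs_gt0//; apply: le_trans H2.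
  rewrite -cabsV -cabsM -cabsN; rewrite (_ : - _ = l - (z - w)^-1 * (f z - f w))//.
  by field.
case=> l H; apply/cvg_ex; exists l; apply/cvgrPdist_le => e e0.
move: e0; rewrite ltcE => /andP[/eqP e1 e2].
have [d d0 Hd] := H (complex.Re e) e2.
apply/nbhs_ballP; exists d%:C; first by rewrite /= ltcR.
move=> h; rewrite /ball /= sub0r normrN normC_cabs ltcR => hd h0.
rewrite /GRing.scale /= mulr1.
have := Hd (h + w); rewrite addrK => /(_ hd) H1.
rewrite normC_cabs lecE /= e1 eqxx/=.
rewrite -(ler_pM2r (cabs_gt0 h0)); apply: le_trans H1.
rewrite -cabsM -cabsN (_ : - _ = f (h + w) - f w - l * h)//.
by field.
Qed.

Lemma derivable_diff2 (f : Cplx R -> Cplx R) u : derivable f (toC u) 1 ->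
  exists A B, is_diff2 (fun v => complex.Re (f (toC v))) u A B /\
              is_diff2 (fun v => complex.Im (f (toC v))) u (- B) A.
Proof.
move=> /derivable_cabsP[l H]; exists (complex.Re l), (- complex.Im l).
have key e : 0 < e -> \forall v \near u,
    cabs (f (toC v) - f (toC u) - l * (toC v - toC u)) <= e * dist1 u v.
  move=> e0; have [d d0 Hd] := H e e0.
  have nv : \forall v \near u, cabs (toC v - toC u) < d.
    apply: (@continuous_toC u [set z | cabs (z - toC u) < d]).
    by apply/near_cabsP; exists d.
  apply: filterS nv => v vd; apply: (le_trans (Hd _ vd)); rewrite ler_pM2l//.
  by apply: (le_trans (cabs_le_ReIm _)); rewrite Re_add Im_add Re_opp Im_opp.
split => e e0; move: (key e e0); apply: filterS => v; apply: le_trans.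
  apply: le_trans (Re_le_cabs _); rewrite !(Re_add, Re_opp, Re_mul, Im_add, Im_opp) /=.
  rewrite le_eqVlt; apply/orP; left; apply/eqP; congr `| _ |; ring.
apply: le_trans (Im_le_cabs _); rewrite !(Re_add, Re_opp, Im_mul, Im_add, Im_opp) /=.
rewrite le_eqVlt; apply/orP; left; apply/eqP; congr `| _ |; ring.
Qed.

Lemma segment_connected2 (A : set (R * R)) u v :
  (forall t : R, 0 <= t <= 1 -> A (u.1 + t * (v.1 - u.1), u.2 + t * (v.2 - u.2))) ->
  exists C : set (R * R), [/\ connected C, C `<=` A, C u & C v].
Proof.
move=> H; pose g (t : R) := (u.1 + t * (v.1 - u.1), u.2 + t * (v.2 - u.2)).
exists (g @` `[0, 1]%classic); split.
- apply: connected_continuous_connected; first exact: segment_connected.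
  apply: continuous_subspaceT => t.
  have c0 (x y : R) : (fun t : R => x + t * (y - x)) s @[s --> t] --> x + t * (y - x).
    by apply: cvgD; [exact: cvg_cst|apply: cvgM; [exact: cvg_id|exact: cvg_cst]].
  by apply: (@cvg_pair _ _ _ _ (nbhs (u.1 + t * (v.1 - u.1))) (nbhs (u.2 + t * (v.2 - u.2)))); exact: c0.
- by move=> _ [t /= + <-]; rewrite in_itv/= => /H.
- exists 0; first by rewrite /= in_itv/= lexx ler01.
  by rewrite /g !mul0r !addr0; case: (u).
- exists 1; first by rewrite /= in_itv/= lexx ler01.
  by rewrite /g !mul1r ![_ + (_ - _)]addrC !subrK; case: (v).
Qed.

Definition joined (A : set (R * R)) u v :=
  exists C : set (R * R), [/\ connected C, C `<=` A, C u & C v].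

Lemma joined_trans A u v (x : R * R) : joined A u v -> joined A v x -> joined A u x.
Proof.
move=> [C [cC CA Cu Cv]] [D [cD DA Dv Dw]]; exists (C `|` D); split.
- by apply: connectedU => //; exists v.
- by move=> y [/CA|/DA].
- by left.
- by right.
Qed.

Lemma joined_connected A u : (forall v, A v -> joined A u v) -> connected A.
Proof.
move=> H.
pose I := [set C : set (R * R) | [/\ connected C, C `<=` A & C u]].
have -> : A = \bigcup_(C in I) C.
  apply/seteqP; split; last by move=> v [C [_ CA _] /CA].
  by move=> v /H[C [cC CA Cu Cv]]; exists C.
apply: bigcup_connected; first by exists u => C [].
by move=> C [].
Qed.

End ComplexPlane.

Section Domain.
Context (R : realType) (rho Rad : R).
Hypothesis rho_gt0 : 0 < rho.
Hypothesis rho_le : rho <= 8^-1.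
Hypothesis Rad_gt0 : 0 < Rad.

Definition cantor_domain : set (Cplx R) := @ofC R @^-1` disc_minus_cantor rho Rad.

Lemma cantor_domain_toC u : cantor_domain (toC u) = disc_minus_cantor rho Rad u.
Proof. by rewrite /cantor_domain /= toCK. Qed.

Lemma open_cantor_domain : open cantor_domain.
Proof.
apply: open_comp; last exact: open_disc_minus_cantor.
by move=> w _; exact: continuous_ofC.
Qed.

(** The Cantor set lies on the real axis and to the right of 0: a point is joined
    to the imaginary axis by a horizontal segment, after a small vertical
    displacement if it is real. *)
Lemma connected_disc_minus_cantor : connected (disc_minus_cantor rho Rad).
Proof.
have nc u : u.2 != 0 -> ~ cantor rho 1 1 u.
  by move=> u2 /(cantor_im rho_gt0 rho_le ltr01)/eqP; rewrite (negbTE u2).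
have nc0 (y : R) : ~ cantor rho 1 1 (0, y).
  by move=> /(cantor_re rho_gt0 rho_le ltr01) /=; lra.
have sqt (t x : R) : 0 <= t <= 1 -> (t * x) ^+ 2 <= x ^+ 2.
  move=> t01; rewrite exprMn ler_piMl ?sqr_ge0// expr_le1//; lra.
have step u : disc_minus_cantor rho Rad u -> u.2 != 0 -> joined (disc_minus_cantor rho Rad) (0, 0) u.
  move=> [uR _] u2; rewrite /= /norm2 in uR.
  apply: (@joined_trans _ _ _ (0, u.2)).
    apply: segment_connected2 => t t01 /=; rewrite !subr0 !add0r mulr0.
    split; last exact: nc0.
    rewrite /= /norm2 /= expr0n add0r; have := sqt t u.2 t01; have := sqr_ge0 u.1; lra.
  apply: segment_connected2 => t t01 /=; rewrite subrr subr0 mulr0 addr0 add0r.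
  split; last exact: nc.
  by rewrite /= /norm2 /=; have := sqt t u.1 t01; lra.
apply: (@joined_connected _ _ (0, 0)) => u ou.
have [u20|u20] := eqVneq u.2 0; last exact: step.
have [uR uc] := ou; rewrite /= /norm2 u20 expr0n addr0 in uR.
pose r := Rad ^+ 2 - u.1 ^+ 2; have r0 : 0 < r by rewrite subr_gt0.
have [e e0 er] : exists2 e : R, 0 < e & e ^+ 2 < r.
  exists (Num.min 1 (r / 2)); first by rewrite lt_min ltr01/= divr_gt0.
  have m1 : Num.min 1 (r / 2) <= 1 by rewrite ge_min lexx.
  have m2 : Num.min 1 (r / 2) <= r / 2 by rewrite ge_min lexx orbT.
  have m0 : 0 < Num.min 1 (r / 2) by rewrite lt_min ltr01/= divr_gt0.
  rewrite expr2; apply: (@le_lt_trans _ _ (1 * (r / 2))); last lra.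
  by apply: ler_pM => //; exact: ltW.
apply: (@joined_trans _ _ _ (u.1, e)).
  apply: step; last by rewrite /= gt_eqF.
  split; last by apply: nc; rewrite /= gt_eqF.
  by rewrite /= /norm2 /=; move: er; rewrite /r; lra.
apply: segment_connected2 => t t01 /=; rewrite subrr mulr0 addr0 u20 sub0r.
have [t1|t1] := eqVneq t 1.
  by rewrite t1 mul1r subrr; rewrite -u20; case: (u) ou.
have e1 : e + t * - e = (1 - t) * e by ring.
split; last first.
  apply: nc; rewrite /= e1 mulf_neq0//; last by rewrite gt_eqF.
  by rewrite subr_eq0 eq_sym.
rewrite /= /norm2 /= e1; have := sqt (1 - t) e ltac:(lra); move: er; rewrite /r; lra.
Qed.

Lemma connected_cantor_domain : connected cantor_domain.
Proof.
have -> : cantor_domain = @toC R @` disc_minus_cantor rho Rad.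
  apply/seteqP; split => [w ow|_ [u ou <-]]; last by rewrite cantor_domain_toC.
  by exists (ofC w) => //; rewrite ofCK.
apply: connected_continuous_connected; first exact: connected_disc_minus_cantor.
by apply: continuous_subspaceT; exact: continuous_toC.
Qed.

Lemma cantor_domain0 : cantor_domain 0.
Proof. exact: (disc_minus_cantor0 rho_gt0 rho_le Rad_gt0). Qed.

Lemma bounded_cantor_domain : bounded_domain cantor_domain.
Proof.
split; [by exists 0; exact: cantor_domain0|exact: open_cantor_domain|exact: connected_cantor_domain|].
exists Rad%:C; split; first by rewrite complex_real.
move=> M RM w [ow _] /=; rewrite (le_trans _ (ltW RM))// normC_cabs lecR.
rewrite -(@ler_pXn2r _ 2)// ?nnegrE ?cabs_ge0 ?(ltW Rad_gt0)// cabs_sqr.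
exact: ltW ow.
Qed.

Lemma cintegral_cantor_domain (F : Cplx R -> \bar R) :
  cintegral cantor_domain F = (\int[plane_measure R]_(u in disc_minus_cantor rho Rad) F (toC u))%E.
Proof.
rewrite /cintegral (_ : [set u : R * R | _] = disc_minus_cantor rho Rad)//.
by apply/seteqP; split => -[].
Qed.

End Domain.

(** * The constant 1 is the minimizer *)

Section PowerInequalities.
Context (R : realType).
Implicit Types (x p M : R).

(** Splitting at height M plays the part of Hoelder's inequality on small squares. *)
Lemma le_split_powR x M p : 0 <= x -> 0 < M -> 1 <= p ->
  x <= M + M * (M^-1) `^ p * x `^ p.
Proof.
move=> x0 M0 p1; have [xM|Mx] := leP x M.
  by rewrite (le_trans xM)// lerDl !mulr_ge0 ?powR_ge0// ltW.
have Mi : 0 <= M^-1 by rewrite invr_ge0 ltW.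
rewrite -mulrA -powRM// [X in X <= _](_ : _ = 0 + M * (M^-1 * x)); last first.
  by rewrite add0r mulrA divff ?gt_eqF// mul1r.
apply: lerD; first exact: ltW.
rewrite ler_pM2l// le1r_powR//.
by rewrite mulrC ler_pdivlMr// mul1r ltW.
Qed.

(** Young's inequality for the product of x^2 and 1, with exponent p / 2. *)
Lemma bernoulli_powR x p : 0 <= x -> 2 < p -> 1 + p / 2 * (x ^+ 2 - 1) <= x `^ p.
Proof.
move=> x0 p2; pose r := p / 2.
have r1 : 1 < r by rewrite /r; lra.
have r0 : 0 < r by lra.
have q0 : 0 < r / (r - 1) by rewrite divr_gt0// subr_gt0.
have := @conjugate_powR R (x ^+ 2) 1 r (r / (r - 1)) (sqr_ge0 x) ler01 r0 q0.
rewrite powR1 mulr1 mul1r.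
have -> : (x ^+ 2) `^ r = x `^ p.
  by rewrite -powR_mulrn// -powRrM /r mulrC divfK.
have e : r^-1 + (r / (r - 1))^-1 = 1 by field; rewrite !gt_eqF ?subr_gt0.
move=> /(_ e) h.
have e' : (r / (r - 1))^-1 = 1 - r^-1 by lra.
rewrite e' in h; have := ler_wpM2l (ltW r0) h.
rewrite (_ : r * (x `^ p / r + (1 - r^-1)) = x `^ p + r - 1); last by field; rewrite gt_eqF.
by rewrite -/r; lra.
Qed.

End PowerInequalities.

Section Bergman.
Context (R : realType) (scale Rad p : R).
Hypothesis scale_ge2 : 2 <= scale.
Hypothesis p_gt2 : 2 < p.
Hypothesis scale_p : 8 * scale ^+ 2 * scale^-1 `^ p < 1.
Hypothesis Rad_gt0 : 0 < Rad.
Notation mu2 := (plane_measure R).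

(** The dimension log 2 / log (4 scale) of the Cantor set is small when scale is
    large. *)
Definition ratio : R := (4 * scale)^-1.
Notation rho := ratio.
Local Notation om := (disc_minus_cantor rho Rad).
Local Notation Omega := (cantor_domain rho Rad).

Let scale_gt0 : 0 < scale. Proof. by apply: lt_le_trans scale_ge2. Qed.
Lemma ratio_gt0 : 0 < rho. Proof. by rewrite invr_gt0 mulr_gt0. Qed.
Lemma ratio_le : rho <= 8^-1.
Proof. by rewrite lef_pV2 ?posrE ?mulr_gt0//; have := scale_ge2; lra. Qed.

Let mom : measurable (om : set (plane R)) := measurable_disc_minus_cantor rho Rad.
Let omfin : (mu2 om < +oo)%E := mu2_disc_minus_cantor_lty rho Rad_gt0.

Section OneFunction.
Variable f : Cplx R -> Cplx R.
Hypothesis hf : holomorphic_on Omega f.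

Let a u := complex.Re (f (toC u)).
Let b u := complex.Im (f (toC u)).
Let q u := cabs (f (toC u)).

Lemma holomorphic_cauchy_riemann : cauchy_riemann om a b.
Proof. by move=> u ou; apply: derivable_diff2; apply: hf; rewrite cantor_domain_toC. Qed.

Lemma continuous_Re_on u : om u -> {for u, continuous a}.
Proof. by move=> /holomorphic_cauchy_riemann[A [B [/diff2_continuous]]]. Qed.

Lemma continuous_Im_on u : om u -> {for u, continuous b}.
Proof. by move=> /holomorphic_cauchy_riemann[A [B [_ /diff2_continuous]]]. Qed.

Lemma continuous_cabs_on u : om u -> {for u, continuous q}.
Proof.
move=> ou; have ca := continuous_Re_on ou; have cb := continuous_Im_on ou.
rewrite (_ : q = (fun u => Num.sqrt (a u * a u + b u * b u))); last first.
  by apply/funext => v; rewrite /q cabsE !expr2.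
apply: (continuous_cvg _ (@sqrt_continuous R _)).
by apply: cvgD; apply: cvgM.
Qed.

Lemma measurable_Re_on : measurable_fun (om : set (plane R)) a.
Proof. by apply: continuous_measurable_plane; [exact: open_disc_minus_cantor|exact: continuous_Re_on]. Qed.

Lemma measurable_Im_on : measurable_fun (om : set (plane R)) b.
Proof. by apply: continuous_measurable_plane; [exact: open_disc_minus_cantor|exact: continuous_Im_on]. Qed.

Lemma measurable_cabs_on : measurable_fun (om : set (plane R)) q.
Proof. by apply: continuous_measurable_plane; [exact: open_disc_minus_cantor|exact: continuous_cabs_on]. Qed.

Let mqp : measurable_fun (om : set (plane R)) (fun u => q u `^ p).
Proof. by apply: measurableT_comp (measurable_powR _) measurable_cabs_on. Qed.

Hypothesis fin : (cintegral Omega (fun w => (cabs (f w) `^ p)%:E) < +oo)%E.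

Lemma integrable_cabs_powR : mu2.-integrable om (EFin \o fun u => q u `^ p).
Proof.
apply/integrableP; split; first exact/measurable_EFinP.
move: fin; rewrite cintegral_cantor_domain; apply: le_lt_trans.
apply: ge0_le_integral => //=.
- by apply/measurable_EFinP; apply: measurableT_comp.
- exact/measurable_EFinP.
- by move=> u _; rewrite lee_fin ger0_norm ?lexx ?powR_ge0.
Qed.

Lemma integrable_cabs : mu2.-integrable om (EFin \o q).
Proof.
have i1 := integrableD mom (integrable_cst_on rho Rad_gt0 1) integrable_cabs_powR.
apply: (le_integrable mom _ _ i1); first by apply/measurable_EFinP; exact: measurable_cabs_on.
move=> u _; rewrite /= lee_fin (ger0_norm (cabs_ge0 _)); apply: le_trans (ler_norm _).
by have := @le_split_powR R (q u) 1 p (cabs_ge0 _) ltr01; rewrite mul1r invr1 powR1 mul1r; apply; have := p_gt2; lra.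
Qed.

Lemma integrable_Re_on : mu2.-integrable om (EFin \o a).
Proof.
apply: (le_integrable mom _ _ integrable_cabs); first by apply/measurable_EFinP; exact: measurable_Re_on.
by move=> u _; rewrite /= lee_fin (ger0_norm (cabs_ge0 _)); exact: Re_le_cabs.
Qed.

Lemma integrable_Im_on : mu2.-integrable om (EFin \o b).
Proof.
apply: (le_integrable mom _ _ integrable_cabs); first by apply/measurable_EFinP; exact: measurable_Im_on.
by move=> u _; rewrite /= lee_fin (ger0_norm (cabs_ge0 _)); exact: Im_le_cabs.
Qed.

Let N := \int[mu2]_(u in om) q u `^ p.

Let N_ge0 : 0 <= N. Proof. by apply: Rintegral_ge0 => u _; exact: powR_ge0. Qed.

Let NE : (\int[mu2]_(u in om) (q u `^ p)%:E = N%:E)%E.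
Proof. by rewrite /N fineK//; exact: integrable_fin_num integrable_cabs_powR. Qed.

Let be M := M * M^-1 `^ p.

Let on_square M c s : 0 < M -> 0 < s ->
  (\int[mu2]_(u in om `&` cantor_level rho 0 c s) (`|a u| + `|b u|)%:E <=
    ((8 * M) * s ^+ 2 + 2 * be M * N)%:E)%E.
Proof.
move=> M0 s0.
have msq := measurable_cantor_level rho 0 c s.
have mi : measurable (om `&` cantor_level rho 0 c s : set (plane R)) by exact: measurableI.
have be0 : 0 <= be M by rewrite mulr_ge0 ?powR_ge0// ltW.
have sub : om `&` cantor_level rho 0 c s `<=` om by exact: subIsetl.
apply: (@le_trans _ _ (\int[mu2]_(u in om `&` cantor_level rho 0 c s)
    ((2 * M)%:E + (2 * be M)%:E * (q u `^ p)%:E))%E).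
  apply: ge0_le_integral => //.
  - apply/measurable_EFinP; apply: (measurable_funS mom) => //; apply: measurable_funD;
      apply: measurableT_comp => //; [exact: measurable_Re_on|exact: measurable_Im_on].
  - apply: emeasurable_funD => //; apply: emeasurable_funM => //; apply/measurable_EFinP.
    exact: (measurable_funS mom).
  - move=> u _; rewrite -EFinM -EFinD lee_fin.
    have := @le_split_powR R (q u) M p (cabs_ge0 _) M0 ltac:(have := p_gt2; lra).
    have := Re_le_cabs (f (toC u)); have := Im_le_cabs (f (toC u)).
    rewrite -/(a u) -/(b u) -/(q u) /be; lra.
rewrite ge0_integralD//; first last.
- by apply: emeasurable_funM => //; apply/measurable_EFinP; exact: (measurable_funS mom).
- by move=> u _; rewrite -EFinM lee_fin; apply: mulr_ge0; [exact: mulr_ge0|exact: powR_ge0].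
- by move=> u _; rewrite lee_fin mulr_ge0 ?(ltW M0).
rewrite EFinD; apply: leeD.
  rewrite integral_cst//.
  apply: (@le_trans _ _ ((2 * M)%:E * (4 * s ^+ 2)%:E)%E).
    apply: lee_wpmul2l; first by rewrite lee_fin mulr_ge0 ?(ltW M0).
    apply: le_trans (mu2_cantor_level0 rho c s0); apply: le_measure; rewrite ?inE//; exact: subIsetr.
  by rewrite -EFinM lee_fin; lra.
rewrite ge0_integralZl//; first last.
- by rewrite lee_fin mulr_ge0.
- by move=> u _; rewrite lee_fin powR_ge0.
- by apply/measurable_EFinP; exact: (measurable_funS mom).
rewrite [X in (_ <= X)%E]EFinM; apply: lee_wpmul2l; first by rewrite lee_fin mulr_ge0.
rewrite -NE; apply: ge0_subset_integral => //; [exact/measurable_EFinP|by move=> u _; rewrite lee_fin powR_ge0].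
Qed.

(** |f| is split at height scale^n.  In the bound of integral_gradient the two parts
    contribute multiples of (2 scale rho)^n = 2^-n and of
    (2 scale scale^-p / rho)^n = (8 scale^2 scale^-p)^n. *)
Lemma bergman_cutoff_negligible : cutoff_negligible rho Rad a b.
Proof.
pose q0 := 8 * scale ^+ 2 * scale^-1 `^ p.
have q00 : 0 <= q0 < 1 by rewrite scale_p andbT !mulr_ge0 ?powR_ge0 ?exprn_ge0// ltW.
have lim1 := @cvg_geometric_EFin R 256 (2^-1) ltac:(lra).
have lim2 := @cvg_geometric_EFin R (64 * N) q0 q00.
have lim : ((256 * 2^-1 ^+ n)%:E + (64 * N * q0 ^+ n)%:E)%E @[n --> \oo] --> (0 : \bar R)%E.
  by rewrite -[X in _ --> X]adde0; apply: cvgeD.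
apply: (squeeze_cvge _ (cvg_cst 0%E) lim); apply: nearW => n.
rewrite integral_ge0/=; last first.
  by move=> u _; rewrite lee_fin mulr_ge0 ?addr_ge0 ?gradient_size_ge0.
have M0 : 0 < scale ^+ n by rewrite exprn_gt0.
have mg : measurable_fun (om : set (plane R)) (fun u => `|a u| + `|b u|).
  by apply: measurable_funD; apply: measurableT_comp => //; [exact: measurable_Re_on|exact: measurable_Im_on].
have H := @integral_gradient _ rho ratio_gt0 om (fun u => `|a u| + `|b u|) (8 * scale ^+ n)
  (2 * be (scale ^+ n) * N) mom mg (fun u _ => addr_ge0 (normr_ge0 _) (normr_ge0 _))
  (fun c s s0 => on_square c M0 s0) n 1 1 ltr01.
apply: (le_trans H); rewrite -EFinD lee_fin mulr1.
have e1 : be (scale ^+ n) = (scale * scale^-1 `^ p) ^+ n.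
  rewrite /be exprMn; congr (_ * _).
  have mi : 0 <= scale^-1 by rewrite invr_ge0 ltW.
  by rewrite -exprVn -(powR_mulrn n (powR_ge0 _ p)) -(powR_mulrn n mi) powRAC.
rewrite le_eqVlt; apply/orP; left; apply/eqP.
rewrite e1 mulrDr; congr (_ + _).
  rewrite (_ : _ * _ = 256 * (2 * (scale * rho)) ^+ n); last by rewrite !exprMn; ring.
  by congr (_ * _ ^+ _); rewrite /ratio; field; rewrite gt_eqF.
rewrite /q0 -exprVn.
apply: (@etrans _ _ (64 * N * (2 * (scale * scale^-1 `^ p) * rho^-1) ^+ n)).
  by move: (scale^-1 `^ p) (rho^-1) => x y; rewrite !exprMn; ring.
by congr (_ * _ ^+ _); rewrite /ratio invrK; ring.
Qed.

Lemma bergman_admissible : admissible rho Rad a b.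
Proof.
split; [exact: holomorphic_cauchy_riemann|exact: integrable_Re_on|exact: integrable_Im_on|].
exact: bergman_cutoff_negligible.
Qed.

(** Bernoulli's inequality for |f|, integrated; the linear term p (Re f - 1) has
    integral 0 by the mean value property.  It shows both that 1 is a minimizer
    and that there is no other. *)
Lemma norm_ge_volume : f 0 = 1 ->
  [/\ mu2.-integrable om (EFin \o fun u => cabs (f (toC u) - 1) ^+ 2) &
  fine (mu2 om) + p / 2 * \int[mu2]_(u in om) (cabs (f (toC u) - 1) ^+ 2) <= N].
Proof.
move=> f01.
have mean := mean_value ratio_gt0 ratio_le Rad_gt0 bergman_admissible.
have a0 : a (0, 0) = 1 by rewrite /a [toC _](_ : _ = 0)// f01.
rewrite a0 mul1r in mean.
have p0 : 0 < p by have := p_gt2; lra.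
have pt u : p / 2 * cabs (f (toC u) - 1) ^+ 2 <= q u `^ p - (1 + p * (a u - 1)).
  have := bernoulli_powR (cabs_ge0 (f (toC u))) p_gt2.
  rewrite -/(q u) cabs_sqr !(Re_add, Im_add, Re_opp, Im_opp) -/(a u) -/(b u).
  rewrite [complex.Re 1]/= [complex.Im 1]/= cabs_sqr -/(a u) -/(b u) oppr0 addr0.
  lra.
have i1 := integrable_cst_on rho Rad_gt0 1.
have ia := integrable_Re_on.
have iL : mu2.-integrable om (EFin \o fun u => 1 + p * (a u - 1)).
  have := integrableD mom i1 (integrableZl mom p (integrableB mom ia i1)).
  by apply: eq_integrable => // u _.
have iB : mu2.-integrable om (EFin \o fun u => q u `^ p - (1 + p * (a u - 1))).
  have := integrableB mom integrable_cabs_powR iL.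
  by apply: eq_integrable => // u _.
have mD : measurable_fun (om : set (plane R)) (fun u => cabs (f (toC u) - 1) ^+ 2).
  rewrite (_ : (fun u => _) = (fun u => (a u - 1) ^+ 2 + b u ^+ 2)).
    by apply: measurable_funD; apply: measurable_funX; [apply: measurable_funB => //; exact: measurable_Re_on|exact: measurable_Im_on].
  by apply/funext => u; rewrite cabs_sqr !(Re_add, Im_add, Re_opp, Im_opp) [complex.Im 1]/= oppr0 addr0.
have iD' : mu2.-integrable om (EFin \o fun u => p / 2 * cabs (f (toC u) - 1) ^+ 2).
  apply: (le_integrable mom _ _ iB).
    by apply/measurable_EFinP; apply: measurable_funM.
  move=> u _; rewrite /= lee_fin ger0_norm; last by rewrite mulr_ge0 ?sqr_ge0// divr_ge0// ltW.
  exact: le_trans (pt u) (ler_norm _).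
have iD : mu2.-integrable om (EFin \o fun u => cabs (f (toC u) - 1) ^+ 2).
  have := integrableZl mom (p / 2)^-1 iD'.
  apply: eq_integrable => // u _; rewrite /= -EFinM mulKf//.
  by rewrite gt_eqF// divr_gt0.
split => //.
have H := le_Rintegral mom iD' iB (fun u _ => pt u).
rewrite RintegralZl// RintegralB// in H; last exact: integrable_cabs_powR.
have iaB : mu2.-integrable om (EFin \o fun u => a u - 1).
  have := integrableB mom ia i1; by apply: eq_integrable.
have ipB : mu2.-integrable om (EFin \o fun u => p * (a u - 1)).
  have := integrableZl mom p iaB; by apply: eq_integrable.
move: H; rewrite RintegralD// RintegralZl// RintegralB// mean !Rintegral_cst//.
by rewrite mul1r subrr mulr0 addr0 -/N; lra.
Qed.

End OneFunction.

Lemma continuous_integral0 (h : R * R -> R) :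
  (forall u, om u -> {for u, continuous h}) -> (forall u, 0 <= h u) ->
  mu2.-integrable om (EFin \o h) -> \int[mu2]_(u in om) h u <= 0 ->
  forall u, om u -> h u = 0.
Proof.
move=> ch h0 ih int0 u ou; apply/eqP; rewrite eq_le h0 andbT leNgt; apply/negP => hu.
have hu2 : h u / 2 < h u by lra.
have n1 : \forall v \near u, h u / 2 < h v.
  exact: (ch u ou _ (open_nbhs_nbhs (conj (@open_gt _ _) hu2))).
have n2 : \forall v \near u, om v by apply: open_nbhs_nbhs; split => //; exact: open_disc_minus_cantor.
have [d d0 Hd] := (near_boxP _ _).1 (filterI n1 n2).
pose r := rect u.1 u.2 (d / 2) (d / 2).
have d20 : 0 <= d / 2 by lra.
have rH v : r v -> h u / 2 < h v /\ om v.
  by move=> [/=]; rewrite !in_itv/= => r1 r2; apply: Hd; rewrite ger0_norm; lra.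
have mr : measurable r by exact: measurable_rect.
have rom : r `<=` om by move=> v /rH[].
have ir : mu2.-integrable r (EFin \o h) by exact: integrableS ih.
have mr2 : mu2 r = (d / 2 * (d / 2))%:E by exact: mu2_rect.
have fr : (mu2 r < +oo)%E by rewrite mr2 ltry.
have h1 : \int[mu2]_(v in r) (h u / 2) <= \int[mu2]_(v in r) h v.
  apply: le_Rintegral => //; last by move=> v /rH[/ltW].
  by apply: measurable_bounded_integrable => //; exact: bounded_cst.
have h2 : \int[mu2]_(v in r) h v <= \int[mu2]_(v in om) h v.
  apply: fine_le; [exact: integrable_fin_num ir|exact: integrable_fin_num ih|].
  by apply: ge0_subset_integral => //; [exact: measurable_int ih|move=> v _; rewrite lee_fin].
move: h1; rewrite Rintegral_cst// [X in _ * fine X]mr2 /= => h1.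
have pos : 0 < h u / 2 * (d / 2 * (d / 2)) by rewrite !mulr_gt0// divr_gt0.
by have := lt_le_trans pos (le_trans h1 (le_trans h2 int0)); rewrite ltxx.
Qed.

Let V := fine (mu2 om).

Lemma volume_gt0 : 0 < V.
Proof.
have o0 := disc_minus_cantor0 ratio_gt0 ratio_le Rad_gt0.
rewrite lt_neqAle eq_sym fine_ge0// andbT; apply/eqP => V0.
have c1 (u : R * R) : om u -> {for u, continuous (fun=> 1 : R)} by move=> _; exact: cvg_cst.
have := continuous_integral0 c1 (fun _ => ler01) (integrable_cst_on rho Rad_gt0 1) _ o0.
rewrite Rintegral_cst// -/V V0 mulr0 lexx => /(_ isT) /eqP.
by rewrite oner_eq0.
Qed.

Let p0 : 0 < p. Proof. by apply: lt_trans p_gt2. Qed.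

Lemma normalized_one : normalized_at Omega p 0 (fun=> 1).
Proof.
split => //; split; first by move=> w _; exact: derivable_cst.
rewrite cintegral_cantor_domain; under eq_integral do rewrite cabs1 powR1.
by rewrite integral_cst//= mul1e.
Qed.

Lemma bergman_normE f : bergman_norm Omega p f =
  (\int[mu2]_(u in om) cabs (f (toC u)) `^ p) `^ p^-1.
Proof. by rewrite /bergman_norm cintegral_cantor_domain. Qed.

Lemma bergman_norm_one : bergman_norm Omega p (fun=> 1) = V `^ p^-1.
Proof.
rewrite bergman_normE; under eq_Rintegral do rewrite cabs1 powR1.
by rewrite Rintegral_cst// mul1r.
Qed.

Lemma bergman_norm_lb f : normalized_at Omega p 0 f -> V `^ p^-1 <= bergman_norm Omega p f.
Proof.
move=> [[hf fin] f0]; have [_ H] := norm_ge_volume hf fin f0.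
rewrite bergman_normE; apply: ge0_ler_powR; rewrite ?nnegrE ?invr_ge0 ?(ltW p0)//.
- exact: ltW volume_gt0.
- by apply: Rintegral_ge0 => u _; exact: powR_ge0.
- apply: le_trans H; rewrite lerDl mulr_ge0 ?divr_ge0 ?(ltW p0)//.
  by apply: Rintegral_ge0 => u _; exact: sqr_ge0.
Qed.

Lemma min_normE : min_norm Omega p 0 = V `^ p^-1.
Proof.
apply/eqP; rewrite eq_le; apply/andP; split.
  rewrite -bergman_norm_one; apply: inf_lbound; last by exists (fun=> 1) => //; exact: normalized_one.
  by exists (V `^ p^-1) => _ [f nf <-]; exact: bergman_norm_lb.
apply: lb_le_inf.
  by exists (bergman_norm Omega p (fun=> 1)); exists (fun=> 1) => //; exact: normalized_one.
by move=> _ [f nf <-]; exact: bergman_norm_lb.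
Qed.

Lemma minimizer_eq1 w : Omega w -> minimizer Omega p 0 w = 1.
Proof.
have : is_minimizer Omega p 0 (minimizer Omega p 0).
  rewrite /minimizer; apply: (@xgetPex _ (fun=> 0) [set f | is_minimizer Omega p 0 f]).
  exists (fun=> 1); split; first exact: normalized_one.
  by rewrite bergman_norm_one min_normE.
set g := minimizer Omega p 0.
move=> [[[hg fin] g0] nmin] ow.
have [i2 H] := norm_ge_volume hg fin g0.
move: nmin; rewrite min_normE bergman_normE => nmin.
have NV : \int[mu2]_(u in om) cabs (g (toC u)) `^ p = V.
  apply: (@powR_injective _ p^-1) nmin; rewrite ?invr_gt0// nnegrE.
    by apply: Rintegral_ge0 => u _; exact: powR_ge0.
  exact: ltW volume_gt0.
rewrite NV in H.
have int0 : \int[mu2]_(u in om) (cabs (g (toC u) - 1) ^+ 2) <= 0.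
  have : p / 2 * \int[mu2]_(u in om) (cabs (g (toC u) - 1) ^+ 2) <= 0 by move: H; rewrite -/V; lra.
  by rewrite pmulr_rle0// divr_gt0.
have ch u : om u -> {for u, continuous (fun u => cabs (g (toC u) - 1) ^+ 2)}.
  move=> ou; have ca := continuous_Re_on hg ou; have cb := continuous_Im_on hg ou.
  rewrite (_ : (fun u => _) = (fun u => (complex.Re (g (toC u)) - 1) * (complex.Re (g (toC u)) - 1)
     + complex.Im (g (toC u)) * complex.Im (g (toC u)))); last first.
    by apply/funext => v; rewrite cabs_sqr !(Re_add, Im_add, Re_opp, Im_opp) [complex.Im 1]/= oppr0 addr0 !expr2.
  apply: cvgD; apply: cvgM => //; by apply: cvgB => //; exact: cvg_cst.
have := continuous_integral0 ch (fun u => sqr_ge0 _) i2 int0 ow.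
rewrite ofCK => /eqP; rewrite sqrf_eq0 => /eqP/cabs_eq0/eqP.
by rewrite subr_eq0 => /eqP.
Qed.

Lemma pBergman_constant w : Omega w -> pBergman Omega p w 0 = (V^-1)%:C.
Proof.
move=> ow; rewrite /pBergman minimizer_eq1// mul1r /pBergman_diag min_normE.
by rewrite -powRrM mulrN mulVf ?gt_eqF// powR_inv1// ltW// volume_gt0.
Qed.

End Bergman.

(** * The Cauchy transform of the Cantor measure *)

Section CantorAverage.
Context (R : realType) (rho : R).
Hypothesis rho_gt0 : 0 < rho.
Hypothesis rho_le : rho <= 8^-1.
Implicit Types (c s x y : R) (phi psi : R -> R).

Local Notation Kc := (cantor rho).
Local Notation re := (right_end rho).

(** The average of phi over the left end points of the 2^n intervals of stage n.
    The limit cantor_mean is integration against the natural measure of the Cantor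
    set, and inherits its self-similarity (cantor_mean_split). *)
Fixpoint cantor_avg n c s phi : R :=
  if n is m.+1 then (cantor_avg m c (rho * s) phi + cantor_avg m (re c s) (rho * s) phi) / 2
  else phi c.

Let rs0 s : 0 < s -> 0 < rho * s. Proof. by move=> s0; rewrite mulr_gt0. Qed.

Lemma cantor_left c s u : 0 < s -> Kc c (rho * s) u -> Kc c s u.
Proof. by move=> s0 h; apply/(cantor_split rho_gt0 rho_le _ _ s0); left. Qed.

Lemma cantor_right c s u : 0 < s -> Kc (re c s) (rho * s) u -> Kc c s u.
Proof. by move=> s0 h; apply/(cantor_split rho_gt0 rho_le _ _ s0); right. Qed.

Lemma cantor_avg_itv n c s phi a b : 0 < s -> (forall x, Kc c s (x, 0) -> a <= phi x <= b) ->
  a <= cantor_avg n c s phi <= b.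
Proof.
elim: n c s => [|n IH] c s s0 H /=.
  by apply: H; exact: cantor_start.
have /andP[h1 h2] := IH c (rho * s) (rs0 s0) (fun x k => H x (cantor_left s0 k)).
have /andP[h3 h4] := IH _ (rho * s) (rs0 s0) (fun x k => H x (cantor_right s0 k)).
by lra.
Qed.

Lemma cantor_avg_linear n c s phi psi a b :
  cantor_avg n c s (fun x => a * phi x + b * psi x) = a * cantor_avg n c s phi + b * cantor_avg n c s psi.
Proof.
by elim: n c s => [//|n IH] c s /=; rewrite !IH; field.
Qed.

Lemma cantor_avg_step n c s phi L : 0 < s ->
  (forall x y, Kc c s (x, 0) -> Kc c s (y, 0) -> `|phi x - phi y| <= L * `|x - y|) ->
  `|cantor_avg n.+1 c s phi - cantor_avg n c s phi| <= L * (rho ^+ n * s).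
Proof.
elim: n c s => [|n IH] c s s0 H.
  rewrite expr0 mul1r /=.
  have k1 : Kc c s (c, 0) by exact: cantor_start.
  have k2 : Kc c s (re c s, 0) by apply: cantor_right => //; exact: cantor_start (rs0 s0).
  have := H _ _ k2 k1; rewrite [right_end _ _ _ - c](_ : _ = (1 - rho) * s); last by rewrite /right_end; ring.
  have r1 : 0 < (1 - rho) * s by rewrite mulr_gt0// subr_gt0 (le_lt_trans rho_le)// invf_lt1// ltr1n.
  rewrite (gtr0_norm r1) => h.
  have L0 : 0 <= L by rewrite -(pmulr_lge0 _ r1) (le_trans _ h).
  rewrite (_ : _ - _ = (phi (re c s) - phi c) / 2); last by field.
  rewrite normrM [`|2^-1|]gtr0_norm// ler_pdivrMr//; apply: (le_trans h).
  rewrite -mulrA ler_wpM2l//.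
  have : 0 < rho * s := rs0 s0.
  by rewrite mulrBl mul1r; lra.
have h1 := IH c (rho * s) (rs0 s0) (fun x y kx ky => H x y (cantor_left s0 kx) (cantor_left s0 ky)).
have h2 := IH (re c s) (rho * s) (rs0 s0) (fun x y kx ky => H x y (cantor_right s0 kx) (cantor_right s0 ky)).
rewrite exprSr -(mulrA _ rho s).
have E m : cantor_avg m.+1 c s phi = (cantor_avg m c (rho * s) phi + cantor_avg m (re c s) (rho * s) phi) / 2 by [].
rewrite (E n.+1) (E n).
set a := cantor_avg n.+1 c (rho * s) phi in h1 *; set b := cantor_avg n.+1 (re c s) (rho * s) phi in h2 *.
move: h1 h2; set a' := cantor_avg n c _ _; set b' := cantor_avg n _ _ _.
move: (L * _) => B h1 h2.
rewrite (_ : (a + b) / 2 - _ = ((a - a') + (b - b')) / 2); last by field.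
rewrite normrM [`|2^-1|]gtr0_norm// ler_pdivrMr//.
by apply: (le_trans (ler_normD _ _)); lra.
Qed.

(** Sufficient for the averages to converge, by the geometric bound
    cantor_avg_step. *)
Definition regular c s phi := exists L M, forall x y, Kc c s (x, 0) -> Kc c s (y, 0) ->
  `|phi x| <= M /\ `|phi x - phi y| <= L * `|x - y|.

Definition cantor_mean c s phi := lim (cantor_avg n c s phi @[n --> \oo]).

Let rho1 : `|rho| < 1.
Proof. by rewrite gtr0_norm// (le_lt_trans rho_le)// invf_lt1// ltr1n. Qed.

Lemma cantor_mean_cvg c s phi : 0 < s -> regular c s phi ->
  cantor_avg n c s phi @[n --> \oo] --> cantor_mean c s phi.
Proof.
move=> s0 [L [M H]]; apply/cvg_ex => /=.
have cs : Kc c s (c, 0) by exact: cantor_start.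
pose C := `|L| * s * 2.
have C0 : 0 <= C by rewrite !mulr_ge0// ltW.
(* C * rho ^+ n dominates the tail of the steps, which makes v monotone *)
pose v n := cantor_avg n c s phi - C * rho ^+ n.
have step n : `|cantor_avg n.+1 c s phi - cantor_avg n c s phi| <= `|L| * (rho ^+ n * s).
  apply: cantor_avg_step => // x y kx ky; have [_ h] := H x y kx ky.
  by apply: (le_trans h); rewrite ler_wpM2r// ler_norm.
have vmon : nondecreasing_seq v.
  apply/nondecreasing_seqP => n; rewrite /v.
  have := step n => /ler_normlP[h1 _].
  have rn : 0 <= rho ^+ n by rewrite exprn_ge0// ltW.
  have : `|L| * (rho ^+ n * s) <= C * rho ^+ n - C * rho ^+ n.+1.
    rewrite (_ : `|L| * (rho ^+ n * s) = C * rho ^+ n * 2^-1); last by rewrite /C; field.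
    rewrite exprS (_ : C * rho ^+ n - C * (rho * rho ^+ n) = C * rho ^+ n * (1 - rho)); last ring.
    by rewrite ler_wpM2l ?mulr_ge0//; have := rho_le; lra.
  lra.
have vub : has_ubound (range v).
  exists M => _ [n _ <-].
  have Hb x : Kc c s (x, 0) -> - M <= phi x <= M.
    by move=> kx; rewrite -ler_norml; case: (H x x kx kx).
  have /andP[_ h] := cantor_avg_itv n s0 Hb.
  have h' : 0 <= C * rho ^+ n by rewrite mulr_ge0// exprn_ge0// ltW.
  by rewrite /v; lra.
have cv := nondecreasing_is_cvgn vmon vub.
have cz : C * rho ^+ n @[n --> \oo] --> C * 0.
  by apply: cvgM; [exact: cvg_cst|exact: cvg_expr].
exists (lim (v @ \oo) + C * 0).
rewrite (_ : (fun n => cantor_avg n c s phi) = (fun n => v n + C * rho ^+ n)); last first.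
  by apply/funext => n; rewrite /v subrK.
by apply: cvgD.
Qed.

Lemma cantor_mean_itv c s phi a b : 0 < s -> regular c s phi ->
  (forall x, Kc c s (x, 0) -> a <= phi x <= b) -> a <= cantor_mean c s phi <= b.
Proof.
move=> s0 rphi H; have cv := cantor_mean_cvg s0 rphi.
apply/andP; split.
  apply: (ler_cvg_to (cvg_cst a) cv); apply: nearW => n.
  by have /andP[] := cantor_avg_itv n s0 H.
apply: (ler_cvg_to cv (cvg_cst b)); apply: nearW => n.
by have /andP[] := cantor_avg_itv n s0 H.
Qed.

Lemma cantor_mean_linear c s phi psi a b : 0 < s -> regular c s phi -> regular c s psi ->
  cantor_mean c s (fun x => a * phi x + b * psi x) = a * cantor_mean c s phi + b * cantor_mean c s psi.
Proof.
move=> s0 r1 r2; apply/cvg_lim => //.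
under eq_fun do rewrite cantor_avg_linear.
by apply: cvgD; (apply: cvgM; [exact: cvg_cst|exact: cantor_mean_cvg]).
Qed.

Lemma regular_left c s phi : 0 < s -> regular c s phi -> regular c (rho * s) phi.
Proof.
by move=> s0 [L [M H]]; exists L, M => x y kx ky; apply: H; exact: cantor_left.
Qed.

Lemma regular_right c s phi : 0 < s -> regular c s phi -> regular (re c s) (rho * s) phi.
Proof.
by move=> s0 [L [M H]]; exists L, M => x y kx ky; apply: H; exact: cantor_right.
Qed.

Lemma cantor_mean_split c s phi : 0 < s -> regular c s phi ->
  cantor_mean c s phi = (cantor_mean c (rho * s) phi + cantor_mean (re c s) (rho * s) phi) / 2.
Proof.
move=> s0 r; apply/cvg_lim => //.
rewrite -(cvg_shiftS (fun n => cantor_avg n c s phi)) /=.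
apply: cvgM; last exact: cvg_cst.
apply: cvgD; apply: cantor_mean_cvg; rewrite ?rs0//.
  exact: regular_left.
exact: regular_right.
Qed.

End CantorAverage.

Section ComplexAverage.
Context (R : realType) (rho : R).
Hypothesis rho_gt0 : 0 < rho.
Hypothesis rho_le : rho <= 8^-1.
Implicit Types (c s x y : R) (phi psi : R -> Cplx R) (w z : Cplx R).

Local Notation Kc := (cantor rho).
Local Notation re := (right_end rho).

Definition regularC c s phi := exists L M, forall x y, Kc c s (x, 0) -> Kc c s (y, 0) ->
  cabs (phi x) <= M /\ cabs (phi x - phi y) <= L * `|x - y|.

Definition cantor_meanC c s phi : Cplx R :=
  cantor_mean rho c s (fun x => complex.Re (phi x)) +i* cantor_mean rho c s (fun x => complex.Im (phi x)).

Lemma regularC_Re c s phi : regularC c s phi -> regular rho c s (fun x => complex.Re (phi x)).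
Proof.
move=> [L [M H]]; exists L, M => x y kx ky; have [h1 h2] := H x y kx ky; split.
  exact: le_trans (Re_le_cabs _) h1.
by apply: le_trans h2; rewrite -Re_opp -Re_add; exact: Re_le_cabs.
Qed.

Lemma regularC_Im c s phi : regularC c s phi -> regular rho c s (fun x => complex.Im (phi x)).
Proof.
move=> [L [M H]]; exists L, M => x y kx ky; have [h1 h2] := H x y kx ky; split.
  exact: le_trans (Im_le_cabs _) h1.
by apply: le_trans h2; rewrite -Im_opp -Im_add; exact: Im_le_cabs.
Qed.

Lemma regularC_add c s phi psi : regularC c s phi -> regularC c s psi ->
  regularC c s (fun x => phi x + psi x).
Proof.
move=> [L1 [M1 H1]] [L2 [M2 H2]]; exists (L1 + L2), (M1 + M2) => x y kx ky.
have [h1 h2] := H1 x y kx ky; have [h3 h4] := H2 x y kx ky; split.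
  by rewrite (le_trans (cabsD _ _))// lerD.
rewrite (_ : _ - _ = (phi x - phi y) + (psi x - psi y)); last by ring.
by rewrite (le_trans (cabsD _ _))// mulrDl lerD.
Qed.

Lemma regularC_mul c s phi psi : 0 < s -> regularC c s phi -> regularC c s psi ->
  regularC c s (fun x => phi x * psi x).
Proof.
move=> s0 [L1 [M1 H1]] [L2 [M2 H2]]; exists (M1 * L2 + M2 * L1), (M1 * M2) => x y kx ky.
have [h1 h2] := H1 x y kx ky; have [h3 h4] := H2 x y kx ky.
have [h5 _] := H2 y x ky kx.
split; first by rewrite cabsM ler_pM ?cabs_ge0.
rewrite (_ : _ - _ = phi x * (psi x - psi y) + psi y * (phi x - phi y)); last by ring.
rewrite (le_trans (cabsD _ _))// !cabsM mulrDl -!mulrA.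
by apply: lerD; apply: ler_pM; rewrite ?cabs_ge0.
Qed.

Lemma regularC_cst c s w : regularC c s (fun=> w).
Proof. by exists 0, (cabs w) => x y _ _; rewrite subrr cabs0 mul0r. Qed.

Lemma cantor_meanC_add c s phi psi : 0 < s -> regularC c s phi -> regularC c s psi ->
  cantor_meanC c s (fun x => phi x + psi x) = cantor_meanC c s phi + cantor_meanC c s psi.
Proof.
move=> s0 r1 r2; apply/eqP; rewrite eq_complex Re_add Im_add /=; apply/andP; split; apply/eqP.
  rewrite (_ : (fun x => _) = (fun x => 1 * complex.Re (phi x) + 1 * complex.Re (psi x))).
    by rewrite cantor_mean_linear ?mul1r//; exact: regularC_Re.
  by apply/funext => x; rewrite Re_add !mul1r.
rewrite (_ : (fun x => _) = (fun x => 1 * complex.Im (phi x) + 1 * complex.Im (psi x))).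
  by rewrite cantor_mean_linear ?mul1r//; exact: regularC_Im.
by apply/funext => x; rewrite Im_add !mul1r.
Qed.

Lemma cantor_meanC_scale c s phi w : 0 < s -> regularC c s phi ->
  cantor_meanC c s (fun x => w * phi x) = w * cantor_meanC c s phi.
Proof.
move=> s0 r; have r1 := regularC_Re r; have r2 := regularC_Im r.
apply/eqP; rewrite eq_complex Re_mul Im_mul /=; apply/andP; split; apply/eqP.
  rewrite (_ : (fun x => _) = (fun x => complex.Re w * complex.Re (phi x) + (- complex.Im w) * complex.Im (phi x))).
    by rewrite cantor_mean_linear// mulNr.
  by apply/funext => x; rewrite Re_mul mulNr.
rewrite (_ : (fun x => _) = (fun x => complex.Re w * complex.Im (phi x) + complex.Im w * complex.Re (phi x))).
  by rewrite cantor_mean_linear.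
by apply/funext => x; rewrite Im_mul.
Qed.

Lemma cantor_meanC_bound c s phi M : 0 < s -> regularC c s phi ->
  (forall x, Kc c s (x, 0) -> cabs (phi x) <= M) -> cabs (cantor_meanC c s phi) <= 2 * M.
Proof.
move=> s0 r H; apply: (le_trans (cabs_le_ReIm _)); rewrite mulr_natl mulr2n /=.
apply: lerD; rewrite ler_norml; apply: cantor_mean_itv => //.
- exact: regularC_Re.
- by move=> x kx; rewrite -ler_norml (le_trans (Re_le_cabs _))// H.
- exact: regularC_Im.
- by move=> x kx; rewrite -ler_norml (le_trans (Im_le_cabs _))// H.
Qed.

Lemma cantor_meanC_split c s phi : 0 < s -> regularC c s phi ->
  cantor_meanC c s phi = (cantor_meanC c (rho * s) phi + cantor_meanC (re c s) (rho * s) phi) * (2^-1)%:C.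
Proof.
move=> s0 r; apply/eqP; rewrite eq_complex Re_mul Im_mul Re_add Im_add /= !mulr0 subr0 add0r.
by rewrite -!cantor_mean_split//; [rewrite !eqxx|exact: regularC_Im|exact: regularC_Re].
Qed.

Definition cauchy_transform c s w : Cplx R := cantor_meanC c s (fun x => (w - x%:C)^-1).

(** d bounds from below the distance of w to the Cantor set. *)
Definition away c s w (d : R) := forall x, Kc c s (x, 0) -> d <= cabs (w - x%:C).

Lemma cabs_real x : cabs (x%:C : Cplx R) = `|x|.
Proof. by rewrite cabsE /= expr0n addr0 sqrtr_sqr. Qed.

Lemma away_neq0 c s w d x : 0 < d -> away c s w d -> Kc c s (x, 0) -> w - x%:C != 0.
Proof.
move=> d0 aw kx; apply/eqP => h; have := aw x kx.
by rewrite h cabs0 leNgt d0.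
Qed.

Lemma away_inv c s w d x : 0 < d -> away c s w d -> Kc c s (x, 0) -> cabs (w - x%:C)^-1 <= d^-1.
Proof.
move=> d0 aw kx; rewrite cabsV lef_pV2 ?posrE//; first exact: aw.
exact: lt_le_trans d0 (aw x kx).
Qed.

Lemma away_regular c s w d : 0 < d -> away c s w d -> regularC c s (fun x => (w - x%:C)^-1).
Proof.
move=> d0 aw; exists (d^-1 * d^-1), d^-1 => x y kx ky.
split; first exact: away_inv aw kx.
have nx := away_neq0 d0 aw kx; have ny := away_neq0 d0 aw ky.
rewrite (_ : _ - _ = (w - x%:C)^-1 * (w - y%:C)^-1 * (x - y)%:C).
  rewrite !cabsM cabs_real ler_wpM2r//; apply: ler_pM; rewrite ?cabs_ge0//.
    exact: away_inv aw kx.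
  exact: away_inv aw ky.
rewrite rmorphB/=; move: nx ny; move: (x%:C) (y%:C) => X Y nx ny.
by field; rewrite nx ny.
Qed.

Lemma cauchy_transform_bound c s w d : 0 < s -> 0 < d -> away c s w d ->
  cabs (cauchy_transform c s w) <= 2 / d.
Proof.
move=> s0 d0 aw; apply: cantor_meanC_bound => //; first exact: away_regular aw.
by move=> x kx; exact: away_inv aw kx.
Qed.

Lemma cauchy_transform_split c s w d : 0 < s -> 0 < d -> away c s w d ->
  cauchy_transform c s w =
  (cauchy_transform c (rho * s) w + cauchy_transform (re c s) (rho * s) w) * (2^-1)%:C.
Proof. by move=> s0 d0 aw; apply: cantor_meanC_split => //; exact: away_regular aw. Qed.

Lemma notin_away c s w : ~ Kc c s (ofC w) -> exists2 d, 0 < d & away c s w d.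
Proof.
move=> nk.
have : \forall v \near ofC w, ~ Kc c s v.
  by apply: open_nbhs_nbhs; split => //; apply: closed_openC; exact: closed_cantor.
move=> /near_boxP[d d0 Hd]; exists d => // x kx; rewrite leNgt; apply/negP => wd.
apply: (Hd (x, 0)) => //=.
  apply: le_lt_trans wd; rewrite distrC; apply: le_trans (Re_le_cabs _).
  by rewrite Re_add Re_opp.
apply: le_lt_trans wd; rewrite distrC; apply: le_trans (Im_le_cabs _).
by rewrite Im_add Im_opp.
Qed.

(** The error of the first-order expansion in h of 1 / (w - x) is
    h^2 / ((w - x)^2 (w + h - x)), which is O(h^2) uniformly for x in the Cantor
    set; averaging over x keeps the bound. *)
Lemma cauchy_transform_derivable c s w : 0 < s -> ~ Kc c s (ofC w) ->
  derivable (cauchy_transform c s) w 1.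
Proof.
move=> s0 /notin_away[d d0 aw].
have rw := away_regular d0 aw.
have rw2 := regularC_mul s0 rw rw.
apply/derivable_cabsP.
exists (- cantor_meanC c s (fun x => (w - x%:C)^-1 * (w - x%:C)^-1)) => e e0.
pose B := 4 * d^-1 ^+ 3.
have di : 0 < d^-1 by rewrite invr_gt0.
have B0 : 0 < B by rewrite mulr_gt0// exprn_gt0.
exists (Num.min (d / 2) (e / B)); first by rewrite lt_min !divr_gt0.
move=> z; rewrite lt_min => /andP[zd ze].
set h := z - w in zd ze *.
have aw' : away c s z (d / 2).
  move=> x kx; have := aw x kx.
  have := cabsD (z - x%:C) (- h).
  rewrite (_ : z - x%:C + - h = w - x%:C); last by rewrite /h; ring.
  by rewrite cabsN; lra.
have d20 : 0 < d / 2 by lra.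
have rz := away_regular d20 aw'.
have E : cauchy_transform c s z - cauchy_transform c s w
   - (- cantor_meanC c s (fun x => (w - x%:C)^-1 * (w - x%:C)^-1)) * h =
   cantor_meanC c s (fun x => ((z - x%:C)^-1 + (-1) * (w - x%:C)^-1) + h * ((w - x%:C)^-1 * (w - x%:C)^-1)).
  rewrite !cantor_meanC_add ?cantor_meanC_scale//.
  - by rewrite /cauchy_transform; ring.
  - by apply: regularC_mul => //; exact: regularC_cst.
  - by apply: regularC_add => //; apply: regularC_mul => //; exact: regularC_cst.
  - by apply: regularC_mul => //; exact: regularC_cst.
rewrite E.
have R1 : regularC c s (fun x => ((z - x%:C)^-1 + (-1) * (w - x%:C)^-1) + h * ((w - x%:C)^-1 * (w - x%:C)^-1)).
  apply: regularC_add; first apply: regularC_add => //.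
    by apply: regularC_mul => //; exact: regularC_cst.
  by apply: regularC_mul => //; exact: regularC_cst.
apply: (@le_trans _ _ (2 * (cabs h ^+ 2 * (2 * d^-1 ^+ 3)))).
  apply: cantor_meanC_bound => // x kx.
  have nx := away_neq0 d0 aw kx; have nz := away_neq0 d20 aw' kx.
  rewrite (_ : _ + _ = h * h * ((w - x%:C)^-1 * (w - x%:C)^-1) * (z - x%:C)^-1); last first.
    rewrite /h; move: nx nz; move: (x%:C) => X nx nz.
    by field; rewrite nx nz.
  rewrite !cabsM expr2 -mulrA ler_wpM2l ?mulr_ge0 ?cabs_ge0//.
  have i1 := away_inv d0 aw kx.
  have i2 := away_inv d20 aw' kx.
  rewrite invf_div in i2.
  rewrite (_ : 2 * _ = d^-1 * d^-1 * (2 / d)); last ring.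
  apply: ler_pM => //; rewrite ?mulr_ge0 ?cabs_ge0//.
  by apply: ler_pM; rewrite ?cabs_ge0.
rewrite (_ : 2 * _ = cabs h * B * cabs h); last by rewrite /B; ring.
by rewrite ler_wpM2r ?cabs_ge0// -ler_pdivlMr// ltW.
Qed.

End ComplexAverage.

(** * The Cauchy transform is square integrable *)

Section SplitIntegral.
Context d (T : measurableType d) (R : realType) (mu : {measure set T -> \bar R}).

Lemma ge0_integral_cut (S P : set T) (f : T -> \bar R) :
  measurable S -> measurable P -> measurable_fun S f ->
  (forall x, S x -> (0 <= f x)%E) ->
  (\int[mu]_(x in S) f x = \int[mu]_(x in S `&` P) f x + \int[mu]_(x in S `\` P) f x)%E.
Proof.
move=> mS mP mf f0.
rewrite -[in LHS](setUIDK S P) ge0_integral_setU ?setUIDK//.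
- exact: measurableI.
- exact: measurableD.
- by apply/disj_setPS => x [[_ h] [_]].
Qed.

End SplitIntegral.

Section CauchyTransformL2.
Context (R : realType) (rho : R).
Hypothesis rho_gt0 : 0 < rho.
Hypothesis rho_le : rho <= 8^-1.
Implicit Types (c s : R) (u : R * R).
Notation mu2 := (plane_measure R).

Local Notation re := (right_end rho).

Definition cauchy_abs c s u : R := cabs (cauchy_transform rho c s (toC u)).

Lemma cauchy_abs_ge0 c s u : 0 <= cauchy_abs c s u. Proof. exact: cabs_ge0. Qed.

Let rs0 s : 0 < s -> 0 < rho * s. Proof. by move=> s0; rewrite mulr_gt0. Qed.

Lemma continuous_cauchy_abs c s u : 0 < s -> ~ cantor rho c s u -> {for u, continuous (cauchy_abs c s)}.
Proof.
move=> s0 nk.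
have /derivable_diff2[A [B [/diff2_continuous ca /diff2_continuous cb]]] :
    derivable (cauchy_transform rho c s) (toC u) 1.
  by apply: cauchy_transform_derivable => //; rewrite toCK.
rewrite (_ : cauchy_abs c s = (fun u => Num.sqrt
   (complex.Re (cauchy_transform rho c s (toC u)) * complex.Re (cauchy_transform rho c s (toC u)) +
    complex.Im (cauchy_transform rho c s (toC u)) * complex.Im (cauchy_transform rho c s (toC u))))).
  apply: (continuous_cvg _ (@sqrt_continuous R _)).
  by apply: cvgD; apply: cvgM.
by apply/funext => v; rewrite /cauchy_abs cabsE !expr2.
Qed.

Lemma measurable_cantor c s : measurable (cantor rho c s : set (plane R)).
Proof. by apply: closed_measurable_plane; exact: closed_cantor. Qed.

Lemma measurable_cauchy_abs c s (S : set (plane R)) : 0 < s -> measurable S ->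
  S `<=` ~` cantor rho c s -> measurable_fun S (cauchy_abs c s).
Proof.
move=> s0 mS sub.
apply: (@measurable_funS _ _ _ _ (~` cantor rho c s : set (plane R))) => //.
  by apply: measurableC; exact: measurable_cantor.
apply: continuous_measurable_plane; first by apply: closed_openC; exact: closed_cantor.
by move=> u; exact: continuous_cauchy_abs.
Qed.

Lemma away_out c s u : 0 < s -> ~ cantor_level rho 0 c s u -> away rho c s (toC u) (s / 4).
Proof.
move=> s0 nu x kx; have := cantor_re rho_gt0 rho_le s0 kx => /= xr.
rewrite leNgt; apply/negP => h; apply: nu.
have h1 := le_lt_trans (Re_le_cabs (toC u - x%:C)) h.
have h2 := le_lt_trans (Im_le_cabs (toC u - x%:C)) h.
move: h1 h2; rewrite Re_add Im_add Re_opp Im_opp /= oppr0 addr0.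
by move=> /ltr_normlP[h1 h2] /ltr_normlP[h3 h4]; split; rewrite ler_norml; lra.
Qed.

Let rs8 s : 0 < s -> rho * s <= s / 8.
Proof. by move=> s0; rewrite mulrC ler_pM2l. Qed.

Lemma away_sibling_right c s u : 0 < s -> cantor_level rho 0 c (rho * s) u ->
  away rho (re c s) (rho * s) (toC u) (s / 4).
Proof.
move=> s0 [+ _] x kx; have := cantor_re rho_gt0 rho_le (rs0 s0) kx => /= xr.
move=> /ler_normlP[u1 u2].
have r8 := rs8 s0; have r0 := rs0 s0.
apply: (le_trans _ (Re_le_cabs (toC u - x%:C))); rewrite Re_add Re_opp /=.
rewrite distrC (le_trans _ (ler_norm _))//; move: xr.
by rewrite /right_end mulrBl mul1r; lra.
Qed.

Lemma away_sibling_left c s u : 0 < s -> cantor_level rho 0 (re c s) (rho * s) u ->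
  away rho c (rho * s) (toC u) (s / 4).
Proof.
move=> s0 [+ _] x kx; have := cantor_re rho_gt0 rho_le (rs0 s0) kx => /= xr.
rewrite /right_end mulrBl mul1r => /ler_normlP[u1 u2].
have r8 := rs8 s0; have r0 := rs0 s0.
apply: (le_trans _ (Re_le_cabs (toC u - x%:C))); rewrite Re_add Re_opp /=.
by rewrite (le_trans _ (ler_norm _))//; lra.
Qed.

Lemma away_children c s u : 0 < s -> ~ cantor_level rho 0 c (rho * s) u ->
  ~ cantor_level rho 0 (re c s) (rho * s) u -> away rho c s (toC u) (rho * s / 4).
Proof.
move=> s0 n1 n2 x /(cantor_split rho_gt0 rho_le _ _ s0)[kx|kx].
  exact: (away_out (rs0 s0) n1 kx).
exact: (away_out (rs0 s0) n2 kx).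
Qed.

Lemma cauchy_abs_split c s u : 0 < s -> ~ cantor rho c s u ->
  cauchy_abs c s u <= (cauchy_abs c (rho * s) u + cauchy_abs (re c s) (rho * s) u) / 2.
Proof.
move=> s0 nk; have [|d d0 aw] := @notin_away _ rho c s (toC u); first by rewrite toCK.
rewrite /cauchy_abs (cauchy_transform_split rho_gt0 rho_le s0 d0 aw) cabsM cabs_real.
by rewrite [`|2^-1|]gtr0_norm// ler_wpM2r// cabsD.
Qed.

Definition L2_bound : R := 3 * (512 * rho ^+ 2 + 256 / rho ^+ 2).

Lemma L2_bound_ge0 : 0 <= L2_bound.
Proof.
apply: mulr_ge0; first exact: ler0n.
by apply: addr_ge0; [apply: mulr_ge0|apply: divr_ge0]; (exact: sqr_ge0 || exact: ler0n).
Qed.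

(** On the square of one child the transform is half that of this child, plus at
    most 4 / s from its sibling.  As (y / 2 + m)^2 <= y^2 / 3 + 4 m^2, each child
    contributes a third of the bound at scale rho * s, plus a constant.  The
    integral is scale invariant, the two thirds are less than one, and L2_bound is
    the fixed point of this recursion. *)
Lemma cauchy_abs_L2_level n c s : 0 < s ->
  (\int[mu2]_(u in cantor_level rho 0 c s `\` cantor_level rho n c s) (cauchy_abs c s u ^+ 2)%:E <= L2_bound%:E)%E.
Proof.
elim: n c s => [|n IH] c s s0.
  by rewrite setDv integral_set0 lee_fin L2_bound_ge0.
have r0 := rs0 s0.
set S := cantor_level rho 0 c s `\` cantor_level rho n.+1 c s.
have mS : measurable (S : set (plane R)) by apply: measurableD; exact: measurable_cantor_level.
have Sk : S `<=` ~` cantor rho c s by move=> u [_ nu] k; apply: nu; exact: k.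
have mct (A : set (plane R)) : measurable A -> A `<=` S -> measurable_fun A (fun u => (cauchy_abs c s u ^+ 2)%:E).
  move=> mA AS; apply/measurable_EFinP; apply: measurable_funX; apply: measurable_cauchy_abs => //.
  exact: subset_trans Sk.
have pos (A : set (plane R)) u : A u -> (0 <= (cauchy_abs c s u ^+ 2)%:E)%E by rewrite lee_fin sqr_ge0.
set P := cantor_level rho 0 c (rho * s); set Q := cantor_level rho 0 (re c s) (rho * s).
have mP : measurable (P : set (plane R)) by exact: measurable_cantor_level.
have mQ : measurable (Q : set (plane R)) by exact: measurable_cantor_level.
rewrite (ge0_integral_cut mu2 mS mP (mct _ mS (@subset_refl _ _)) (pos _)).
have mSP : measurable (S `\` P : set (plane R)) by exact: measurableD.
rewrite (ge0_integral_cut mu2 mSP mQ (mct _ mSP (@subDsetl _ _ _)) (pos _)).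
have child c' : ((c' = c) \/ (c' = re c s)) -> forall A : set (plane R), measurable A -> A `<=` S ->
    A `<=` cantor_level rho 0 c' (rho * s) `\` cantor_level rho n c' (rho * s) ->
    (forall u, A u -> cauchy_abs c s u <= cauchy_abs c' (rho * s) u / 2 + 4 / s) ->
    (\int[mu2]_(u in A) (cauchy_abs c s u ^+ 2)%:E <= (L2_bound / 3 + 256 * rho ^+ 2)%:E)%E.
  move=> hc A mA AS AB hA.
  set B := cantor_level rho 0 c' (rho * s) `\` cantor_level rho n c' (rho * s) in AB *.
  have mB : measurable (B : set (plane R)) by apply: measurableD; exact: measurable_cantor_level.
  have Bk : B `<=` ~` cantor rho c' (rho * s) by move=> u [_ nu] k; apply: nu; exact: k.
  have mcB (A' : set (plane R)) : measurable A' -> A' `<=` B -> measurable_fun A' (fun u => (cauchy_abs c' (rho * s) u ^+ 2)%:E).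
    move=> mA' AS'; apply/measurable_EFinP; apply: measurable_funX; apply: measurable_cauchy_abs => //.
    exact: subset_trans Bk.
  apply: (@le_trans _ _ (\int[mu2]_(u in A) ((3^-1)%:E * (cauchy_abs c' (rho * s) u ^+ 2)%:E + (64 / s ^+ 2)%:E))%E).
    apply: ge0_le_integral => //.
    - by move=> u _; rewrite lee_fin sqr_ge0.
    - exact: mct.
    - by apply: emeasurable_funD => //; apply: emeasurable_funM => //; exact: mcB.
    - move=> u Au; rewrite -EFinM -EFinD lee_fin.
      have h := hA u Au; have p1 := cauchy_abs_ge0 c s u; have p2 := cauchy_abs_ge0 c' (rho * s) u.
      apply: (@le_trans _ _ ((cauchy_abs c' (rho * s) u / 2 + 4 / s) ^+ 2)).
        by rewrite ler_sqr// nnegrE// addr_ge0// divr_ge0// ltW.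
      rewrite (_ : 64 / s ^+ 2 = 4 * (4 / s) ^+ 2); last by field; rewrite gt_eqF.
      move: (cauchy_abs _ _ _) (4 / s) => y m.
      have := sqr_ge0 (y / 6 - m); nra.
  rewrite ge0_integralD//; first last.
  - by move=> u _; rewrite lee_fin divr_ge0// sqr_ge0.
  - by apply: emeasurable_funM => //; exact: mcB.
  - by move=> u _; rewrite -EFinM lee_fin mulr_ge0// sqr_ge0.
  rewrite EFinD; apply: leeD.
    rewrite ge0_integralZl//; first last.
    - by move=> u _; rewrite lee_fin sqr_ge0.
    - exact: mcB.
    rewrite (_ : (L2_bound / 3)%:E = ((3^-1)%:E * L2_bound%:E)%E); last by rewrite -EFinM mulrC.
    apply: lee_wpmul2l; first by rewrite lee_fin.
    apply: le_trans (IH c' (rho * s) r0).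
    apply: ge0_subset_integral => //; first by apply: mcB.
    by move=> u _; rewrite lee_fin sqr_ge0.
  rewrite integral_cst//.
  have ms : (mu2 A <= (4 * (rho * s) ^+ 2)%:E)%E.
    apply: le_trans (mu2_cantor_level0 rho c' r0); apply: le_measure; rewrite ?inE//.
      exact: measurable_cantor_level.
    by apply: subset_trans AB _; exact: subDsetl.
  apply: (@le_trans _ _ ((64 / s ^+ 2)%:E * (4 * (rho * s) ^+ 2)%:E)%E).
    by apply: lee_wpmul2l => //; rewrite lee_fin divr_ge0// sqr_ge0.
  rewrite -EFinM lee_fin le_eqVlt; apply/orP; left; apply/eqP; field.
  by rewrite gt_eqF.
have c1 : (\int[mu2]_(x in S `&` P) (cauchy_abs c s x ^+ 2)%:E <= (L2_bound / 3 + 256 * rho ^+ 2)%:E)%E.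
  apply: (child c); first by left.
  - exact: measurableI.
  - exact: subIsetl.
  - by move=> u [[_ nu] Pu]; split => // h; apply: nu; left.
  - move=> u [Su Pu]; have := cauchy_abs_split s0 (Sk _ Su).
    have := cauchy_transform_bound rho_gt0 rho_le r0 _ (away_sibling_right s0 Pu).
    rewrite -/(cauchy_abs _ _ _) => /(_ ltac:(rewrite divr_gt0//)).
    rewrite (_ : 2 / (s / 4) = 2 * (4 / s)); last by field; rewrite gt_eqF.
    lra.
have c2 : (\int[mu2]_(x in (S `\` P) `&` Q) (cauchy_abs c s x ^+ 2)%:E <= (L2_bound / 3 + 256 * rho ^+ 2)%:E)%E.
  apply: (child (re c s)); first by right.
  - exact: measurableI.
  - by move=> u [[]].
  - by move=> u [[[_ nu] _] Qu]; split => // h; apply: nu; right.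
  - move=> u [[Su _] Qu]; have := cauchy_abs_split s0 (Sk _ Su).
    have := cauchy_transform_bound rho_gt0 rho_le r0 _ (away_sibling_left s0 Qu).
    rewrite -/(cauchy_abs _ _ _) => /(_ ltac:(rewrite divr_gt0//)).
    rewrite (_ : 2 / (s / 4) = 2 * (4 / s)); last by field; rewrite gt_eqF.
    lra.
have c3 : (\int[mu2]_(x in (S `\` P) `\` Q) (cauchy_abs c s x ^+ 2)%:E <= (256 / rho ^+ 2)%:E)%E.
  have mD : measurable ((S `\` P) `\` Q : set (plane R)) by exact: measurableD.
  apply: (@le_trans _ _ (\int[mu2]_(x in (S `\` P) `\` Q) ((8 / (rho * s)) ^+ 2)%:E)%E).
    apply: ge0_le_integral => //.
    - by move=> u _; rewrite lee_fin sqr_ge0.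
    - by apply: mct => // u [[]].
    - move=> u [[_ nP] nQ]; rewrite lee_fin ler_sqr ?nnegrE ?cauchy_abs_ge0//; last first.
        by rewrite divr_ge0// ltW.
      have := cauchy_transform_bound rho_gt0 rho_le s0 _ (away_children s0 nP nQ).
      rewrite -/(cauchy_abs _ _ _) => /(_ ltac:(rewrite divr_gt0//)).
      by rewrite (_ : 2 / (rho * s / 4) = 8 / (rho * s)); last by field; rewrite !gt_eqF.
  rewrite integral_cst//.
  apply: (@le_trans _ _ (((8 / (rho * s)) ^+ 2)%:E * (4 * s ^+ 2)%:E)%E).
    apply: lee_wpmul2l; first by rewrite lee_fin sqr_ge0.
    apply: le_trans (mu2_cantor_level0 rho c s0); apply: le_measure; rewrite ?inE//.
      exact: measurable_cantor_level.
    by move=> u [[[]]].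
  rewrite -EFinM lee_fin le_eqVlt; apply/orP; left; apply/eqP; field.
  by rewrite !gt_eqF.
apply: (le_trans (leeD c1 (leeD c2 c3))).
by rewrite -!EFinD lee_fin /L2_bound; have := sqr_ge0 rho; lra.
Qed.

End CauchyTransformL2.

(** * The two kernels differ *)

Section CauchyTransformDisc.
Context (R : realType) (rho : R).
Hypothesis rho_gt0 : 0 < rho.
Hypothesis rho_le : rho <= 8^-1.
Notation mu2 := (plane_measure R).
Notation F := (cauchy_abs rho 1 1).
Notation E := (cantor rho 1 1).
Notation Q := (cantor_level rho 0 1 1).

Let mE : measurable (E : set (plane R)). Proof. exact: measurable_cantor. Qed.
Let mQ : measurable (Q : set (plane R)). Proof. exact: measurable_cantor_level. Qed.

Let QE : Q `\` E = \bigcup_n (Q `\` cantor_level rho n 1 1).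
Proof.
apply/seteqP; split => [u [Qu nE]|u [n _ [Qu nu]]]; last first.
  by split => // h; apply: nu; exact: h.
apply: contrapT => h; apply: nE => n _; apply: contrapT => nu.
by apply: h; exists n.
Qed.

Let mF (S : set (plane R)) : measurable S -> S `<=` ~` E -> measurable_fun S F.
Proof. by move=> mS; exact: measurable_cauchy_abs. Qed.

Lemma cauchy_abs_L2_square : (\int[mu2]_(u in Q `\` E) (F u ^+ 2)%:E <= (L2_bound rho)%:E)%E.
Proof.
have cv : (\int[mu2]_(u in Q `\` cantor_level rho n 1 1) (F u ^+ 2)%:E)%E @[n --> \oo] -->
    (\int[mu2]_(u in \bigcup_n (Q `\` cantor_level rho n 1 1)) (F u ^+ 2)%:E)%E.
  apply: ge0_nondecreasing_set_cvg_integral.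
  - apply/nondecreasing_seqP => n; apply/subsetPset => u [Qu nu]; split => // h.
    by apply: nu; apply: (cantor_levelS rho_gt0 rho_le ltr01).
  - by move=> n; apply: measurableD => //; exact: measurable_cantor_level.
  - move=> n; apply/measurable_EFinP; apply: measurable_funX; apply: mF.
      by apply: measurableD => //; exact: measurable_cantor_level.
    by move=> u [_ nu] k; apply: nu; exact: k.
  - by move=> n u _; rewrite lee_fin sqr_ge0.
rewrite QE -(cvg_lim _ cv)//; apply: lime_le; first by apply/cvg_ex; eexists; exact: cv.
by apply: nearW => n; exact: cauchy_abs_L2_level.
Qed.

Variable Rad : R.
Hypothesis Rad_gt0 : 0 < Rad.
Local Notation om := (disc_minus_cantor rho Rad).
Let mom : measurable (om : set (plane R)) := measurable_disc_minus_cantor rho Rad.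
Let V := fine (mu2 om).

Let VE : mu2 om = V%:E.
Proof. by rewrite fineK// ge0_fin_numE//; exact: mu2_disc_minus_cantor_lty. Qed.

Let omE : om `<=` ~` E. Proof. by move=> u []. Qed.

Let cauchy_abs_far u : ~ Q u -> F u <= 8.
Proof.
move=> nQ; have := cauchy_transform_bound rho_gt0 rho_le ltr01 _ (away_out rho_gt0 rho_le ltr01 nQ).
by move=> /(_ ltac:(lra)); rewrite (_ : 2 / (1 / 4) = 8) //; field.
Qed.

Definition box20 : set (plane R) := rect (- 20) (- 20) 40 40.

Let cauchy_abs_very_far u : ~ box20 u -> F u <= 8^-1.
Proof.
move=> nB.
have aw : away rho 1 1 (toC u) 16.
  move=> x kx; have := cantor_re rho_gt0 rho_le ltr01 kx => /= xr.
  rewrite leNgt; apply/negP => h; apply: nB.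
  have h1 := le_lt_trans (Re_le_cabs (toC u - x%:C)) h.
  have h2 := le_lt_trans (Im_le_cabs (toC u - x%:C)) h.
  move: h1 h2; rewrite Re_add Im_add Re_opp Im_opp /= oppr0 addr0.
  by move=> /ltr_normlP[h1 h2] /ltr_normlP[h3 h4]; split; rewrite /= in_itv/=; lra.
have := cauchy_transform_bound rho_gt0 rho_le ltr01 _ aw.
by move=> /(_ ltac:(lra)); rewrite (_ : 2 / 16 = 8^-1) //; field.
Qed.

Definition L1_bound : R := 4 + L2_bound rho + 8 * 1600.

(** Beyond box20 the transform is at most 1/8; what happens inside does not depend
    on the radius of the disc. *)
Lemma cauchy_abs_L1_disc : (\int[mu2]_(u in om) (F u)%:E <= (L1_bound + 8^-1 * V)%:E)%E.
Proof.
have pos (A : set (plane R)) u : A u -> (0 <= (F u)%:E)%E by rewrite lee_fin cauchy_abs_ge0.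
have mFE (A : set (plane R)) : measurable A -> A `<=` om -> measurable_fun A (fun u => (F u)%:E).
  by move=> mA AS; apply/measurable_EFinP; apply: mF => //; exact: subset_trans omE.
have mB : measurable box20 by exact: measurable_rect.
rewrite (ge0_integral_cut mu2 mom mQ (mFE _ mom (@subset_refl _ _)) (pos _)).
have mOQ : measurable (om `\` Q : set (plane R)) by exact: measurableD.
rewrite (ge0_integral_cut mu2 mOQ mB (mFE _ mOQ (@subDsetl _ _ _)) (pos _)).
have mQE : measurable (Q `\` E : set (plane R)) by exact: measurableD.
have mFQ : measurable_fun (Q `\` E : set (plane R)) F by apply: mF => // u [].
have i1 : (\int[mu2]_(u in om `&` Q) (F u)%:E <= (4 + L2_bound rho)%:E)%E.
  apply: (@le_trans _ _ (\int[mu2]_(u in Q `\` E) (F u)%:E)%E).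
    apply: ge0_subset_integral => //; first exact: measurableI.
    - exact/measurable_EFinP.
    - by move=> u _; rewrite lee_fin cauchy_abs_ge0.
    - by move=> u [[_ nE] Qu].
  apply: (@le_trans _ _ (\int[mu2]_(u in Q `\` E) (1%:E + (F u ^+ 2)%:E))%E).
    apply: ge0_le_integral => //.
    - by move=> u _; rewrite lee_fin cauchy_abs_ge0.
    - exact/measurable_EFinP.
    - by apply: emeasurable_funD => //; apply/measurable_EFinP; exact: measurable_funX.
    - move=> u _; rewrite -EFinD lee_fin; have := sqr_ge0 (F u - 1); have := sqr_ge0 (F u); nra.
  rewrite ge0_integralD//; first last.
  - by apply/measurable_EFinP; exact: measurable_funX.
  - by move=> u _; rewrite lee_fin sqr_ge0.
  rewrite EFinD; apply: leeD; last exact: cauchy_abs_L2_square.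
  rewrite integral_cst// mul1e.
  apply: (@le_trans _ _ (mu2 Q)); first by apply: le_measure; rewrite ?inE//; exact: subDsetl.
  by apply: (le_trans (mu2_cantor_level0 rho 1 ltr01)); rewrite lee_fin; lra.
have i2 : (\int[mu2]_(u in (om `\` Q) `&` box20) (F u)%:E <= (8 * 1600)%:E)%E.
  have mA : measurable ((om `\` Q) `&` box20) by exact: measurableI.
  apply: (@le_trans _ _ (\int[mu2]_(u in (om `\` Q) `&` box20) 8%:E)%E).
    apply: ge0_le_integral => //.
    - by move=> u _; rewrite lee_fin cauchy_abs_ge0.
    - by apply: mFE => // u [[]].
    - by move=> u [[_ nQ] _]; rewrite lee_fin; exact: cauchy_abs_far.
  rewrite integral_cst// EFinM; apply: lee_wpmul2l; first by rewrite lee_fin.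
  apply: (@le_trans _ _ (mu2 box20)); first by apply: le_measure; rewrite ?inE//; exact: subIsetr.
  have -> : mu2 box20 = (40 * 40)%:E by apply: mu2_rect; lra.
  by rewrite lee_fin; lra.
have i3 : (\int[mu2]_(u in (om `\` Q) `\` box20) (F u)%:E <= (8^-1 * V)%:E)%E.
  have mA : measurable ((om `\` Q) `\` box20) by exact: measurableD.
  apply: (@le_trans _ _ (\int[mu2]_(u in (om `\` Q) `\` box20) (8^-1)%:E)%E).
    apply: ge0_le_integral => //.
    - by move=> u _; rewrite lee_fin cauchy_abs_ge0.
    - by apply: mFE => // u [[]].
    - by move=> u [_ nB]; rewrite lee_fin; exact: cauchy_abs_very_far.
  rewrite integral_cst// EFinM; apply: lee_wpmul2l; first by rewrite lee_fin.
  by rewrite -VE; apply: le_measure; rewrite ?inE// => u [[]].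
apply: (le_trans (leeD i1 (leeD i2 i3))).
by rewrite -!EFinD lee_fin /L1_bound addrA.
Qed.

Lemma cauchy_abs_L2_disc : (\int[mu2]_(u in om) (F u ^+ 2)%:E < +oo)%E.
Proof.
have pos (A : set (plane R)) u : A u -> (0 <= (F u ^+ 2)%:E)%E by rewrite lee_fin sqr_ge0.
have mFE (A : set (plane R)) : measurable A -> A `<=` ~` E -> measurable_fun A (fun u => (F u ^+ 2)%:E).
  by move=> mA AS; apply/measurable_EFinP; apply: measurable_funX; exact: mF.
rewrite (ge0_integral_cut mu2 mom mQ (mFE _ mom omE) (pos _)).
have mQE : measurable (Q `\` E : set (plane R)) by exact: measurableD.
have mOQ : measurable (om `\` Q : set (plane R)) by exact: measurableD.
have i1 : (\int[mu2]_(u in om `&` Q) (F u ^+ 2)%:E <= (L2_bound rho)%:E)%E.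
  apply: le_trans cauchy_abs_L2_square; apply: ge0_subset_integral => //; first exact: measurableI.
  - by apply: mFE => // u [].
  - by move=> u _; rewrite lee_fin sqr_ge0.
  - by move=> u [[_ nE] Qu].
have i2 : (\int[mu2]_(u in om `\` Q) (F u ^+ 2)%:E <= (64 * V)%:E)%E.
  apply: (@le_trans _ _ (\int[mu2]_(u in om `\` Q) 64%:E)%E).
    apply: ge0_le_integral => //.
    - by move=> u _; rewrite lee_fin sqr_ge0.
    - by apply: mFE => // u [/omE].
    - move=> u [_ nQ]; rewrite lee_fin (_ : 64 = 8 ^+ 2); last by ring.
      by rewrite ler_sqr ?nnegrE ?cauchy_abs_ge0//; exact: cauchy_abs_far.
  rewrite integral_cst// EFinM; apply: lee_wpmul2l; first by rewrite lee_fin.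
  by rewrite -VE; apply: le_measure; rewrite ?inE// => u [].
apply: (le_lt_trans (leeD i1 i2)).
by rewrite -EFinD ltry.
Qed.

Lemma volume_lb (L : R) : 0 < L -> Rad = 2 * L -> L * L <= V.
Proof.
move=> L0 RL.
have mr : measurable (rect (- L) (- L) L L) by exact: measurable_rect.
have : (mu2 (rect (- L) (- L) L L) <= mu2 om)%E.
  apply: le_measure; rewrite ?inE// => u [/=]; rewrite !in_itv/= => u1 u2.
  split; last by move=> /(cantor_re rho_gt0 rho_le ltr01) /=; lra.
  have h1 : u.1 ^+ 2 <= L ^+ 2.
    by rewrite -[u.1 ^+ 2]real_normK ?num_real// ler_sqr ?nnegrE ?(ltW L0)// ler_norml; lra.
  have h2 : u.2 ^+ 2 <= L ^+ 2.
    by rewrite -[u.2 ^+ 2]real_normK ?num_real// ler_sqr ?nnegrE ?(ltW L0)// ler_norml; lra.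
  rewrite /= /norm2 RL exprMn; have : 0 < L ^+ 2 by rewrite exprn_gt0.
  lra.
have -> : mu2 (rect (- L) (- L) L L) = (L * L)%:E by apply: mu2_rect; exact: ltW.
by rewrite VE lee_fin.
Qed.

(** The transform at 0 is the mean of - 1 / x, with x at most 33 / 16. *)
Lemma cauchy_transform0 : complex.Re (cauchy_transform rho 1 1 (0 : Cplx R)) <= - 4^-1.
Proof.
have xr x : E (x, 0) -> 15 / 16 <= x <= 33 / 16.
  by move=> /(cantor_re rho_gt0 rho_le ltr01) /=; lra.
have aw : away rho 1 1 (0 : Cplx R) 2^-1.
  move=> x /xr xx; rewrite sub0r cabsN cabs_real ger0_norm; lra.
have h := away_regular (ltac:(by []) : 0 < 2^-1 :> R) aw.
have := @cantor_mean_itv _ rho rho_gt0 rho_le 1 1 _ (-2) (- 4^-1) ltr01 (regularC_Re h).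
move=> H; suff H2 x : E (x, 0) -> -2 <= complex.Re (((0 : Cplx R) - x%:C)^-1) <= - 4^-1.
  by have /andP[] := H H2.
move=> kx; have xx := xr x kx.
have x0 : 0 < x by lra.
rewrite sub0r -rmorphN -fmorphV /= invrN.
have i1 : x^-1 <= 2 by rewrite -[leRHS]invrK lef_pV2 ?posrE; lra.
have i2 : 4^-1 <= x^-1 by rewrite lef_pV2 ?posrE; lra.
lra.
Qed.

End CauchyTransformDisc.

(** The condition reads 8 < scale^(p - 2). *)
Lemma scale_choice (R : realType) (p : R) : 2 < p ->
  exists scale : R, 2 <= scale /\ 8 * scale ^+ 2 * scale^-1 `^ p < 1.
Proof.
move=> p2; have p20 : 0 < p - 2 by rewrite subr_gt0.
pose t : R := 8 `^ (p - 2)^-1.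
have t0 : 0 <= t by exact: powR_ge0.
exists (t + 2); split; first lra.
set scale := t + 2; have scale_gt0 : 0 < scale by rewrite /scale; lra.
have h8 : 8 < scale `^ (p - 2).
  have -> : 8 = t `^ (p - 2) by rewrite /t -powRrM mulVf ?gt_eqF// powRr1.
  by apply: gt0_ltr_powR => //; rewrite ?nnegrE ?(ltW scale_gt0)// /scale; lra.
have -> : scale^-1 `^ p = (scale ^+ 2 * scale `^ (p - 2))^-1.
  rewrite -powR_mulrn ?(ltW scale_gt0)// -powRD; last by apply/implyP => _; rewrite gt_eqF.
  rewrite (_ : 2 + (p - 2) = p); last by ring.
  rewrite -powR_inv1 ?(ltW scale_gt0)// -powRrM mulN1r powRN//.
have m2 : 0 < scale ^+ 2 by rewrite exprn_gt0.
rewrite ltr_pdivrMr ?mulr_gt0 ?powR_gt0// mul1r mulrC ltr_pM2l//.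
Qed.

Theorem proposition1p3 (R : realType) (p : R) (hp : 2 < p) :
  exists (Omega : set (Cplx R)) (z : Cplx R),
    [/\ bounded_domain Omega, Omega z &
        ~ (forall w, Omega w -> pBergman Omega p w z = K2p Omega p z w z)].
Proof.
have [scale [mm2 mmp]] := scale_choice hp.
pose rho := ratio scale.
have r0 : 0 < rho := ratio_gt0 mm2.
have r8 : rho <= 8^-1 := ratio_le mm2.
(* the volume is at least L ^ 2 >= L, which exceeds 8 * L1_bound *)
pose L := 8 * L1_bound rho + 1.
have C0 : 0 <= L1_bound rho by rewrite /L1_bound; have := L2_bound_ge0 rho; lra.
have L0 : 0 < L by rewrite /L; lra.
pose Rad := 2 * L.
have Rad0 : 0 < Rad by rewrite mulr_gt0.
exists (cantor_domain rho Rad), 0; split.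
- exact: bounded_cantor_domain.
- exact: cantor_domain0.
move=> H.
have pc := pBergman_constant mm2 hp mmp Rad0.
set Om := cantor_domain _ _ in H pc *.
set V := fine _ in pc.
have V0 : 0 < V := volume_gt0 mm2 Rad0.
have O0 : Om 0 by exact: cantor_domain0.
set phi := minimizer_weight Om p 0.
have phi0 w : Om w -> phi w = 0.
  move=> ow; rewrite /phi /minimizer_weight (minimizer_eq1 mm2 hp mmp Rad0 ow) cabs1 ln1 mulr0//.
pose f := cauchy_transform rho 1 1.
have wf : weighted_bergman_space Om phi f.
  split.
    by move=> w [_ nk]; apply: cauchy_transform_derivable.
  rewrite cintegral_cantor_domain; under eq_integral => u.
    rewrite inE => ou; rewrite phi0; last by rewrite /Om cantor_domain_toC.
    rewrite oppr0 expR0 mulr1; over.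
  exact: cauchy_abs_L2_disc.
(* without a reproducing kernel K2p would be 0, but pBergman at (0, 0) is 1 / V *)
have [[K HK]|nK] := pselect (exists K, is_reproducing_kernel Om phi K); last first.
  have := H 0 O0; rewrite pc// /K2p /weighted_bergman_kernel xgetPN.
    by move=> /eqP; rewrite eq_complex /= invr_eq0 gt_eqF.
  by move=> K HK; apply: nK; exists K.
have HK' : is_reproducing_kernel Om phi (K2p Om p 0).
  by apply: (@xgetPex _ (fun _ _ => 0) [set K | is_reproducing_kernel Om phi K]); exists K.
have [_ /(_ f wf)] := HK' 0 O0.
move=> /(congr1 (@complex.Re R)).
rewrite /cintegralC; set lhs := complex.Re (f 0).
rewrite /= cintegral_cantor_domain.
under eq_integral => u.
  rewrite inE => ou; have oo : Om (toC u) by rewrite /Om cantor_domain_toC.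
  rewrite -H// pc// phi0// oppr0 expR0.
  rewrite (_ : complex.Re _ = V^-1 * complex.Re (f (toC u))); last first.
    by rewrite !(Re_mul, Im_mul) /=; ring.
  over.
have iF : (plane_measure R).-integrable (disc_minus_cantor rho Rad) (EFin \o cauchy_abs rho 1 1).
  apply/integrableP; split.
    apply/measurable_EFinP; apply: measurable_cauchy_abs => //; first exact: measurable_disc_minus_cantor.
    by move=> u [].
  under eq_integral do rewrite /= ger0_norm ?cauchy_abs_ge0//.
  by apply: le_lt_trans (cauchy_abs_L1_disc r0 r8 Rad0) _; rewrite ltry.
have ia : (plane_measure R).-integrable (disc_minus_cantor rho Rad) (EFin \o fun u => complex.Re (f (toC u))).
  apply: (le_integrable (measurable_disc_minus_cantor _ _) _ _ iF).
    apply/measurable_EFinP; apply: (@measurable_Re_on _ scale Rad) => w [_ nk].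
    exact: cauchy_transform_derivable.
  by move=> u _; rewrite /= lee_fin [leRHS]ger0_norm ?cauchy_abs_ge0//; exact: (Re_le_cabs (f (toC u))).
rewrite -/(Rintegral _ _ _) RintegralZl//; last exact: measurable_disc_minus_cantor.
move=> E0.
have f0 : lhs <= - 4^-1 by exact: cauchy_transform0 r0 r8.
rewrite E0 in f0.
have b1 : `|\int[plane_measure R]_(u in disc_minus_cantor rho Rad) complex.Re (f (toC u))| <= L1_bound rho + 8^-1 * V.
  apply: (le_trans (le_normr_Rintegral (measurable_disc_minus_cantor _ _) ia)).
  apply: (@le_trans _ _ (\int[plane_measure R]_(u in disc_minus_cantor rho Rad) cauchy_abs rho 1 1 u)).
    apply: le_Rintegral => //; [exact: measurable_disc_minus_cantor|exact: integrable_norm|].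
    by move=> u _; exact: (Re_le_cabs (f (toC u))).
  rewrite -lee_fin fineK; last exact: (integrable_fin_num (measurable_disc_minus_cantor _ _) iF).
  exact: cauchy_abs_L1_disc.
have VL : L * L <= V by apply: (volume_lb r0 r8 Rad0).
have L1 : 1 <= L by rewrite /L; lra.
have LL : L * 1 <= L * L by rewrite ler_pM2l.
have VL' : L <= V by rewrite mulr1 in LL; exact: le_trans LL VL.
move: b1 f0; set I := Rintegral _ _ _ => b1 f0.
have : V * (V^-1 * I) <= V * - 4^-1 by rewrite ler_pM2l.
rewrite mulrA divff ?gt_eqF// mul1r.
move: b1 => /ler_normlP[b1 b2]; rewrite /L in VL' => b3.
lra.
Qed.
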